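(* Let $\mathcal{L}$ be an operator with fundamental solution $\Gamma$ satisfying the standing assumptions given in the context. Let $f,u:\mathbb{R}^n\to\mathbb{R}$ be compactly supported continuous functions. Then $$\mathcal{L}_a u=-f\ \text{ in }\mathbb{R}^n$$ (that is, $u\in\mathcal{A}(\mathbb{R}^n,\mathcal{L})$ and $\mathcal{L}_a u(x)=-f(x)$ for every $x\in\mathbb{R}^n$) if and only if $$\mathcal{L}u=-f\ \text{ in }\mathcal{D}'(\mathbb{R}^n),$$ i.e. in the weak sense of distributions.
   Context: Standing assumptions. $\mathcal{L}$ is the partial differential operator on $\mathbb{R}^n$ $$\mathcal{L}=\sum_{i,j=1}^n\partial_{x_i}\bigl(a_{ij}(x)\,\partial_{x_j}\bigr),$$ where $A(x)=(a_{ij}(x))_{i,j=1,\dots,n}$ is, for every $x\in\mathbb{R}^n$, a real symmetric nonnegative definite matrix, the functions $a_{ij}$ are smooth ($C^\infty$) on $\mathbb{R}^n$, and $\sum_{i=1}^n a_{ii}(x)>0$ for every $x\in\mathbb{R}^n$. Moreover $\mathcal{L}$ is hypoelliptic in $\mathbb{R}^n$ (every distribution $u$ on an open set with $\mathcal{L}u$ smooth there is itself smooth there), and $\mathcal{L}$ is endowed with a fundamental solution $\Gamma:\{(x,y)\in\mathbb{R}^n\times\mathbb{R}^n: x\ne y\}\to\mathbb{R}$, smooth on its domain, such that (i) $\Gamma(x,y)=\Gamma(y,x)>0$ for all $x\neq y$; (ii) $\lim_{x\to y}\Gamma(x,y)=\infty$ for every $y\in\mathbb{R}^n$; (iii) $\lim_{x\to\infty}\bigl(\sup_{y\in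 K}\Gamma(x,y)\bigr)=0$ for every compact set $K\subseteq\mathbb{R}^n$; (iv) $\Gamma(x,\cdot)\in L^1_{\rm loc}(\mathbb{R}^n)$ for every $x\in\mathbb{R}^n$. That $\Gamma$ is a fundamental solution of $\mathcal{L}$ means: for every $\varphi\in C_0^\infty(\mathbb{R}^n,\mathbb{R})$ and every $x\in\mathbb{R}^n$, $\int_{\mathbb{R}^n}\Gamma(x,y)\,\mathcal{L}\varphi(y)\,dy=-\varphi(x)$. Set $\Gamma(x,x):=+\infty$. $\mathcal{L}$-balls and averages. For $x\in\mathbb{R}^n$ and $r>0$, $\Omega_r(x):=\{y\in\mathbb{R}^n:\Gamma(x,y)>1/r\}$. Fix a real number $\alpha>-1$. For a continuous function $u:\mathbb{R}^n\to\mathbb{R}$ define $$M_r(u)(x):=\frac{\alpha+1}{r^{\alpha+1}}\int_{\Omega_r(x)}u(y)\,K(x,y)\,dy,\qquad K(x,y):=\frac{\langle A(y)\nabla_y\Gamma(x,y),\nabla_y\Gamma(x,y)\rangle}{(\Gamma(x,y))^{\alpha+2}},$$ and $$Q_r(x):=\frac{\alpha+1}{r^{\alpha+1}}\int_0^r\rho^\alpha\left(\int_{\Omega_\rho(x)}\Bigl(\Gamma(x,y)-\frac1\rho\Bigr)dy\right)d\rho.$$ Asymptotic average operator. $\mathcal{A}(\mathbb{R}^n,\mathcal{L})$ is the set of continuous functions $u:\mathbb{R}^n\to\mathbb{R}$ such that the limit $$\mathcal{L}_a u(x):=\lim_{r\to0^+}\frac{M_r(u)(x)-u(x)}{Q_r(x)}$$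 exists in $\mathbb{R}$ at every point $x\in\mathbb{R}^n$. *)

(* Defs.v *)
From HB Require Import structures.
From mathcomp Require Import all_boot all_order all_algebra.
From mathcomp Require Import all_classical all_reals all_analysis.

Set Implicit Arguments.
Unset Strict Implicit.
Unset Printing Implicit Defensive.

Import Order.TTheory GRing.Theory Num.Theory.
Import numFieldNormedType.Exports.

Local Open Scope classical_set_scope.
Local Open Scope ring_scope.

(* R^n is 'rV[R]_n, with the topology and the (sup) norm of the library. The
   library has no Lebesgue measure in dimension n: it is built here on the
   sigma-algebra generated by the coordinates (the Borel sigma-algebra), by
   iterating the library's product measure. *)

Section measurable_rV.
Variables (R : realType) (n : nat).

Definition rV_coord (i : 'I_n) (v : 'rV[R]_n) : measurableTypeR R := v ord0 i.

Let rV_set0 : g_sigma_preimage rV_coord set0.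
Proof. exact: sigma_algebra0. Qed.

Let rV_setC A : g_sigma_preimage rV_coord A -> g_sigma_preimage rV_coord (~` A).
Proof. exact: sigma_algebraC. Qed.

Let rV_bigcup (F : (set 'rV[R]_n)^nat) :
  (forall i, g_sigma_preimage rV_coord (F i)) ->
  g_sigma_preimage rV_coord (\bigcup_i (F i)).
Proof. exact: sigma_algebra_bigcup. Qed.

HB.instance Definition _ := @isMeasurable.Build default_measure_display
  'rV[R]_n (g_sigma_preimage rV_coord) rV_set0 rV_setC rV_bigcup.

End measurable_rV.

Section measurable_rV_theory.
Variable R : realType.

Lemma measurable_rV_coord n (i : 'I_n) :
  measurable_fun [set: 'rV[R]_n] (@rV_coord R n i).
Proof.
move=> _ Y mY; rewrite setTI; apply: sub_sigma_algebra => /=.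
rewrite -bigcup_seq/=; exists i => /=; first by rewrite mem_index_enum.
by exists Y => //; rewrite setTI.
Qed.

Lemma measurable_fun_rVP d (T : measurableType d) n (f : T -> 'rV[R]_n) :
  (forall i, measurable_fun [set: T] (@rV_coord R n i \o f)) ->
  measurable_fun [set: T] f.
Proof.
move=> mf.
have : g_sigma_preimage (fun i => @rV_coord R n i \o f) `<=` measurable.
  apply: smallest_sub; first exact: sigma_algebra_measurable.
  case: n => [|n] in f mf *; first by rewrite big_ord0.
  rewrite -bigcup_mkord_ord; apply: bigcup_sub => i Ii.
  by move=> A [B mB <-]; exact: mf.
by rewrite g_sigma_preimage_comp => sub _ Y mY; apply: sub; exists Y.
Qed.

Definition rV_cons n (p : measurableTypeR R * 'rV[R]_n) : 'rV[R]_n.+1 :=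
  row_mx (const_mx p.1 : 'rV[R]_1) p.2.

Definition rV_uncons n (v : 'rV[R]_n.+1) : measurableTypeR R * 'rV[R]_n :=
  (v ord0 ord0, rsubmx (v : 'rV[R]_(1 + n))).

Lemma rV_consK n : cancel (@rV_cons n) (@rV_uncons n).
Proof.
case=> x v; rewrite /rV_uncons /rV_cons/=; congr pair; last by rewrite row_mxKr.
have -> : (ord0 : 'I_n.+1) = lshift n (ord0 : 'I_1) by exact: val_inj.
by rewrite (row_mxEl (const_mx x : 'rV[R]_1)) mxE.
Qed.

Lemma measurable_rV_cons n : measurable_fun setT (@rV_cons n).
Proof.
apply: measurable_fun_rVP => i.
have [j ->|j ->] := @split_ordP 1 n i.
  rewrite (_ : _ \o _ = fst) //; apply/funext => -[x v] /=.
  by rewrite /rV_coord /rV_cons (row_mxEl (const_mx x : 'rV[R]_1)) ord1 mxE.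
rewrite (_ : _ \o _ = @rV_coord R n j \o snd).
  exact: (measurableT_comp (measurable_rV_coord j)).
apply/funext => -[x v] /=.
by rewrite /rV_coord /rV_cons (row_mxEr (const_mx x : 'rV[R]_1)).
Qed.

Lemma measurable_rV_uncons n : measurable_fun setT (@rV_uncons n).
Proof.
apply/measurable_fun_pair; first exact: (measurable_rV_coord ord0).
apply: measurable_fun_rVP => i.
rewrite (_ : _ \o _ = @rV_coord R n.+1 (rshift 1 i)).
  exact: measurable_rV_coord.
by apply/funext => v; rewrite /= /rV_coord mxE.
Qed.

Section lebesgue_step.
Variables (n : nat) (mu : {sigma_finite_measure set 'rV[R]_n -> \bar R}).

Let prod_mu : {measure set _ -> \bar R} := (@lebesgue_measure R \x mu)%E.

Definition lebesgue_rV_step : set 'rV[R]_n.+1 -> \bar R :=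
  pushforward prod_mu (@rV_cons n).

Let step0 : lebesgue_rV_step set0 = 0%E.
Proof. by rewrite /lebesgue_rV_step /pushforward preimage_set0 (measure0 prod_mu). Qed.

Let step_ge0 B : (0 <= lebesgue_rV_step B)%E.
Proof. exact: (measure_ge0 prod_mu). Qed.

Let step_sigma_additive : semi_sigma_additive lebesgue_rV_step.
Proof.
move=> F mF tF mUF; rewrite /lebesgue_rV_step /pushforward preimage_bigcup.
apply: (@measure_semi_sigma_additive _ _ _ prod_mu).
- by move=> k; rewrite -[X in measurable X]setTI; exact: measurable_rV_cons.
- apply/trivIsetP => /= i j _ _ ij; rewrite -preimage_setI.
  by move/trivIsetP : tF => /(_ _ _ _ _ ij) ->//; rewrite preimage_set0.
- rewrite -preimage_bigcup -[X in measurable X]setTI.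
  exact: measurable_rV_cons.
Qed.

HB.instance Definition _ := isMeasure.Build _ _ _ lebesgue_rV_step
  step0 step_ge0 step_sigma_additive.

Let step_sigma_finite : sigma_finite setT lebesgue_rV_step.
Proof.
have /sigma_finiteP[F [TF ndF Foo]] := sigma_finiteT (@lebesgue_measure R).
have /sigma_finiteP[G [TG ndG Goo]] := sigma_finiteT mu.
exists (fun k => @rV_uncons n @^-1` (F k `*` G k)).
  rewrite -preimage_bigcup -[LHS](preimage_setT (@rV_uncons n)); congr (_ @^-1` _).
  rewrite -setXTT TF TG predeqE => -[x y]; split.
    move=> [/= [k _ Fkx] [l _ Gly]]; exists (maxn k l) => //; split.
    - by move: x Fkx; exact/subsetPset/ndF/leq_maxl.
    - by move: y Gly; exact/subsetPset/ndG/leq_maxr.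
  by move=> [k _ []/= ? ?]; split; exists k.
move=> k; have [mF Fk] := Foo k; have [mG Gk] := Goo k; split.
  rewrite -[X in measurable X]setTI; apply: measurable_rV_uncons => //.
  exact: measurableX.
rewrite /lebesgue_rV_step /pushforward -comp_preimage.
rewrite (_ : _ \o _ = id); last by apply/funext => p; exact: rV_consK.
by rewrite preimage_id /= product_measure1E// lte_mul_pinfty// ge0_fin_numE.
Qed.

HB.instance Definition _ := Measure_isSigmaFinite.Build _ _ _
  lebesgue_rV_step step_sigma_finite.

End lebesgue_step.

Fixpoint lebesgue_rV n : {sigma_finite_measure set 'rV[R]_n -> \bar R} :=
  if n is m.+1 return {sigma_finite_measure set 'rV[R]_n -> \bar R}
  then lebesgue_rV_step (lebesgue_rV m) else dirac (0 : 'rV[R]_0).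

End measurable_rV_theory.
Arguments lebesgue_rV {R n}.

Section smooth_functions.
Variables (R : realType) (n : nat).
Implicit Types (f g : 'rV[R]_n -> R) (Omega : set 'rV[R]_n).

Definition partial (i : 'I_n) f : 'rV[R]_n -> R := 'D_(delta_mx ord0 i) f.

(* multi-indices are given as words: partials s f = d_(s_1) ... d_(s_k) f *)
Definition partials (s : seq 'I_n) f : 'rV[R]_n -> R := foldr partial f s.

Definition smooth_on Omega f : Prop :=
  forall (s : seq 'I_n) (x : 'rV[R]_n), Omega x ->
    {for x, continuous (partials s f)} /\
    forall i : 'I_n, derivable (partials s f) x (delta_mx ord0 i).

Definition tsupp f : set 'rV[R]_n := closure [set x | f x != 0].

(* C_0^oo(Omega), each function being extended by 0 outside Omega *)
Definition test_fun Omega f : Prop :=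
  [/\ smooth_on setT f, compact (tsupp f) & tsupp f `<=` Omega].

End smooth_functions.

Section distributions.
Variables (R : realType) (n : nat).
Implicit Types (phi psi : 'rV[R]_n -> R) (Omega : set 'rV[R]_n).

(* linear functionals on test functions that are bounded, on the test functions
   supported in a given compact set, by a C^N norm; values outside of
   C_0^oo(Omega) are irrelevant *)
Definition distribution_on Omega (T : ('rV[R]_n -> R) -> R) : Prop :=
  (forall (a : R) phi psi, test_fun Omega phi -> test_fun Omega psi ->
     T (fun x => a * phi x + psi x) = a * T phi + T psi) /\
  (forall K : set 'rV[R]_n, compact K -> K `<=` Omega ->
     exists (C : R) (N : nat), forall phi, test_fun Omega phi -> tsupp phi `<=` K ->
       `|T phi| <= C * \sum_(k < N.+1) \sum_(s : k.-tuple 'I_n)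
                         sup [set `|partials s phi x| | x in setT]).

Definition regular_dist Omega (g : 'rV[R]_n -> R) : ('rV[R]_n -> R) -> R :=
  fun phi => \int[lebesgue_rV]_(y in Omega) (g y * phi y).

Definition dist_eq_on Omega (S T : ('rV[R]_n -> R) -> R) : Prop :=
  forall phi, test_fun Omega phi -> S phi = T phi.

Definition dist_smooth_on Omega (T : ('rV[R]_n -> R) -> R) : Prop :=
  exists2 g, smooth_on Omega g & dist_eq_on Omega T (regular_dist Omega g).

Definition dist_partial (i : 'I_n) (T : ('rV[R]_n -> R) -> R) :=
  fun phi => - T (partial i phi).

Definition dist_mul (a : 'rV[R]_n -> R) (T : ('rV[R]_n -> R) -> R) :=
  fun phi => T (fun x => a x * phi x).

End distributions.

Section operator.
Variables (R : realType) (n : nat) (A : 'rV[R]_n -> 'M[R]_n).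

Definition Lop (phi : 'rV[R]_n -> R) : 'rV[R]_n -> R := fun x =>
  \sum_(i < n) \sum_(j < n) partial i (fun y => A y i j * partial j phi y) x.

Definition Lop_dist (T : ('rV[R]_n -> R) -> R) : ('rV[R]_n -> R) -> R := fun phi =>
  \sum_(i < n) \sum_(j < n)
    dist_partial i (dist_mul (fun y => A y i j) (dist_partial j T)) phi.

Definition hypoelliptic : Prop :=
  forall (Omega : set 'rV[R]_n) (T : ('rV[R]_n -> R) -> R),
    open Omega -> distribution_on Omega T ->
    dist_smooth_on Omega (Lop_dist T) -> dist_smooth_on Omega T.

Definition admissible_matrix : Prop :=
  [/\ forall x, (A x)^T = A x,
      forall x (v : 'rV[R]_n), 0 <= (v *m A x *m v^T) ord0 ord0,
      forall i j, smooth_on setT (fun x => A x i j)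
    & forall x, 0 < \tr (A x)].

(* The value of Gamma on the diagonal is arbitrary here and never matters: the
   convention Gamma(x,x) = +oo is that of extGamma below. *)
Variable Gamma : 'rV[R]_n -> 'rV[R]_n -> R.

Definition extGamma (x y : 'rV[R]_n) : \bar R :=
  if x == y then +oo%E else (Gamma x y)%:E.

Definition fundamental_solution : Prop :=
  forall phi, test_fun setT phi -> forall x,
    \int[lebesgue_rV]_y (Gamma x y * Lop phi y) = - phi x.

Definition admissible_fundamental_solution : Prop :=
  smooth_on [set z : 'rV[R]_(n + n) | lsubmx z != rsubmx z]
            (fun z => Gamma (lsubmx z) (rsubmx z)) /\
  [/\ forall x y, x != y -> Gamma x y = Gamma y x /\ 0 < Gamma x y,
      forall y, Gamma x y @[x --> y^'] --> +oo%R,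
      (* sup_(y in K) Gamma(x,y) -> 0 as x -> oo; the sup over an empty K would
         be -oo *)
      forall K : set 'rV[R]_n, compact K -> K !=set0 ->
        forall eps : R, 0 < eps -> exists M : R, forall x, M < `|x| ->
          (`| ereal_sup [set extGamma x y | y in K] | < eps%:E)%E,
      forall x (K : set 'rV[R]_n), compact K ->
        lebesgue_rV.-integrable K (EFin \o Gamma x)
    & fundamental_solution].

Definition Lball (r : R) (x : 'rV[R]_n) : set 'rV[R]_n :=
  [set y | (r^-1%:E < extGamma x y)%E].

Definition grad_y (x y : 'rV[R]_n) : 'rV[R]_n :=
  \row_(i < n) partial i (Gamma x) y.

Variable alpha : R.

Definition kernelK (x y : 'rV[R]_n) : R :=
  (grad_y x y *m A y *m (grad_y x y)^T) ord0 ord0 / (Gamma x y `^ (alpha + 2)).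

Definition meanM (r : R) (u : 'rV[R]_n -> R) (x : 'rV[R]_n) : R :=
  (alpha + 1) / (r `^ (alpha + 1)) *
  \int[lebesgue_rV]_(y in Lball r x) (u y * kernelK x y).

Definition meanQ (r : R) (x : 'rV[R]_n) : R :=
  (alpha + 1) / (r `^ (alpha + 1)) *
  \int[lebesgue_measure]_(rho in `]0, r[)
    (rho `^ alpha *
       \int[lebesgue_rV]_(y in Lball rho x) (Gamma x y - rho^-1)).

Definition La_quotient (u : 'rV[R]_n -> R) (x : 'rV[R]_n) (r : R) : R :=
  (meanM r u x - u x) / meanQ r x.

Definition La_domain (u : 'rV[R]_n -> R) : Prop :=
  continuous u /\ forall x, cvg (La_quotient u x r @[r --> 0^'+]).

Definition La (u : 'rV[R]_n -> R) (x : 'rV[R]_n) : R :=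
  lim (La_quotient u x r @[r --> 0^'+]).

End operator.

(* Main.v *)
Require Import Defs.
From mathcomp Require Import all_boot all_order all_algebra.
From mathcomp Require Import all_classical all_reals all_analysis.
From mathcomp Require Import measurable_realfun ring lra.

(* For a function [H] that is constant near 0 and near infinity, [H (Gamma_x)] is a
   test function, and off the pole [L (H (Gamma_x)) = H''(Gamma_x) <A dGamma_x, dGamma_x>].
   Testing a weak solution of [L w = - f] against it, for [H''] approximating the
   weight [t^-(alpha+2)] on [1/r < t], gives [M_r w (x) - w x] as minus an average of
   [f] over the ball, of total mass [Q_r x]; no surface integral and no coarea formula
   is involved. Hence [L_a w = - f] for every continuous weak solution [w].

   Conversely, the potential [Gamma * f] is a continuous weak solution vanishing at
   infinity, so [L_a (Gamma * f) = - f]. If [u - Gamma * f] were positive somewhere,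
   [u - Gamma * (f + eps g)] would have, for some [g >= 0] and small [eps > 0], a
   maximum at a point where [g > 0]; there the difference quotients are nonpositive
   but converge to [eps g]. By symmetry, [u = Gamma * f]. *)

Set Implicit Arguments.
Unset Strict Implicit.
Unset Printing Implicit Defensive.

Import Order.TTheory GRing.Theory Num.Theory.
Import numFieldNormedType.Exports.

Local Open Scope classical_set_scope.
Local Open Scope ring_scope.

(** * Borel sets and Lebesgue measure of [R^n] *)

Section rV_measure.
Variable R : realType.

(** The weight [t^-(alpha+2)] on [1/r < t] cannot be [H''] itself: it jumps at [1/r], and its
    primitive [P] vanishing at [1/r] has a nonzero limit [Pinf] at infinity. So [H'] is [P] times
    two cutoffs, and [H''] acquires two error terms. The one at [1/r] disappears, because [P]
    vanishes there to first order and compensates the slope of the cutoff. The one at infinity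
    survives: the energy density of [Gamma_x], weighted by [F'(Gamma_x)], has integral 1 whenever
    [F] climbs from 0 to 1, so this term is a mass [Pinf] concentrating at the pole, and it yields
    [w x].

    Integrability of the weight over the ball is not known beforehand. It comes out of the same
    identity for [w = 1], [f = 0], by Fatou.

    The source is weighted by the primitive of [P], which a one-dimensional integral identifies with
    what Tonelli leaves of [Q_r].

    In the converse, the delicate point is the continuity of potentials: [Gamma x] is locally
    integrable for each [x], without uniform control near the diagonal. A test function whose [- L]
    is at least 1 near a given point supplies the missing control. *)

Lemma ball_rVP n (c v : 'rV[R]_n) (e : R) : 0 < e ->
  ball c e v <-> forall i, `|c ord0 i - v ord0 i| < e.
Proof.
by move=> e0; split=> [[_ h] i|h]; [exact: h|split => // i j; rewrite ord1; exact: h].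
Qed.

Lemma ball_rV_bigcap n (c : 'rV[R]_n) (e : R) : 0 < e ->
  ball c e = \bigcap_(i : 'I_n) (@rV_coord R n i @^-1` (ball (c ord0 i) e)).
Proof.
move=> e0; apply/seteqP; split=> v.
  by move=> /(ball_rVP _ _ e0) h i _; exact: h.
by move=> h; apply/(ball_rVP _ _ e0) => i; exact: (h i I).
Qed.

Lemma measurable_ball_rV n (c : 'rV[R]_n) (e : R) : measurable (ball c e).
Proof.
have [e0|e0] := ltP 0 e; last first.
  rewrite (_ : ball c e = set0)//; apply/seteqP; split=> // v [].
  by rewrite ltNge e0.
rewrite ball_rV_bigcap//; apply: fin_bigcap_measurable => // i _.
rewrite -[X in measurable X]setTI; apply: measurable_rV_coord => //.
exact: measurable_ball.
Qed.

(** The sigma-algebra is generated by the coordinates, without reference to the topology. Balls of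
    the sup norm are finite intersections of coordinate strips, and [U] is the union of the
    countably many balls with rational centre and radius [1/(k+1)] that it contains. *)
Lemma open_measurable_rV n (U : set 'rV[R]_n) : open U -> measurable U.
Proof.
move=> oU.
pose c (p : 'rV[rat]_n * nat) : 'rV[R]_n := map_mx ratr p.1.
pose B p := ball (c p) (p.2.+1%:R^-1).
pose F p := if `[< B p `<=` U >] then B p else set0.
rewrite (_ : U = \bigcup_p F p).
  apply: countable_bigcupT_measurable => // p; rewrite /F; case: ifP => // _.
  exact: measurable_ball_rV.
apply/seteqP; split=> [v Uv|v [p _]]; last first.
  by rewrite /F; case: asboolP => // BU; exact: BU.
have /nbhs_ballP[e /= e0 eU] : nbhs v U by exact: open_nbhs_nbhs.
(* With a radius below [e / 2], a ball of the family that contains [v] stays inside [ball v e]. *)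
have [k _ ke] : exists2 k : nat, True & (k.+1%:R^-1 : R) < e / 2.
  have e20 : 0 < e / 2 by rewrite divr_gt0.
  have /cvgrPdist_lt/(_ _ e20)[N _ /(_ N (leqnn N))] := @cvg_harmonic R.
  by rewrite /= sub0r normrN ger0_norm//; exists N.
have k0 : 0 < (k.+1%:R^-1 : R) by rewrite invr_gt0.
have /choice[q hq] : forall i : 'I_n, exists q : rat,
    `|v ord0 i - ratr q| < k.+1%:R^-1.
  move: k0; move: (k.+1%:R^-1 : R) => d d0 i.
  have vk : v ord0 i - d < v ord0 i + d by lra.
  have [q] := rat_in_itvoo vk.
  rewrite in_itv/= => /andP[q1 q2]; exists q; rewrite ltr_norml.
  by apply/andP; split; lra.
exists (\row_i q i, k) => //; rewrite /F.
have Bv : B (\row_i q i, k) v.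
  by apply/ball_rVP => // i; rewrite !mxE distrC; exact: hq.
rewrite asboolT// => w Bw; apply: eU.
rewrite [X in ball _ X](splitr e); apply: ball_triangle.
  by apply: ball_sym; exact: le_ball (ltW ke) _ Bv.
exact: le_ball (ltW ke) _ Bw.
Qed.

Lemma closed_measurable_rV n (U : set 'rV[R]_n) : closed U -> measurable U.
Proof.
move=> cU; rewrite -(setCK U); apply: measurableC; apply: open_measurable_rV.
by rewrite openC.
Qed.

Lemma measurable_rV_set1 n (x : 'rV[R]_n) : measurable [set x].
Proof.
apply: closed_measurable_rV; apply: compact_closed; last exact: compact_set1.
exact: norm_hausdorff.
Qed.

Lemma open_continuous_measurable_rV n (U : set 'rV[R]_n) (f : 'rV[R]_n -> R) :
  open U -> (forall x, U x -> {for x, continuous f}) -> measurable_fun U f.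
Proof.
move=> oU cf; apply: (measurability _ (RGenOpens.measurableE R)).
move=> _ [_ [a [b ->]] <-]; apply: open_measurable_rV.
rewrite openE => x [Ux /= abx]; apply: filterI; first exact: open_nbhs_nbhs.
apply: (cf x Ux); exact: open_nbhs_nbhs.
Qed.

Lemma continuous_measurable_rV n (f : 'rV[R]_n -> R) :
  continuous f -> measurable_fun setT f.
Proof.
move=> cf; apply: open_continuous_measurable_rV; first exact: openT.
by move=> x _; exact: cf.
Qed.

Notation mu := lebesgue_rV.

Lemma preimage_rV_cons_ball n (c : 'rV[R]_n.+1) (e : R) : 0 < e ->
  @rV_cons R n @^-1` (ball c e) =
  (ball (c ord0 ord0) e : set (measurableTypeR R)) `*` ball (rV_uncons c).2 e.
Proof.
move=> e0; apply/seteqP; split=> -[t v] /=.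
  move=> /(ball_rVP _ _ e0) h; split => /=.
    have := h ord0; rewrite /rV_cons /=.
    have -> : (ord0 : 'I_n.+1) = lshift n (ord0 : 'I_1) by exact: val_inj.
    by rewrite (row_mxEl (const_mx t : 'rV[R]_1)) mxE.
  apply/(ball_rVP _ _ e0) => i; have := h (rshift 1 i).
  by rewrite /rV_cons /= (row_mxEr (const_mx t : 'rV[R]_1)) mxE.
move=> [/= h0 /(ball_rVP _ _ e0) h]; apply/(ball_rVP _ _ e0) => i.
have [j ->|j ->] := @split_ordP 1 n i.
  rewrite /rV_cons (row_mxEl (const_mx t : 'rV[R]_1)) mxE (ord1 j).
  by have <- : (ord0 : 'I_n.+1) = lshift n (ord0 : 'I_1) by exact: val_inj.
by have := h j; rewrite /rV_cons /= (row_mxEr (const_mx t : 'rV[R]_1)) mxE.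
Qed.

Lemma lebesgue_rVS n (B : set 'rV[R]_n.+1) :
  mu B = (@lebesgue_measure R \x mu)%E (@rV_cons R n @^-1` B).
Proof. by []. Qed.

Lemma lebesgue_rV_ball n (c : 'rV[R]_n) (e : R) : 0 < e ->
  (0 < mu (ball c e) < +oo)%E.
Proof.
move=> e0; elim: n c => [|n IH] c.
  rewrite /= diracE mem_set ?lte01 ?ltry//.
  by apply/ball_rVP => // -[].
rewrite lebesgue_rVS preimage_rV_cons_ball// product_measure1E; last 2 first.
  exact: measurable_ball.
  exact: measurable_ball_rV.
have /andP[h1 h2] := IH (rV_uncons c).2.
have /= -> := lebesgue_measure_ball (c ord0 ord0) (ltW e0).
apply/andP; split; first by rewrite mule_gt0// lte_fin mulrn_wgt0.
by rewrite lte_mul_pinfty// lee_fin mulrn_wge0// ltW.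
Qed.

(** Stated from dimension 1 on, since the measure on [R^0] is a Dirac mass. It makes the arbitrary
    value of [Gamma] at the pole harmless under integrals. *)
Lemma lebesgue_rV_set1 n (x : 'rV[R]_n.+1) : mu [set x] = 0%E.
Proof.
rewrite lebesgue_rVS (_ : _ @^-1` _ =
  ([set x ord0 ord0] : set (measurableTypeR R)) `*` [set (rV_uncons x).2]).
  rewrite product_measure1E//; last exact: measurable_rV_set1.
  by rewrite [X in (X * _)%E](lebesgue_measure_set1 (x ord0 ord0)) mul0e.
apply/seteqP; split=> -[t v] /=.
  by move=> <-; have := rV_consK (t, v); rewrite /rV_uncons => -[-> ->].
move=> [/= -> ->]; apply/rowP => i; rewrite /rV_cons/=.
have [j ->|j ->] := @split_ordP 1 n i.
  rewrite (row_mxEl (const_mx _ : 'rV[R]_1)) mxE (ord1 j).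
  by have <- : (ord0 : 'I_n.+1) = lshift n (ord0 : 'I_1) by exact: val_inj.
by rewrite (row_mxEr (const_mx _ : 'rV[R]_1)) mxE.
Qed.

Lemma lebesgue_rV_open_gt0 n (U : set 'rV[R]_n) x : open U -> U x -> (0 < mu U)%E.
Proof.
move=> oU Ux; have /nbhs_ballP[e /= e0 eU] : nbhs x U by exact: open_nbhs_nbhs.
have /andP[h _] := lebesgue_rV_ball x e0; apply: (lt_le_trans h).
apply: le_measure => //; rewrite inE; first exact: measurable_ball_rV.
exact: open_measurable_rV.
Qed.

End rV_measure.

(** * Dominated convergence for real-valued integrals *)

Section dominated_Rintegral.
Context d (T : measurableType d) (R : realType) (mu : {measure set T -> \bar R}).

Lemma dominated_cvg_Rintegral (D : set T) (f_ : (T -> R)^nat) (f g : T -> R) :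
  measurable D -> (forall n, measurable_fun D (f_ n)) ->
  (forall x, D x -> f_ n x @[n --> \oo] --> f x) ->
  mu.-integrable D (EFin \o g) ->
  (forall n x, D x -> `|f_ n x| <= g x) ->
  mu.-integrable D (EFin \o f) /\
  \int[mu]_(x in D) f_ n x @[n --> \oo] --> \int[mu]_(x in D) f x.
Proof.
move=> mD mf ff ig fg.
have mfE n : measurable_fun D (EFin \o f_ n) by exact/measurable_EFinP.
have mlim : measurable_fun D f by apply: (measurable_fun_cvg mf); exact: ff.
have [] := @dominated_convergence _ _ _ mu D mD (fun n => EFin \o f_ n) (EFin \o f) (EFin \o g).
- exact: mfE.
- exact/measurable_EFinP.
- apply/aeW => x Dx; apply: cvg_EFin; first by apply: nearW.
  exact: ff.
- exact: ig.
- by apply/aeW => x n Dx /=; rewrite lee_fin fg.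
move=> fi _ cv; split => //.
apply/fine_cvg; rewrite fineK; first exact: cv.
exact: integrable_fin_num.
Qed.

End dominated_Rintegral.

(** * Bounded supports and integrals of partial derivatives *)

Section rV_integral.
Variable R : realType.
Notation mu := lebesgue_rV.

Lemma rV_norm_leP n (x : 'rV[R]_n) (c : R) : 0 <= c ->
  (`|x| <= c) <-> (forall i, `|x ord0 i| <= c).
Proof.
move=> c0; rewrite [X in X <= c]/Num.norm /= mx_normrE; split.
  by move=> /bigmax_leP[_ h] i; exact: (h (ord0, i)).
by move=> h; apply/bigmax_leP; split => // -[i j] _ /=; rewrite (ord1 i).
Qed.

Lemma rV_coord_norm_le n (x : 'rV[R]_n) i : `|x ord0 i| <= `|x|.
Proof. by have /(rV_norm_leP x (normr_ge0 _)) := lexx `|x|. Qed.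

(** A form of compact support (see [compact_tsuppP]) that passes to products and partial derivatives
    without any closure. *)
Definition bounded_supp n (f : 'rV[R]_n -> R) :=
  exists M : R, forall x, M < `|x| -> f x = 0.

Lemma rV_ball0E n (M : R) : ball (0 : 'rV[R]_n) M = [set x | `|x| < M].
Proof. by rewrite -ball_normE; apply/seteqP; split=> x; rewrite /= sub0r normrN. Qed.

Lemma compact_tsuppP n (f : 'rV[R]_n -> R) :
  compact (tsupp f) <-> bounded_supp f.
Proof.
split.
  move=> /compact_bounded[M [_ hM]]; exists (M + 1) => x Mx.
  apply/eqP/negP => /negP fx0.
  have : tsupp f x by apply: subset_closure.
  by move=> /(hM _ (ltr_pwDr ltr01 (lexx M))) /(lt_le_trans Mx); rewrite ltxx.
move=> [M hM]; apply: bounded_closed_compact; last exact: closed_closure.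
exists M; split; first exact: num_real.
move=> N MN x; apply: contraPP => /negP; rewrite -ltNge => Nx.
move=> /(_ [set y | N < `|y|]) [].
  apply: open_nbhs_nbhs; split => //.
  apply: (@open_comp _ _ (fun y : 'rV[R]_n => `|y|) [set r | N < r]).
    by move=> y _; exact: norm_continuous.
  exact: open_gt.
move=> y [/= /eqP fy Ny]; apply: fy; apply: hM; exact: lt_trans MN Ny.
Qed.

Lemma integrable_bounded_supp n (f : 'rV[R]_n -> R) (C : R) :
  measurable_fun setT f -> (forall x, `|f x| <= C) -> bounded_supp f ->
  mu.-integrable setT (EFin \o f).
Proof.
move=> mf fC [M hM]; pose B := ball (0 : 'rV[R]_n) (`|M| + 1).
have M10 : 0 < `|M| + 1 by rewrite ltr_pwDr.
have mB : measurable B by exact: measurable_ball_rV.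
rewrite (_ : EFin \o f = (EFin \o f) \_ B).
  apply/(integrable_mkcond _ mB)/measurable_bounded_integrable => //.
  - by have /andP[] := lebesgue_rV_ball (0 : 'rV[R]_n) M10.
  - exact: measurable_funTS.
  - exists C; split; first exact: num_real.
    by move=> N CN x _ /=; rewrite (le_trans (fC x))// ltW.
apply/funext => x; rewrite patchE; case: ifPn => //=.
rewrite notin_setE /B rV_ball0E /= => /negP; rewrite -leNgt => Mx.
by rewrite hM// (lt_le_trans _ Mx)// (le_lt_trans (ler_norm M))// ltrDl.
Qed.

Lemma compact_rV_le n (M : R) : compact [set x : 'rV[R]_n | `|x| <= M].
Proof.
apply: bounded_closed_compact.
  by exists M; split; [exact: num_real|move=> N MN x /= xM; exact: le_trans (ltW MN)].
rewrite (_ : [set x | _] = (fun x : 'rV[R]_n => `|x|) @^-1` [set r | r <= M])//.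
by apply: closed_comp; [move=> x _; exact: norm_continuous|exact: closed_le].
Qed.

Lemma continuous_bounded_ball n (f : 'rV[R]_n -> R) (M : R) : continuous f ->
  exists2 C, 0 <= C & forall x, `|x| <= M -> `|f x| <= C.
Proof.
move=> cf; have cB := @compact_rV_le n `|M|.
have [||c _ hc] := @EVT_max_rV R n (fun x => `|f x|) [set x | `|x| <= `|M|] _ cB.
- by exists 0; rewrite /= normr0.
- apply: continuous_subspaceT => x; apply: continuous_comp; first exact: cf.
  exact: norm_continuous.
by exists `|f c| => // x xM; apply: hc; rewrite inE /=; exact: le_trans (ler_norm M).
Qed.

Lemma continuous_bounded_supp_bounded n (f : 'rV[R]_n -> R) :
  continuous f -> bounded_supp f -> exists2 C, 0 <= C & forall x, `|f x| <= C.
Proof.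
move=> cf [M hM]; have [C C0 hC] := continuous_bounded_ball M cf.
exists C => // x; have [/hC//|/hM ->] := leP `|x| M; by rewrite normr0.
Qed.

Lemma integrable_continuous_bounded_supp n (f : 'rV[R]_n -> R) :
  continuous f -> bounded_supp f -> mu.-integrable setT (EFin \o f).
Proof.
move=> cf bf; have [C _ hC] := continuous_bounded_supp_bounded cf bf.
by apply: integrable_bounded_supp hC bf; exact: continuous_measurable_rV.
Qed.


Lemma integral_rVS n (f : 'rV[R]_n.+1 -> \bar R) :
  mu.-integrable setT f ->
  (\int[mu]_x f x = \int[(@lebesgue_measure R \x mu)%E]_p f (rV_cons p))%E.
Proof.
move=> fi.
have mf : measurable_fun setT f by exact: measurable_int fi.
have fi' : (@lebesgue_measure R \x mu)%E.-integrable setT (f \o @rV_cons R n).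
  apply/integrableP; split.
    by apply: measurableT_comp; [exact: mf|exact: measurable_rV_cons].
  move/integrableP : (fi) => [_]; congr (_ < _)%E.
  rewrite [LHS](@ge0_integral_pushforward _ _ _ _ _ _ (@measurable_rV_cons R n) (@lebesgue_measure R \x mu)%E setT (fun x => `|f x|%E)) ?preimage_setT//.
  exact: measurableT_comp.
rewrite [LHS](@integral_pushforward _ _ _ _ _ _ (@measurable_rV_cons R n) (@lebesgue_measure R \x mu)%E setT f) ?preimage_setT//.
Qed.

Lemma integrable_rVS n (f : 'rV[R]_n.+1 -> \bar R) :
  mu.-integrable setT f ->
  (@lebesgue_measure R \x mu)%E.-integrable setT (fun p => f (rV_cons p)).
Proof.
move=> fi.
have mf : measurable_fun setT f by exact: measurable_int fi.
apply/integrableP; split.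
  by apply: measurableT_comp; [exact: mf|exact: measurable_rV_cons].
move/integrableP : (fi) => [_]; congr (_ < _)%E.
rewrite [LHS](@ge0_integral_pushforward _ _ _ _ _ _ (@measurable_rV_cons R n) (@lebesgue_measure R \x mu)%E setT (fun x => `|f x|%E)) ?preimage_setT//.
exact: measurableT_comp.
Qed.

Lemma rV_cons_coord0 n (t : R) (v : 'rV[R]_n) : rV_cons (t, v) ord0 ord0 = t.
Proof.
have -> : (ord0 : 'I_n.+1) = lshift n (ord0 : 'I_1) by exact: val_inj.
by rewrite /rV_cons (row_mxEl (const_mx t : 'rV[R]_1)) mxE.
Qed.

Lemma rV_cons_coordS n (t : R) (v : 'rV[R]_n) j :
  rV_cons (t, v) ord0 (rshift 1 j) = v ord0 j.
Proof. by rewrite /rV_cons /= (row_mxEr (const_mx t : 'rV[R]_1)). Qed.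

Lemma rV_cons_ext n (x y : 'rV[R]_n.+1) : x ord0 ord0 = y ord0 ord0 ->
  (forall j : 'I_n, x ord0 (rshift 1 j) = y ord0 (rshift 1 j)) -> x = y.
Proof.
move=> h0 h; apply/rowP => i; have [j ->|j ->] := @split_ordP 1 n i; last exact: h.
rewrite (ord1 j).
by have <- : (ord0 : 'I_n.+1) = lshift n (ord0 : 'I_1) by exact: val_inj.
Qed.

Lemma continuous_rV_consr n (t : R) : continuous (fun v : 'rV[R]_n => rV_cons (t, v)).
Proof.
move=> v A /nbhs_ballP[e /= e0 eA]; apply/nbhs_ballP; exists e => //= w hw; apply: eA.
have : (@rV_cons R n @^-1` (ball (rV_cons (t, v)) e)) (t, w); last by [].
rewrite preimage_rV_cons_ball// rV_consK; split => /=.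
  by rewrite rV_cons_coord0; exact: ballxx.
exact: hw.
Qed.

Lemma continuous_rV_consl n (v : 'rV[R]_n) : continuous (fun t : R => rV_cons (t, v)).
Proof.
move=> t A /nbhs_ballP[e /= e0 eA]; apply/nbhs_ballP; exists e => //= s hs; apply: eA.
have : (@rV_cons R n @^-1` (ball (rV_cons (t, v)) e)) (s, v); last by [].
rewrite preimage_rV_cons_ball// rV_consK; split => /=.
  by rewrite rV_cons_coord0; exact: hs.
exact: ballxx.
Qed.

Lemma rV_norm_consr n (t : R) (v : 'rV[R]_n) : `|v| <= `|rV_cons (t, v)|.
Proof.
by apply/rV_norm_leP => // i; rewrite -(rV_cons_coordS t); exact: rV_coord_norm_le.
Qed.

Lemma rV_norm_consl n (t : R) (v : 'rV[R]_n) : `|t| <= `|rV_cons (t, v)|.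
Proof. by rewrite -[in leLHS](rV_cons_coord0 t v); exact: rV_coord_norm_le. Qed.

(** A directional derivative only sees the restriction to one line. This transfers derivatives
    between a space, its slices and the real line, even when the ambient spaces differ. *)
Lemma derive_slice (V W : normedModType R) (f : V -> R) (g : W -> R) a b v w :
  (forall h : R, f (h *: v + a) = g (h *: w + b)) -> f a = g b ->
  'D_v f a = 'D_w g b /\ (derivable f a v <-> derivable g b w).
Proof.
move=> fg fgab; have E : (fun h : R => h^-1 *: ((f \o shift a) (h *: v) - f a)) =
    (fun h : R => h^-1 *: ((g \o shift b) (h *: w) - g b)).
  by apply/funext => h /=; rewrite fg fgab.
by rewrite /derive /derivable E.
Qed.

Lemma integral_derive1_bounded_supp (g : R -> R) (M : R) :
  (forall t, derivable g t 1) -> continuous (derive1 g) ->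
  (forall t, M < `|t| -> g t = 0) ->
  (\int[@lebesgue_measure R]_t (derive1 g t)%:E = 0)%E.
Proof.
move=> dg cg gM; pose a := - (`|M| + 1); pose b := `|M| + 1.
have M10 : 0 < b by rewrite ltr_pwDr.
have ab : a < b by rewrite gtrN.
have gM' t : `|M| < `|t| -> g t = 0.
  by move=> Mt; rewrite gM// (le_lt_trans (ler_norm _)).
rewrite (_ : (fun t => _) = ((fun t => (derive1 g t)%:E) \_ `[a, b])); last first.
  apply/funext => t; rewrite patchE; case: ifPn => //.
  rewrite notin_setE /= in_itv /= => /negP tab.
  have Mt : `|M| < `|t|.
    by rewrite ltNge; apply: contra tab; rewrite ler_norml /a /b => /andP[]; lra.
  congr EFin; rewrite derive1E.
  rewrite (@near_eq_derive _ _ _ _ (cst 0)) ?derive_cst ?oner_neq0//.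
  near=> s; apply: gM'; near: s.
  apply: (cvgr_gt `|t|) => //; exact: norm_continuous.
have cg' t : {for t, continuous g} by apply/differentiable_continuous/derivable1_diffP.
have LR : derivable_oo_LRcontinuous g a b.
  split => //; first by apply: cvg_at_right_filter; exact: cg'.
  by apply: cvg_at_left_filter; exact: cg'.
have cw : {within `[a, b], continuous (derive1 g)} by apply: continuous_subspaceT.
have bM : `|M| < `|b| by rewrite (ger0_norm (ltW M10)) ltrDl.
rewrite -integral_mkcond.
have -> := @continuous_FTC2 R (derive1 g) g a b ab cw LR (fun _ _ => erefl).
by rewrite (gM' b bM) (gM' a) ?subee// normrN.
Unshelve. all: by end_near. Qed.

Lemma rV_lineE n (h : R) (i j : 'I_n) (x : 'rV[R]_n) :
  (h *: delta_mx ord0 i + x) ord0 j = h * (j == i)%:R + x ord0 j.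
Proof. by rewrite mxE; congr (_ + _); rewrite !mxE. Qed.

Lemma bounded_supp_partial n (f : 'rV[R]_n -> R) i :
  bounded_supp f -> bounded_supp (partial i f).
Proof.
move=> [M hM]; exists M => x Mx; rewrite /partial.
rewrite (@near_eq_derive _ _ _ _ (cst 0)) ?derive_cst//.
near=> y; apply: hM; near: y.
apply: (cvgr_gt `|x|) => //; exact: norm_continuous.
Unshelve. all: by end_near. Qed.

(** Induction on the dimension by Fubini. If [i] is the first coordinate, it is integrated first and
    the fundamental theorem of calculus gives 0 on each line; otherwise the first coordinate is
    frozen and the induction hypothesis applies to the slice. *)
Lemma integral_partial n (phi : 'rV[R]_n -> R) (i : 'I_n) :
  (forall x, derivable phi x (delta_mx ord0 i)) -> continuous (partial i phi) ->
  bounded_supp phi -> \int[mu]_x (partial i phi x) = 0.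
Proof.
move=> dphi cphi bphi; rewrite /Rintegral.
suff -> : (\int[mu]_x (partial i phi x)%:E = 0)%E by [].
elim: n => [|n IH] in phi i dphi cphi bphi *; first by move: (i) => -[].
have ip : mu.-integrable setT (EFin \o partial i phi).
  by apply: integrable_continuous_bounded_supp => //; exact: bounded_supp_partial.
have ip' := integrable_rVS ip.
rewrite integral_rVS//.
have [j iE|j iE] := @split_ordP 1 n i.
  have {j iE}i0 : i = ord0 by rewrite iE; apply: val_inj; rewrite (ord1 j).
  subst i.
  rewrite -integral21_prod_meas1//; apply: integral0_eq => v _.
  have E t : 'D_(delta_mx ord0 ord0) phi (rV_cons (t, v)) =
      'D_1 (fun t => phi (rV_cons (t, v))) t /\
     (derivable phi (rV_cons (t, v)) (delta_mx ord0 ord0) <->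
      derivable (fun t => phi (rV_cons (t, v))) t 1).
    apply: derive_slice => // h; congr phi; apply: rV_cons_ext.
      by rewrite rV_lineE !rV_cons_coord0 eqxx mulr1 [h *: 1]mulr1.
    by move=> k; rewrite rV_lineE !rV_cons_coordS /= mulr0 add0r.
  case: (bphi) => M hM.
  pose g t := phi (rV_cons (t, v)).
  have Eg : derive1 g = partial ord0 phi \o (fun t => rV_cons (t, v)).
    by apply/funext => t; rewrite derive1E -(E t).1.
  have := @integral_derive1_bounded_supp g M.
  rewrite Eg; apply.
  - move=> t; exact: (iffLR (E t).2 (dphi _)).
  - by move=> t; apply: continuous_comp; [exact: continuous_rV_consl|exact: cphi].
  - by move=> t Mt; apply: hM; apply: lt_le_trans Mt _; exact: rV_norm_consl.
subst i.
rewrite -integral12_prod_meas1//; apply: integral0_eq => t _.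
have E v : 'D_(delta_mx ord0 (rshift 1 j)) phi (rV_cons (t, v)) =
    'D_(delta_mx ord0 j) (fun v => phi (rV_cons (t, v))) v /\
   (derivable phi (rV_cons (t, v)) (delta_mx ord0 (rshift 1 j)) <->
    derivable (fun v => phi (rV_cons (t, v))) v (delta_mx ord0 j)).
  apply: derive_slice => // h; congr phi; apply: rV_cons_ext.
    by rewrite rV_lineE !rV_cons_coord0 /= mulr0 add0r.
  by move=> k; rewrite rV_lineE !rV_cons_coordS rV_lineE; congr (_ * _%:R + _).
pose g v := phi (rV_cons (t, v)).
have Eg : partial j g = partial (rshift 1 j) phi \o (fun v => rV_cons (t, v)).
  by apply/funext => v; rewrite /partial -(E v).1.
have := IH g j; rewrite Eg; apply.
- move=> v; exact: (iffLR (E v).2 (dphi _)).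
- by move=> v; apply: continuous_comp; [exact: continuous_rV_consr|exact: cphi].
- case: bphi => M hM; exists M => v Mv; apply: hM; apply: lt_le_trans Mv _.
  exact: rV_norm_consr.
Qed.

End rV_integral.

(** * Differentiability of finite order along a family of directions *)

Section Ck.
Context (R : realType) (V : normedModType R) (I : Type) (e : I -> V).

(** A finite order allows product and chain rules to be proved by induction on [k]; [smooth_on] is
    recovered as all orders at once. The directions [e] are a parameter so that the same rules serve
    the line and [R^n]. *)
Fixpoint Ck (k : nat) (D : set V) (f : V -> R) : Prop :=
  (forall x, D x -> {for x, continuous f}) /\
  if k is k'.+1 then
    forall i, (forall x, D x -> derivable f x (e i)) /\ Ck k' D ('D_(e i) f)
  else True.

Lemma Ck_continuous k D f x : Ck k D f -> D x -> {for x, continuous f}.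
Proof. by case: k => [|k] [h _] /h. Qed.

Lemma CkS k D f : Ck k.+1 D f -> Ck k D f.
Proof.
elim: k f => [|k IH] f; first by move=> [cf _].
move=> [cf df]; split=> // i; split; first exact: (df i).1.
exact: IH (df i).2.
Qed.

Lemma Ck_subset k D E f : E `<=` D -> Ck k D f -> Ck k E f.
Proof.
move=> ED; elim: k f => [|k IH] f [cf df]; first by split=> // x /ED /cf.
split=> [x /ED /cf//|i]; split; first by move=> x /ED; exact: (df i).1.
exact: IH (df i).2.
Qed.

Lemma Ck_local k D f :
  (forall x, D x -> exists U, [/\ open U, U x & Ck k U f]) -> Ck k D f.
Proof.
elim: k f => [|k IH] f h; first by split=> // x /h[U [oU Ux] /Ck_continuous]; exact.
split=> [x /h[U [oU Ux] /Ck_continuous]|i]; first exact.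
split; first by move=> x /h[U [oU Ux [_ /(_ i)[hU _]]]]; exact: hU.
by apply: IH => x /h[U [oU Ux [_ /(_ i)[_ hU]]]]; exists U.
Qed.

Lemma near_eq_continuous (x : V) (f g : V -> R) :
  (\forall y \near x, f y = g y) -> {for x, continuous f} -> {for x, continuous g}.
Proof.
move=> fg cf; have fgx : f x = g x by exact: nbhs_singleton fg.
rewrite /prop_for /continuous_at -fgx; apply: cvg_trans cf.
by apply: near_eq_cvg.
Qed.

Lemma Ck_ext k D f g : open D -> (forall x, D x -> f x = g x) ->
  Ck k D f -> Ck k D g.
Proof.
move=> oD; have nD x : D x -> \forall y \near x, D y by move=> Dx; exact: open_nbhs_nbhs.
elim: k f g => [|k IH] f g fg.
  move=> [cf _]; split=> // x Dx; apply: near_eq_continuous (cf x Dx).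
  by apply: filterS (nD x Dx) => y /fg.
move=> [cf df]; split=> [x Dx|i].
  apply: near_eq_continuous (cf x Dx).
  by apply: filterS (nD x Dx) => y /fg.
have E x : D x -> 'D_(e i) f x = 'D_(e i) g x.
  move=> Dx; apply: near_eq_derive => //.
  by apply: filterS (nD x Dx) => y /fg.
split; last exact: IH E (df i).2.
move=> x Dx; apply: near_eq_derivable ((df i).1 x Dx) => //.
by apply: filterS (nD x Dx) => y /fg.
Qed.

Lemma Ck_cst k D (a : R) : open D -> Ck k D (cst a).
Proof.
move=> oD; elim: k a => [|k IH] a; first by split=> // x _; exact: cst_continuous.
split=> [x _|i]; first exact: cst_continuous.
split; first by move=> x _; exact: derivable_cst.
by apply: (@Ck_ext k D (cst 0)) => // x _; rewrite derive_cst.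
Qed.

Lemma CkD k D f g : open D -> Ck k D f -> Ck k D g -> Ck k D (fun x => f x + g x).
Proof.
move=> oD; elim: k f g => [|k IH] f g [cf df] [cg dg].
  by split=> // x Dx; apply: continuousD; [exact: cf|exact: cg].
split=> [x Dx|i]; first by apply: continuousD; [exact: cf|exact: cg].
split; first by move=> x Dx; apply: derivableD; [exact: (df i).1|exact: (dg i).1].
apply: (@Ck_ext k D (fun x => 'D_(e i) f x + 'D_(e i) g x)) => //; last first.
  by apply: IH; [exact: (df i).2|exact: (dg i).2].
by move=> x Dx; rewrite [RHS]deriveD//; [exact: (df i).1|exact: (dg i).1].
Qed.

Lemma CkM k D f g : open D -> Ck k D f -> Ck k D g -> Ck k D (fun x => f x * g x).
Proof.
move=> oD; elim: k f g => [|k IH] f g fk gk.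
  by split=> // x Dx; apply: continuousM; [exact: fk.1|exact: gk.1].
have [cf df] := fk; have [cg dg] := gk.
split=> [x Dx|i]; first by apply: continuousM; [exact: cf|exact: cg].
split; first by move=> x Dx; apply: derivableM; [exact: (df i).1|exact: (dg i).1].
apply: (@Ck_ext k D (fun x => f x * 'D_(e i) g x + g x * 'D_(e i) f x)) => //; last first.
  by apply: CkD => //; apply: IH;
    [exact: CkS fk|exact: (dg i).2|exact: CkS gk|exact: (df i).2].
by move=> x Dx; rewrite [RHS]deriveM//; [exact: (df i).1|exact: (dg i).1].
Qed.

Lemma CkN k D f : open D -> Ck k D f -> Ck k D (fun x => - f x).
Proof.
move=> oD fk; apply: (@Ck_ext k D (fun x => cst (-1) x * f x)) => //.
  by move=> x _; rewrite /cst mulN1r.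
by apply: CkM => //; exact: Ck_cst.
Qed.

Lemma Ck_sum (J : Type) (s : seq J) k D (f : J -> V -> R) : open D ->
  (forall j, Ck k D (f j)) -> Ck k D (fun x => \sum_(j <- s) f j x).
Proof.
move=> oD fk; elim: s => [|j s IH].
  by apply: (@Ck_ext k D (cst 0)) => //; [move=> x _; rewrite big_nil|exact: Ck_cst].
apply: (@Ck_ext k D (fun x => f j x + \sum_(j <- s) f j x)) => //; last exact: CkD.
by move=> x _; rewrite big_cons.
Qed.

End Ck.

(** * Chain rule and affine changes of variable *)

Section Ck_comp.
Context (R : realType) (V : normedModType R) (I : Type) (e : I -> V).
(* On the line, the family of directions is reduced to the vector 1. *)
Local Notation Ck1 := (@Ck R R unit (fun=> 1)).

(** [g] is only assumed derivable along [v]; on the line through [x] in this direction the claim is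
    the chain rule in one variable. *)
Lemma derive_comp1 (F : R -> R) (g : V -> R) x v :
  derivable g x v -> derivable F (g x) 1 ->
  derivable (F \o g) x v /\ 'D_v (F \o g) x = 'D_1 F (g x) * 'D_v g x.
Proof.
move=> dg dF; pose h t := g (t *: v + x).
have h0 : h 0 = g x by rewrite /h scale0r add0r.
have [gE gd] : 'D_v g x = 'D_1 h 0 /\ (derivable g x v <-> derivable h 0 1).
  by apply: derive_slice => // t; rewrite /h addr0 [t *: 1]mulr1.
have [fE fd] : 'D_v (F \o g) x = 'D_1 (F \o h) 0 /\
    (derivable (F \o g) x v <-> derivable (F \o h) 0 1).
  by apply: derive_slice => [t|]; rewrite /= /h ?addr0 ?[t *: 1]mulr1// scale0r add0r.
have dh : derivable h 0 1 by exact: (iffLR gd dg).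
have dF' : derivable F (h 0) 1 by rewrite h0.
split.
  apply/fd; apply/derivable1_diffP; apply: differentiable_comp;
    exact/derivable1_diffP.
by rewrite fE gE -derive1E (derive1_comp dh dF') !derive1E h0.
Qed.

Lemma Ck_comp k (E : set R) D (F : R -> R) (g : V -> R) : open D -> open E ->
  (forall x, D x -> E (g x)) -> Ck1 k E F -> Ck e k D g -> Ck e k D (F \o g).
Proof.
move=> oD oE DE; elim: k F g DE => [|k IH] F g DE Fk gk.
  by split=> // x Dx; apply: continuous_comp; [exact: gk.1|exact: (Fk.1 _ (DE _ Dx))].
have [cF /(_ tt)[dF Fk']] := Fk; have [cg dg] := gk.
split=> [x Dx|i].
  by apply: continuous_comp; [exact: cg|exact: (cF _ (DE _ Dx))].
split; first by move=> x Dx; apply: (derive_comp1 _ _).1; [exact: (dg i).1|exact: (dF _ (DE _ Dx))].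
apply: (@Ck_ext _ _ _ _ k D (fun x => ('D_1 F \o g) x * 'D_(e i) g x)) => //.
  by move=> x Dx; rewrite (derive_comp1 _ _).2//; [exact: (dg i).1|exact: (dF _ (DE _ Dx))].
by apply: CkM => //; [exact: IH (CkS gk)|exact: (dg i).2].
Qed.

(* Composition with an affine map sending each line of direction [e' j] to a
   line of direction [e (s j)]. *)
Lemma Ck_affine (W : normedModType R) (J : Type) (e' : J -> W) (s : J -> I)
    (phi : W -> V) k D (f : V -> R) :
  continuous phi -> (forall j (h : R) y, phi (h *: e' j + y) = h *: e (s j) + phi y) ->
  open D -> Ck e k D f -> Ck e' k (phi @^-1` D) (f \o phi).
Proof.
move=> cphi hphi oD; have oD' : open (phi @^-1` D).
  by apply: open_comp => // x _; exact: cphi.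
elim: k f => [|k IH] f [cf df].
  by split=> // x Dx; apply: continuous_comp; [exact: cphi|exact: cf].
have E j x : 'D_(e' j) (f \o phi) x = 'D_(e (s j)) f (phi x) /\
    (derivable (f \o phi) x (e' j) <-> derivable f (phi x) (e (s j))).
  by apply: derive_slice => // h; rewrite /= hphi.
split=> [x Dx|j].
  by apply: continuous_comp; [exact: cphi|exact: cf].
split.
  move=> x Dx; apply: (iffRL (E j x).2); exact: (df (s j)).1.
apply: (@Ck_ext _ _ _ _ k _ ('D_(e (s j)) f \o phi)) => //.
  by move=> x _; rewrite (E j x).1.
exact: IH (df (s j)).2.
Qed.

End Ck_comp.

(** * Smooth functions on [R^n] *)

Section smooth_rV.
Context (R : realType) (n : nat).
Local Notation Ck1 := (@Ck R R unit (fun=> 1)).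
Local Notation Ckn := (@Ck R 'rV[R]_n 'I_n (fun i => delta_mx ord0 i)).

Lemma partials_rcons s i (f : 'rV[R]_n -> R) :
  partials (rcons s i) f = partials s (partial i f).
Proof. by rewrite /partials foldr_rcons. Qed.

Lemma smooth_on_partial D i (f : 'rV[R]_n -> R) :
  smooth_on D f -> smooth_on D (partial i f).
Proof. by move=> sf s x Dx; rewrite -partials_rcons; exact: sf. Qed.

Lemma smooth_onP D (f : 'rV[R]_n -> R) : smooth_on D f <-> forall k, Ckn k D f.
Proof.
split=> [sf k|fk s].
  elim: k f sf => [|k IH] f sf; first by split=> // x Dx; exact: (sf [::] x Dx).1.
  split=> [x Dx|i]; first exact: (sf [::] x Dx).1.
  split; first by move=> x Dx; exact: (sf [::] x Dx).2.
  exact/IH/smooth_on_partial.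
have := fk (size s).+1; elim/last_ind: s f {fk} => [|s i IH] f [cf df] x Dx.
  by split=> [|i]; [exact: cf|exact: (df i).1].
rewrite size_rcons in df; rewrite partials_rcons; apply: IH => //.
exact: (df i).2.
Qed.

Lemma smooth_on_continuous D (f : 'rV[R]_n -> R) x :
  smooth_on D f -> D x -> {for x, continuous f}.
Proof. by move=> sf Dx; exact: (sf [::] x Dx).1. Qed.

Lemma smooth_on_derivable D (f : 'rV[R]_n -> R) x i :
  smooth_on D f -> D x -> derivable f x (delta_mx ord0 i).
Proof. by move=> sf Dx; exact: (sf [::] x Dx).2. Qed.

Lemma smooth_on_subset D E (f : 'rV[R]_n -> R) :
  E `<=` D -> smooth_on D f -> smooth_on E f.
Proof. by move=> ED sf s x /ED; exact: sf. Qed.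

Lemma smooth_on_ext D (f g : 'rV[R]_n -> R) : open D ->
  (forall x, D x -> f x = g x) -> smooth_on D f -> smooth_on D g.
Proof. by move=> oD fg /smooth_onP sf; apply/smooth_onP => k; exact: Ck_ext fg _. Qed.

Lemma smooth_on_local D (f : 'rV[R]_n -> R) :
  (forall x, D x -> exists U, [/\ open U, U x & smooth_on U f]) -> smooth_on D f.
Proof.
move=> h; apply/smooth_onP => k; apply: Ck_local => x /h[U [oU Ux]].
by move=> /smooth_onP sU; exists U.
Qed.

Lemma smooth_on_cst D (a : R) : open D -> smooth_on D (fun _ : 'rV[R]_n => a).
Proof. by move=> oD; apply/smooth_onP => k; exact: Ck_cst. Qed.

Lemma smooth_onD D (f g : 'rV[R]_n -> R) : open D ->
  smooth_on D f -> smooth_on D g -> smooth_on D (fun x => f x + g x).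
Proof.
by move=> oD /smooth_onP sf /smooth_onP sg; apply/smooth_onP => k; exact: CkD.
Qed.

Lemma smooth_onM D (f g : 'rV[R]_n -> R) : open D ->
  smooth_on D f -> smooth_on D g -> smooth_on D (fun x => f x * g x).
Proof.
by move=> oD /smooth_onP sf /smooth_onP sg; apply/smooth_onP => k; exact: CkM.
Qed.

Lemma smooth_onN D (f : 'rV[R]_n -> R) : open D ->
  smooth_on D f -> smooth_on D (fun x => - f x).
Proof. by move=> oD /smooth_onP sf; apply/smooth_onP => k; exact: CkN. Qed.

Lemma smooth_on_sum (J : finType) D (f : J -> 'rV[R]_n -> R) : open D ->
  (forall j, smooth_on D (f j)) -> smooth_on D (fun x => \sum_j f j x).
Proof.
move=> oD sf; apply/smooth_onP => k; apply: Ck_sum => // j.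
by have /smooth_onP := sf j.
Qed.

Lemma smooth_on_comp (E : set R) D (F : R -> R) (g : 'rV[R]_n -> R) :
  open D -> open E -> (forall x, D x -> E (g x)) ->
  (forall k, Ck1 k E F) -> smooth_on D g -> smooth_on D (fun x => F (g x)).
Proof.
move=> oD oE DE Fk /smooth_onP gk; apply/smooth_onP => k.
exact: (@Ck_comp _ _ _ _ k E D F g).
Qed.

Lemma coord_continuous_rV (i : 'I_n) : continuous (fun v : 'rV[R]_n => v ord0 i).
Proof. by move=> v; apply: differentiable_continuous; exact: differentiable_coord. Qed.

Lemma partial_coord (i j : 'I_n) x :
  partial i (fun v : 'rV[R]_n => v ord0 j) x = (j == i)%:R /\
  derivable (fun v : 'rV[R]_n => v ord0 j) x (delta_mx ord0 i).
Proof.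
pose g (t : R) := t * (j == i)%:R + x ord0 j.
have [gE gd] : 'D_(delta_mx ord0 i) (fun v : 'rV[R]_n => v ord0 j) x = 'D_1 g 0 /\
    (derivable (fun v : 'rV[R]_n => v ord0 j) x (delta_mx ord0 i) <-> derivable g 0 1).
  apply: derive_slice => [h|]; last by rewrite /g mul0r add0r.
  by rewrite rV_lineE /g addr0 [h *: 1]mulr1.
have : is_derive (0 : R) (1 : R) g (j == i)%:R.
  rewrite /g; apply: is_derive_eq; by rewrite scaler0 add0r addr0 -[LHS]/(_ * 1) mulr1.
move=> [gd' gv]; split; first by rewrite /partial gE gv.
exact: (iffRL gd gd').
Qed.

Lemma smooth_on_coord D (j : 'I_n) : open D ->
  smooth_on D (fun v : 'rV[R]_n => v ord0 j).
Proof.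
move=> oD; apply/smooth_onP => -[|k].
  by split=> // x _; exact: coord_continuous_rV.
split=> [x _|i]; first exact: coord_continuous_rV.
split; first by move=> x _; exact: (partial_coord i j x).2.
apply: (@Ck_ext _ _ _ _ k D (cst (j == i)%:R)) => //; last exact: Ck_cst.
by move=> x _; have := (partial_coord i j x).1.
Qed.

End smooth_rV.

(** * Smooth cutoffs and primitives on the line *)

Section one_variable.
Context (R : realType).
Local Notation Ck1 := (@Ck R R unit (fun=> 1)).
Implicit Types (F f g : R -> R) (D : set R).

Lemma MVT_closed f df (a b : R) : a <= b ->
  (forall x, a <= x <= b -> is_derive x 1 f (df x)) ->
  exists2 c, a <= c <= b & f b - f a = df c * (b - a).
Proof.
move=> ab fd; have [||c cab E] := @MVT_segment R f df a b ab.
- by move=> x; rewrite in_itv/= => /andP[/ltW ax /ltW xb]; apply: fd; rewrite ax xb.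
- apply: derivable_within_continuous => x; rewrite in_itv /= => xab.
  by have := fd x xab; case.
by exists c => //; move: cab; rewrite in_itv.
Qed.

Lemma Ck1S k D F f : open D -> (forall x, D x -> is_derive x 1 F (f x)) ->
  Ck1 k D f -> Ck1 k.+1 D F.
Proof.
move=> oD FD fk; split=> [x Dx|_].
  by apply/differentiable_continuous/derivable1_diffP; have [] := FD x Dx.
split; first by move=> x Dx; have [] := FD x Dx.
by apply: Ck_ext fk => // x Dx; have [_ ->] := FD x Dx.
Qed.

Lemma Ck1_derive k D F f : open D -> (forall x, D x -> is_derive x 1 F (f x)) ->
  Ck1 k.+1 D F -> Ck1 k D f.
Proof.
move=> oD FD [_ /(_ tt)[_ h]]; apply: Ck_ext h => // x Dx.
by have [_ ->] := FD x Dx.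
Qed.

Lemma Ck1_powR k (p : R) : Ck1 k [set t | 0 < t] (fun t => t `^ p).
Proof.
have oD : open [set t : R | 0 < t] by exact: open_gt.
elim: k p => [|k IH] p.
  split=> // x x0; apply/differentiable_continuous/derivable1_diffP.
  by have [] := is_derive1_powR p x0.
apply: (@Ck1S _ _ _ (fun t => p * t `^ (p - 1))) => //.
by apply: CkM => //; exact: Ck_cst.
Qed.

Lemma Ck1_affine k D F (c d : R) : open D -> Ck1 k D F ->
  Ck1 k [set t | D (c * t + d)] (fun t => F (c * t + d)).
Proof.
move=> oD Fk; have dl (t : R) : is_derive t 1 (fun t => c * t + d) c.
  by apply: is_derive_eq; rewrite addr0 [c *: 1]mulr1.
have cl : continuous (fun t => c * t + d).
  by move=> t; apply/differentiable_continuous/derivable1_diffP; have [] := dl t.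
have oE : open [set t | D (c * t + d)] by apply: open_comp => // t _; exact: cl.
apply: (@Ck_comp R R unit (fun=> 1) k D _ F (fun t => c * t + d)) => //.
have h m : Ck1 m setT (fun t => c * t + d).
  case: m => [|m]; first by split=> // t _; exact: cl.
  by apply: (Ck1S openT (fun t _ => dl t)); apply: Ck_cst; exact: openT.
exact: Ck_subset (h k).
Qed.

(** Since [0 < s], the open half-lines [t < s] and [0 < t] cover the line and overlap, so regularity
    is local on each of them. *)
Lemma Ck1_glue k F (s : R) : 0 < s -> (forall t, t <= s -> F t = 0) ->
  Ck1 k [set t | 0 < t] F -> Ck1 k setT F.
Proof.
move=> s0 F0 Fk; apply: Ck_local => t _; have [ts|st] := ltP t s.
  have oS : open [set t : R | t < s] by exact: open_lt.
  exists [set t | t < s]; split => //.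
  apply: (@Ck_ext _ _ _ _ k _ (cst 0)) => //; last exact: Ck_cst.
    by move=> x /= /ltW /F0 ->.
exists [set t | 0 < t]; split => //.
exact: lt_le_trans s0 st.
Qed.

Lemma is_derive_quadratic f (C x : R) : f x = 0 -> (forall h, `|f (h + x)| <= C * h ^+ 2) ->
  is_derive x 1 f 0.
Proof.
move=> f0 fC; have C0 : 0 <= C.
  by have := fC 1; rewrite expr1n mulr1; apply: le_trans.
have h : h^-1 *: ((f \o shift x) (h *: 1) - f x) @[h --> 0^'] --> (0 : R).
  apply/cvgrPdist_le => e e0; near=> h.
  have h0 : h != 0 by near: h; exact: nbhs_dnbhs_neq.
  rewrite sub0r normrN f0 subr0 /= [h *: 1]mulr1 normrZ normfV.
  rewrite ler_pdivrMl ?normr_gt0//.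
  apply: le_trans (fC h) _; rewrite -real_normK ?num_real// expr2.
  rewrite mulrCA ler_wpM2l//.
  have : `|h| <= e / (C + 1).
    near: h; apply: dnbhs0_le; by rewrite divr_gt0// ltr_wpDl.
  rewrite ler_pdivlMr ?ltr_wpDl//; apply: le_trans.
  by rewrite mulrC ler_wpM2l// lerDl.
have df : derivable f x 1 by apply/cvg_ex; exists 0.
by split => //; apply/cvg_lim.
Unshelve. all: by end_near. Qed.

(* [flat m] is t^(-m) exp(-1/t) extended by 0: the derivative of [flat m] is a
   combination of [flat m.+1] and [flat m.+2]. *)
Definition flat m (t : R) : R := if t <= 0 then 0 else t^-1 ^+ m * expR (- t^-1).

(** With [s = 1/t], [exp s >= s^(m+2) / (m+2)!]. The exponent exceeds [m] by two, which leaves the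
    factor [t^2] required by [is_derive_quadratic] at 0. *)
Lemma flat_le m t : `|flat m t| <= m.+2`!%:R * t ^+ 2.
Proof.
rewrite /flat; case: ifPn => t0; first by rewrite normr0 mulr_ge0// sqr_ge0.
rewrite -ltNge in t0; set s := t^-1; have s0 : 0 < s by rewrite invr_gt0.
rewrite ger0_norm; last by rewrite mulr_ge0 ?expR_ge0// exprn_ge0// ltW.
have := expR_ge1Dxn m.+1 (ltW s0).
have fm : (0 : R) < m.+2`!%:R by rewrite ltr0n fact_gt0.
rewrite expRN ler_pdivrMr ?expR_gt0// => h.
have ts : t * s = 1 by rewrite divff// gt_eqF.
have E : s ^+ m = m.+2`!%:R * t ^+ 2 * (s ^+ m.+2 / m.+2`!%:R).
  transitivity (s ^+ m * (t * s) ^+ 2); first by rewrite ts expr1n mulr1.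
  by rewrite !exprS; field; rewrite gt_eqF.
rewrite [leLHS]E; apply: ler_wpM2l; first by rewrite mulr_ge0 ?sqr_ge0.
by apply: le_trans h; rewrite lerDr.
Qed.

Lemma is_derive_flat m (t : R) :
  is_derive t 1 (flat m) (- m%:R * flat m.+1 t + flat m.+2 t).
Proof.
have [t0|t0|->] := ltgtP t 0; last first.
- rewrite /flat lexx mulr0 addr0; apply: (@is_derive_quadratic _ m.+2`!%:R).
    by rewrite /flat lexx.
  by move=> h; rewrite addr0; exact: flat_le.
- have tn0 : t != 0 by rewrite gt_eqF.
  have dV : is_derive t 1 (fun s : R => s^-1) (- t^-1 ^+ 2).
    have := @is_deriveV R id t 1 1 tn0 (is_derive_id _ _).
    by rewrite /= -exprVn [_ *: 1]mulr1.
  apply: (@near_eq_is_derive R R R (fun s : R => s^-1 ^+ m * expR (- s^-1))).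
  + near=> s; rewrite /flat leNgt.
    have -> // : 0 < s by near: s; exact: lt_nbhsr.
  have dN : is_derive t 1 (fun s : R => - s^-1) (t^-1 ^+ 2).
    by rewrite -[t^-1 ^+ 2]opprK; exact: is_deriveN.
  have dE : is_derive t 1 (fun s : R => expR (- s^-1)) (t^-1 ^+ 2 * expR (- t^-1)).
    have := @is_derive1_comp R expR (fun s => - s^-1) t _ _ (is_derive_expR _) dN.
    by rewrite mulrC.
  have dX : is_derive t 1 (fun s : R => s^-1 ^+ m) (m%:R * t^-1 ^+ m.-1 * - t^-1 ^+ 2).
    have := @is_deriveX R R (fun s : R => s^-1) m t 1 _ dV.
    by rewrite exprfctE.
  have dM := @is_deriveM R R _ _ _ _ _ _ dX dE.
  apply: (is_derive_eq dM); rewrite /flat leNgt t0 /= /GRing.scale /=.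
  move: (t^-1) (expR _) => s E; case: m {dX dM} => [|m] /=.
    by rewrite !mul0r oppr0 mulr0 addr0 expr0 mul1r mul0r add0r.
  rewrite !exprS; ring.
- rewrite /flat (ltW t0) mulr0 addr0.
  apply: (@near_eq_is_derive R R R (cst 0)).
  near=> s; rewrite /flat.
  by have -> // : s <= 0 by apply: ltW; near: s; exact: lt_nbhsl.
Unshelve. all: by end_near. Qed.

Lemma Ck1_flat k m : Ck1 k setT (flat m).
Proof.
have oT : open [set: R] by exact: openT.
elim: k m => [|k IH] m.
  split=> // t _; apply/differentiable_continuous/derivable1_diffP.
  by have [] := is_derive_flat m t.
apply: (@Ck1S _ _ _ _ oT) => [t _|]; first exact: is_derive_flat.
by apply: CkD => //; apply: CkM => //; exact: Ck_cst.
Qed.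

Lemma flat0_ge0 t : 0 <= flat 0 t.
Proof. by rewrite /flat; case: ifPn => // _; rewrite expr0 mul1r expR_ge0. Qed.

Lemma flat0_gt0 t : 0 < t -> 0 < flat 0 t.
Proof. by move=> t0; rewrite /flat leNgt t0 /= expr0 mul1r expR_gt0. Qed.

Lemma antiderivative f (s : R) : continuous f -> (forall t, t <= s -> f t = 0) ->
  exists2 F, (forall t : R, is_derive t 1 F (f t)) & forall t, t <= s -> F t = 0.
Proof.
(* The integral starts strictly to the left of [s], so that the fundamental theorem applies at
   [t = s] too; nothing is added since [f] vanishes there. *)
move=> cf f0; pose F x := (\int[@lebesgue_measure R]_(t in `[s - 1, x]) f t)%R.
have F0 t : t <= s -> F t = 0.
  move=> ts; rewrite /F /Rintegral integral0_eq// => u /=.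
  by rewrite in_itv /= => /andP[_ ut]; rewrite f0// (le_trans ut).
exists F => // t; have [ts|st] := ltP t s.
  rewrite f0 ?ltW//; apply: (@near_eq_is_derive R R R (cst 0)).
  by near=> u; rewrite F0//; apply: ltW; near: u; exact: lt_nbhsl.
have tt1 : t < t + 1 by rewrite ltrDl.
have fi : (@lebesgue_measure R).-integrable `[s - 1, t + 1] (EFin \o f).
  apply: continuous_compact_integrable; first exact: segment_compact.
  exact: continuous_subspaceT.
have st1 : s - 1 < t by rewrite ltrBlDr (le_lt_trans st).
have [dF F'] := @continuous_FTC1_closed R f (s - 1) t (t + 1) tt1 fi st1 (cf t).
by split; [exact: dF|rewrite -derive1E].
Unshelve. all: by end_near. Qed.

Lemma derive0_const f (a b : R) : (forall t : R, a <= t <= b -> is_derive t 1 f 0) ->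
  forall t, a <= t <= b -> f t = f a.
Proof.
move=> df t /andP[a_t tb]; have [x xat|c _] := @MVT_closed f (cst 0) a t a_t.
  by move/andP: xat => [ax xt]; apply: df; rewrite ax (le_trans xt).
by rewrite mul0r => /eqP; rewrite subr_eq0 => /eqP.
Qed.

Lemma antiderivative_smooth f (s T : R) : (forall k, Ck1 k setT f) ->
  (forall t, t <= s -> f t = 0) -> (forall t, T <= t -> f t = 0) ->
  exists F, [/\ (forall t : R, is_derive t 1 F (f t)), (forall k, Ck1 k setT F),
    (forall t, t <= s -> F t = 0) & (forall t, T <= t -> F t = F T)].
Proof.
move=> fk f0 fT; have cf : continuous f by move=> t; exact: ((fk 0%N).1 t I).
have [F dF F0] := antiderivative cf f0; exists F; split => //.
  case=> [|k]; last by apply: (@Ck1S _ _ _ f) => //; exact: openT.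
  by split=> // t _; apply/differentiable_continuous/derivable1_diffP; have [] := dF t.
move=> t Tt; apply: (@derive0_const F T t) => [u /andP[Tu _]|]; last by rewrite Tt lexx.
by rewrite -(fT u Tu).
Qed.

Lemma smooth_step : exists chi chi' : R -> R,
  [/\ forall t : R, is_derive t 1 chi (chi' t), forall k, Ck1 k setT chi,
      forall t, t <= 0 -> chi t = 0, forall t, 1 <= t -> chi t = 1
    & [/\ forall t, 0 <= chi' t, forall t, 0 <= chi t <= 1,
       forall t, t <= 0 \/ 1 <= t -> chi' t = 0
       & exists C, forall t, chi' t <= C]].
Proof.
(* A bump supported in [[0, 1]]; the step is its primitive, normalized by the value at 1. *)
pose b t := flat 0 t * flat 0 (1 - t).
have oT : open [set: R] by exact: openT.
have bk k : Ck1 k setT b.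
  apply: CkM => //; first exact: Ck1_flat.
  have := @Ck1_affine k setT (flat 0) (-1) 1 oT (Ck1_flat k 0).
  apply: Ck_ext; first by rewrite (_ : [set _ | _] = setT)//; exact/seteqP.
  by move=> x _; rewrite mulN1r addrC.
have b0 t : t <= 0 -> b t = 0 by move=> t0; rewrite /b /flat t0 mul0r.
have b1 t : 1 <= t -> b t = 0.
  by move=> t1; rewrite /b [X in _ * X]/flat subr_le0 t1 mulr0.
have [B [dB Bk B0 B1]] := antiderivative_smooth bk b0 b1.
have b_ge0 t : 0 <= b t by rewrite mulr_ge0// flat0_ge0.
have Bmono x y : x <= y -> B x <= B y.
  move=> xy; have [c _] := @MVT_closed B b x y xy (fun z _ => dB z).
  by move=> /eqP; rewrite subr_eq => /eqP ->; rewrite lerDr mulr_ge0// subr_ge0.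
have B1_gt0 : 0 < B 1.
  (* The mean value theorem on [[1/4, 1/2]], well inside the region where the bump is positive,
     gives a strict increase of [B]. *)
  have h41 : (4^-1 : R) <= 2^-1 by rewrite lef_pV2 ?posrE// ler_nat.
  have [c] := @MVT_closed B b 4^-1 2^-1 h41 (fun z _ => dB z).
  move=> /andP[c1 c2] E; have c0 : 0 < c by apply: lt_le_trans c1; rewrite invr_gt0.
  have c3 : 0 < 1 - c by rewrite subr_gt0 (le_lt_trans c2)// invf_lt1// ltr1n.
  have : B 4^-1 < B 2^-1.
    rewrite -subr_gt0 E mulr_gt0 ?mulr_gt0 ?flat0_gt0//.
    by rewrite subr_gt0 ltf_pV2 ?posrE// ltr_nat.
  have B4 : 0 <= B 4^-1 by rewrite -(B0 0)//; apply: Bmono; rewrite invr_ge0.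
  have B2 : B 2^-1 <= B 1 by apply: Bmono; rewrite invf_le1// ler1n.
  by move=> h; exact: le_lt_trans B4 (lt_le_trans h B2).
have [C hC] : exists C, forall t, b t <= C.
  exists 4 => t; have h s : flat 0 s <= 2 * s ^+ 2.
    exact: le_trans (ler_norm _) (flat_le 0 s).
  have [t0|t0] := leP t 0; first by rewrite b0.
  have [t1|t1] := leP 1 t; first by rewrite b1.
  apply: (@le_trans _ _ (2 * 2)); last by rewrite -natrM.
  rewrite /b ler_pM ?flat0_ge0//.
    by apply: le_trans (h t) _; rewrite ler_piMr// expr_le1// ltW.
  have t2 : 0 <= 1 - t by lra.
  have t3 : 1 - t <= 1 by lra.
  by apply: le_trans (h _) _; rewrite ler_piMr// expr_le1.
exists (fun t => (B 1)^-1 * B t), (fun t => (B 1)^-1 * b t); split.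
- by move=> t; apply: is_deriveZ; exact: dB.
- by move=> k; apply: CkM => //; exact: Ck_cst.
- by move=> t t0; rewrite (B0 t)// mulr0.
- by move=> t t1; rewrite (B1 t)// mulVf// gt_eqF.
split.
- by move=> t; rewrite mulr_ge0// invr_ge0 ltW.
- move=> t; have Bt0 : 0 <= B t.
    by have [t0|t0] := leP t 0; [rewrite (B0 t)|rewrite -(B0 0)//; apply: Bmono; exact: ltW].
  rewrite mulr_ge0 ?invr_ge0 ?(ltW B1_gt0)//= mulrC ler_pdivrMr// mul1r.
  by have [t1|t1] := leP 1 t; [rewrite (B1 t)|apply: Bmono; exact: ltW].
- by move=> t [t0|t1]; [rewrite b0 ?mulr0|rewrite b1 ?mulr0].
- by exists ((B 1)^-1 * C) => t; rewrite ler_wpM2l// invr_ge0 ltW.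
Qed.

End one_variable.

(** * The fundamental solution near its pole and at infinity *)

Section pole.
Context (R : realType) (n : nat).
Local Notation rV := ('rV[R]_n.+1).
Context (A : rV -> 'M[R]_n.+1) (Gamma : rV -> rV -> R)
  (hG : admissible_fundamental_solution A Gamma).
Local Notation Ck1 := (@Ck R R unit (fun=> 1)).

Lemma Gamma_sym (x y : rV) : x != y -> Gamma x y = Gamma y x.
Proof. by have [_ [h _ _ _ _]] := hG; move=> /h[]. Qed.

Lemma Gamma_gt0 (x y : rV) : x != y -> 0 < Gamma x y.
Proof. by have [_ [h _ _ _ _]] := hG; move=> /h[]. Qed.

Lemma open_rV_neq (x : rV) : open [set y | x != y].
Proof.
rewrite (_ : [set y | _] = ~` [set x]).
  by rewrite openC; apply: compact_closed; [exact: norm_hausdorff|exact: compact_set1].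
by apply/seteqP; split=> y /= h; [move=> yx; rewrite yx eqxx in h|apply/eqP => xy; apply: h].
Qed.

Lemma ball_row_mx (x x' y y' : rV) (e : R) : ball x e x' -> ball y e y' ->
  ball (row_mx x y) e (row_mx x' y').
Proof.
move=> [e0 bx] [_ bY]; split=> // i j; have [k ->|k ->] := @split_ordP n.+1 n.+1 j.
  by rewrite !row_mxEl.
by rewrite !row_mxEr.
Qed.

Lemma open_diag : open [set z : 'rV[R]_(n.+1 + n.+1) | lsubmx z != rsubmx z].
Proof.
rewrite openE => z /= h; have /nbhs_ballP[e /= e0 he] : nbhs (lsubmx z - rsubmx z) [set y : rV | 0 != y].
  by apply: open_nbhs_nbhs; split; [exact: open_rV_neq|rewrite /= eq_sym subr_eq0].
apply/nbhs_ballP; exists (e / 2); rewrite /= ?divr_gt0// => z' [_ zz'].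
have : ball (lsubmx z - rsubmx z) e (lsubmx z' - rsubmx z').
  split=> // i j; rewrite !mxE /ball /= opprB.
  have := zz' i (lshift _ j); have := zz' i (rshift _ j); rewrite /ball /=.
  move: (z i _) (z i _) (z' i _) (z' i _) => a b c d h1 h2.
  rewrite (_ : _ - _ + _ = (a - c) + (d - b)); last by ring.
  by rewrite (le_lt_trans (ler_normD _ _))// (splitr e) ltrD// distrC.
by move=> /he /=; rewrite eq_sym subr_eq0.
Qed.

Lemma Gamma_continuous2 (x y : rV) e : x != y -> 0 < e ->
  exists2 d, 0 < d & forall x' y', ball x d x' -> ball y d y' ->
    `|Gamma x y - Gamma x' y'| < e.
Proof.
move=> xy e0; have [sG _] := hG.
have /(smooth_on_continuous sG) : [set z : 'rV[R]_(n.+1 + n.+1) | lsubmx z != rsubmx z] (row_mx x y).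
  by rewrite /= row_mxKl row_mxKr.
move=> /cvgrPdist_lt/(_ _ e0) /nbhs_ballP[d /= d0 hd]; exists d => // x' y' bx bY.
by have := hd _ (ball_row_mx bx bY); rewrite !row_mxKl !row_mxKr.
Qed.

(** Joint smoothness on [R^(n+n)] is restricted to a slice through the affine map sending [y] to
    [(x, y)]. *)
Lemma smooth_Gamma x : smooth_on [set y | x != y] (Gamma x).
Proof.
have [sG _] := hG; apply/smooth_onP => k; move/smooth_onP : sG => /(_ k) sG.
have := @Ck_affine R _ _ _ rV 'I_n.+1 (fun i => delta_mx ord0 i) (@rshift n.+1 n.+1)
  (fun y => row_mx x y) k _ _ _ _ open_diag sG.
rewrite (_ : _ @^-1` _ = [set y | x != y]); last first.
  by apply/seteqP; split=> y /=; rewrite row_mxKl row_mxKr.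
rewrite (_ : _ \o _ = Gamma x); last by apply/funext => y /=; rewrite row_mxKl row_mxKr.
apply.
  move=> y B /nbhs_ballP[e /= e0 eB]; apply/nbhs_ballP; exists e => //= y' yy'.
  by apply: eB; apply: ball_row_mx => //; exact: ballxx.
move=> j h y; apply/rowP => i; rewrite rV_lineE; have [l ->|l ->] := @split_ordP n.+1 n.+1 i.
  by rewrite !row_mxEl eq_lrshift mulr0 add0r.
by rewrite !row_mxEr rV_lineE eq_rshift.
Qed.

Lemma Gamma_continuous (x y : rV) : x != y -> {for y, continuous (Gamma x)}.
Proof. by move=> xy; apply: smooth_on_continuous (@smooth_Gamma x) xy. Qed.

Lemma Gamma_pole x (T : R) : exists2 d, 0 < d & forall y, x != y -> ball x d y -> T < Gamma x y.
Proof.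
have [_ [_ h _ _ _]] := hG.
have /cvgryPgt/(_ T) := h x; rewrite /prop_near1 /= => /nbhs_ballP[d /= d0 hd].
by exists d => // y xy bxy; rewrite Gamma_sym//; apply: hd => //; rewrite eq_sym.
Qed.

Lemma Gamma_decay (K : set rV) (e : R) : compact K -> 0 < e ->
  exists M, forall x y, M < `|x| -> K y -> x != y /\ Gamma x y < e.
Proof.
move=> cK e0; have [_ [_ _ h _ _]] := hG.
have [[y0 Ky0]|K0] := pselect (K !=set0); last first.
  by exists 0 => x y _ Ky; exfalso; apply: K0; exists y.
have [M hM] := h K cK (ex_intro _ y0 Ky0) e e0; exists M => x y Mx Ky.
have : (extGamma Gamma x y < e%:E)%E.
  apply: le_lt_trans (hM x Mx); apply: le_trans (lee_abs _).
  by apply: ereal_sup_ubound; exists y.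
by rewrite /extGamma; case: ifPn => [//|xy]; rewrite lte_fin.
Qed.

Lemma Gamma_decay1 x (e : R) : 0 < e ->
  exists M, forall y, M < `|y| -> x != y /\ Gamma x y < e.
Proof.
move=> e0; have [M hM] := @Gamma_decay [set x] e (@compact_set1 _ x) e0.
by exists M => y /hM/(_ erefl)[yx]; rewrite eq_sym yx Gamma_sym// eq_sym.
Qed.

(** The superlevel sets of [Gamma x] shrink to the pole: outside [U], [Gamma x] is bounded by its
    maximum on a compact set, and by 1 far away. *)
Lemma Gamma_base x (U : set rV) : open U -> U x ->
  exists2 T, 0 < T & forall y, x != y -> T <= Gamma x y -> U y.
Proof.
move=> oU Ux; have [M hM] := @Gamma_decay1 x 1 ltr01.
pose K := [set y : rV | `|y| <= M] `&` ~` U.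
have cK : compact K.
  apply: (subclosed_compact _ (@compact_rV_le R n.+1 M)); last by apply: subIsetl.
  apply: closedI; last by rewrite closedC.
  by apply: compact_closed; [exact: norm_hausdorff|exact: compact_rV_le].
have Kx y : K y -> x != y by move=> [_ Uy]; apply/eqP => xy; apply: Uy; rewrite -xy.
have [T [T0 hT]] : exists T : R, 0 < T /\ forall y, K y -> Gamma x y < T.
  have [[y0 Ky0]|K0] := pselect (K !=set0); last first.
    by exists 1; split=> // y Ky; exfalso; apply: K0; exists y.
  have [||c _ hc] := @EVT_max_rV R n.+1 (Gamma x) K _ cK.
  - by exists y0.
  - apply: continuous_in_subspaceT => y; rewrite inE => Ky.
    exact: Gamma_continuous (Kx _ Ky).
  exists (`|Gamma x c| + 1); split; first by rewrite ltr_wpDl.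
  move=> y Ky; rewrite (@le_lt_trans _ _ (Gamma x c))//; first by apply: hc; rewrite inE.
  by rewrite ltr_pwDr// ler_norm.
exists (T + 1); first by rewrite addr_gt0.
move=> y xy Ty; apply: contrapT => Uy.
have [yM|yM] := leP `|y| M.
  by have := hT y (conj yM Uy); rewrite ltNge (le_trans _ Ty)// lerDl.
by have [_] := hM y yM; rewrite ltNge (le_trans _ Ty)// lerDr ltW.
Qed.

(** [c] is meant to be the constant value of [F] near infinity, hence the value of the composition
    around the pole, where [Gamma x x] itself is arbitrary. *)
Definition level x (F : R -> R) (c : R) (y : rV) : R :=
  if x == y then c else F (Gamma x y).

Lemma level_bounded_supp x F c (s : R) : 0 < s -> (forall t, t <= s -> F t = 0) ->
  bounded_supp (level x F c).
Proof.
move=> s0 F0; have [M hM] := Gamma_decay1 x s0; exists M => y /hM[xy ys].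
by rewrite /level (negPf xy) F0// ltW.
Qed.

Lemma smooth_level x F (s T c : R) : 0 < s -> (forall k, Ck1 k setT F) ->
  (forall t, T <= t -> F t = c) -> smooth_on setT (level x F c).
Proof.
move=> s0 Fk FT; apply: smooth_on_local => y _.
have [xy|xy] := eqVneq x y; last first.
  exists [set y | x != y]; split => //; first exact: open_rV_neq.
  apply: (@smooth_on_ext _ _ _ (fun y => F (Gamma x y))); first exact: open_rV_neq.
    by move=> z xz; rewrite /level (negPf xz).
  apply: (@smooth_on_comp _ _ setT) => //; [exact: open_rV_neq|exact: openT|].
  exact: smooth_Gamma.
have [d d0 hd] := Gamma_pole x T; exists (ball x d); split.
- exact: ball_open.
- by rewrite -xy; exact: ballxx.
apply: (@smooth_on_ext _ _ _ (fun=> c)); first exact: ball_open.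
  by move=> z xz; rewrite /level; case: eqVneq => // xz'; rewrite FT// ltW// hd.
by apply: smooth_on_cst; exact: ball_open.
Qed.

Lemma test_level x F (s T c : R) : 0 < s -> (forall k, Ck1 k setT F) ->
  (forall t, t <= s -> F t = 0) -> (forall t, T <= t -> F t = c) ->
  test_fun setT (level x F c).
Proof.
move=> s0 Fk F0 FT; split => //; first exact: smooth_level s0 Fk FT.
by apply/compact_tsuppP; exact: level_bounded_supp F0.
Qed.

End pole.

(** * Integrals of finite sums *)

Section Rintegral_sum.
Context d (T : measurableType d) (R : realType) (mu : {measure set T -> \bar R}).

Lemma integrable_Rsum (J : Type) (s : seq J) (D : set T) (f : J -> T -> R) :
  measurable D -> (forall j, mu.-integrable D (EFin \o f j)) ->
  mu.-integrable D (EFin \o (fun x => \sum_(j <- s) f j x)).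
Proof.
move=> mD fi; rewrite (_ : _ \o _ = (fun x => \sum_(j <- s) (f j x)%:E)%E).
  by apply: integrable_sum => // j _; exact: fi.
by apply/funext => x /=; rewrite sumEFin.
Qed.

Lemma Rintegral_sum (J : Type) (s : seq J) (D : set T) (f : J -> T -> R) :
  measurable D -> (forall j, mu.-integrable D (EFin \o f j)) ->
  \int[mu]_(x in D) (\sum_(j <- s) f j x) = \sum_(j <- s) \int[mu]_(x in D) f j x.
Proof.
move=> mD fi; elim: s => [|j s IH].
  rewrite big_nil (_ : (fun x => _) = cst 0); last by apply/funext => x; rewrite big_nil.
  by rewrite /Rintegral integral0.
rewrite big_cons -IH -RintegralD//; last exact: integrable_Rsum.
by apply: eq_Rintegral => x _; rewrite big_cons.
Qed.

End Rintegral_sum.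

(** * Chain rule and divergence theorem for the operator *)

Section operator_calculus.
Context (R : realType) (n : nat).
Local Notation rV := ('rV[R]_n.+1).
Context (A : rV -> 'M[R]_n.+1) (hA : admissible_matrix A).
Notation mu := lebesgue_rV.

Lemma A_sym x i j : A x i j = A x j i.
Proof. by have [/(_ x) + _ _ _] := hA; move=> /(congr1 (fun M : 'M[R]_n.+1 => M j i)); rewrite mxE. Qed.

Lemma smooth_A D i j : smooth_on D (fun x => A x i j).
Proof. by have [_ _ h _] := hA; apply: smooth_on_subset (h i j). Qed.

Lemma partial_ext (D : set rV) f g i x : open D -> (forall y, D y -> f y = g y) -> D x ->
  partial i f x = partial i g x.
Proof.
move=> oD fg Dx; apply: near_eq_derive.
by apply: filterS (open_nbhs_nbhs (conj oD Dx)) => y /fg.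
Qed.

Lemma partialM (f g : rV -> R) i x : derivable f x (delta_mx ord0 i) ->
  derivable g x (delta_mx ord0 i) ->
  partial i (fun y => f y * g y) x = f x * partial i g x + g x * partial i f x.
Proof. by move=> df dg; exact: (deriveM df dg). Qed.

Lemma partialD (f g : rV -> R) i x : derivable f x (delta_mx ord0 i) ->
  derivable g x (delta_mx ord0 i) ->
  partial i (fun y => f y + g y) x = partial i f x + partial i g x.
Proof. by move=> df dg; exact: (deriveD df dg). Qed.

Lemma partialN (f : rV -> R) i x : derivable f x (delta_mx ord0 i) ->
  partial i (fun y => - f y) x = - partial i f x.
Proof. by move=> df; exact: (deriveN df). Qed.

Lemma smooth_flux D f i j : open D -> smooth_on D f ->
  smooth_on D (fun y => A y i j * partial j f y).
Proof.
move=> oD sf; exact: (@smooth_onM _ _ D (fun y => A y i j) (partial j f) oD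
  (@smooth_A D i j) (smooth_on_partial j sf)).
Qed.

Lemma smooth_Lop D f : open D -> smooth_on D f -> smooth_on D (Lop A f).
Proof.
move=> oD sf.
have h i j : smooth_on D (partial i (fun y => A y i j * partial j f y)).
  exact: (smooth_on_partial i (smooth_flux i j oD sf)).
exact: (smooth_on_sum oD (fun i => smooth_on_sum oD (h i))).
Qed.

Lemma Lop_ext (D : set rV) f g x : open D -> (forall y, D y -> f y = g y) -> D x ->
  Lop A f x = Lop A g x.
Proof.
move=> oD fg Dx; apply: eq_bigr => i _; apply: eq_bigr => j _.
by apply: (partial_ext i oD) => // y Dy; rewrite (partial_ext j oD fg Dy).
Qed.

Definition energy (f : rV -> R) (x : rV) : R :=
  \sum_i \sum_j A x i j * (partial i f x * partial j f x).

Lemma energy_ge0 f x : 0 <= energy f x.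
Proof.
have [_ /(_ x (\row_i partial i f x)) + _ _] := hA; congr (0 <= _).
rewrite mxE [RHS]exchange_big /=; apply: eq_bigr => j _; rewrite !mxE mulr_suml.
by apply: eq_bigr => i _; rewrite !mxE [RHS]mulrCA mulrA.
Qed.

Lemma Lop_comp (D : set rV) (F F1 F2 : R -> R) f x : open D -> smooth_on D f ->
  (forall t : R, is_derive t 1 F (F1 t)) -> (forall t : R, is_derive t 1 F1 (F2 t)) ->
  D x -> Lop A (fun y => F (f y)) x = F1 (f x) * Lop A f x + F2 (f x) * energy f x.
Proof.
move=> oD sf dF dF1 Dx; rewrite /Lop /energy !mulr_sumr -big_split /=.
apply: eq_bigr => i _; rewrite !mulr_sumr -big_split /=; apply: eq_bigr => j _.
have pc (G G1 : R -> R) k y : (forall t : R, is_derive t 1 G (G1 t)) -> D y ->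
    derivable (fun y => G (f y)) y (delta_mx ord0 k) /\
    partial k (fun y => G (f y)) y = G1 (f y) * partial k f y.
  move=> dG Dy; have [dG1 dG2] := dG (f y).
  have [h1 h2] := derive_comp1 (smooth_on_derivable (i := k) sf Dy) dG1.
  by split=> //; rewrite /partial -dG2.
rewrite (partial_ext (D := D) (g := fun y => F1 (f y) * (A y i j * partial j f y)))//; last first.
  by move=> y Dy; rewrite (pc _ _ _ _ dF Dy).2 mulrCA.
rewrite partialM.
- rewrite (pc _ _ _ _ dF1 Dx).2; congr (_ + _).
  by rewrite mulrCA -mulrA (mulrC (partial j f x)).
- exact: (pc _ _ _ _ dF1 Dx).1.
- exact: smooth_on_derivable (smooth_flux i j oD sf) Dx.
Qed.

(** Expanding the divergence of [f A dg - g A df] leaves, besides the left-hand side, the cross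
    terms [<A dg, df> - <A df, dg>], which cancel by symmetry of [A]. *)
Lemma green_pointwise (D : set rV) f g x : open D -> smooth_on D f -> smooth_on D g -> D x ->
  f x * Lop A g x - g x * Lop A f x =
  \sum_i \sum_j partial i (fun y => f y * (A y i j * partial j g y)
                                 + - (g y * (A y i j * partial j f y))) x.
Proof.
move=> oD sf sg Dx; rewrite /Lop !mulr_sumr -sumrB.
have -> : \sum_i \sum_j partial i (fun y => f y * (A y i j * partial j g y)
                           + - (g y * (A y i j * partial j f y))) x =
  \sum_i \sum_j (f x * partial i (fun y => A y i j * partial j g y) x
     - g x * partial i (fun y => A y i j * partial j f y) x) +
  (\sum_i \sum_j (A x i j * partial j g x) * partial i f x
     - \sum_i \sum_j (A x i j * partial j f x) * partial i g x).
  rewrite -sumrB -big_split; apply: eq_bigr => i _ /=.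
  rewrite -sumrB -big_split; apply: eq_bigr => j _ /=.
  have d1 (h : rV -> R) : smooth_on D h -> derivable h x (delta_mx ord0 i).
    by move=> sh; exact: smooth_on_derivable sh Dx.
  have s1 := smooth_flux i j oD sg; have s2 := smooth_flux i j oD sf.
  have d2 := d1 _ (smooth_onM oD sf s1); have d3 := d1 _ (smooth_onM oD sg s2).
  have d4 := d1 _ (smooth_onN oD (smooth_onM oD sg s2)).
  rewrite (partialD d2 d4) (partialN d3) (partialM (d1 _ sf) (d1 _ s1)).
  by rewrite (partialM (d1 _ sg) (d1 _ s2)) opprD addrACA.
have -> : \sum_i \sum_j (A x i j * partial j f x) * partial i g x =
   \sum_i \sum_j (A x i j * partial j g x) * partial i f x.
  rewrite exchange_big; apply: eq_bigr => i _; apply: eq_bigr => j _.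
  by rewrite (A_sym x j i); ring.
rewrite subrr addr0; apply: eq_bigr => i _.
by rewrite !mulr_sumr -sumrB.
Qed.

Lemma integral_divergence (V : 'I_n.+1 -> 'I_n.+1 -> rV -> R) :
  (forall i j, smooth_on setT (V i j)) -> (forall i j, bounded_supp (V i j)) ->
  \int[mu]_x (\sum_i \sum_j partial i (V i j) x) = 0.
Proof.
move=> sV bV; have cV i j : continuous (partial i (V i j)).
  by move=> x; apply: smooth_on_continuous (smooth_on_partial i (sV i j)) _.
have iV i j : mu.-integrable setT (EFin \o partial i (V i j)).
  by apply: integrable_continuous_bounded_supp => //; exact: bounded_supp_partial.
rewrite Rintegral_sum//; last by move=> i; exact: integrable_Rsum.
rewrite big1// => i _; rewrite Rintegral_sum// big1// => j _.
by apply: integral_partial => // x; exact: (smooth_on_derivable (sV i j)).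
Qed.

Lemma bounded_suppM f (g : rV -> R) : bounded_supp g -> bounded_supp (fun x => f x * g x).
Proof. by move=> [M hM]; exists M => x /hM ->; rewrite mulr0. Qed.

Lemma integral_Lop phi : smooth_on setT phi -> bounded_supp phi ->
  \int[mu]_x (Lop A phi x) = 0.
Proof.
move=> sphi bphi; apply: (@integral_divergence (fun i j y => A y i j * partial j phi y)).
  by move=> i j; apply: smooth_flux => //; exact: openT.
by move=> i j; apply: bounded_suppM; exact: bounded_supp_partial.
Qed.

Lemma continuous_Lop phi : smooth_on setT phi -> continuous (Lop A phi).
Proof.
move=> sphi x; have sL : smooth_on setT (Lop A phi) by apply: smooth_Lop => //; exact: openT.
exact: smooth_on_continuous sL _.
Qed.

Lemma bounded_supp_Lop phi : bounded_supp phi -> bounded_supp (Lop A phi).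
Proof.
move=> [M hM]; exists M => x Mx.
have oM : open [set x : rV | M < `|x|].
  apply: (@open_comp _ _ (fun y : rV => `|y|) [set r | M < r]); last exact: open_gt.
  by move=> y _; exact: norm_continuous.
rewrite (@Lop_ext _ phi (cst 0) x oM)//.
rewrite /Lop big1// => i _; rewrite big1// => j _.
rewrite (partial_ext (D := setT) (g := cst 0)) ?/partial ?derive_cst//; first exact: openT.
by move=> y _; rewrite /partial derive_cst mulr0.
Qed.

End operator_calculus.

(** * The equation of [Gamma x] off the pole *)

Section pole_equation.
Context (R : realType) (n : nat).
Local Notation rV := ('rV[R]_n.+1).
Context (A : rV -> 'M[R]_n.+1) (hA : admissible_matrix A).
Context (Gamma : rV -> rV -> R) (hG : admissible_fundamental_solution A Gamma).
Local Notation Ck1 := (@Ck R R unit (fun=> 1)).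
Notation mu := lebesgue_rV.

Lemma bounded_suppMl (f g : rV -> R) : bounded_supp f -> bounded_supp (fun x => f x * g x).
Proof. by move=> [M hM]; exists M => x /hM ->; rewrite mul0r. Qed.

Lemma bounded_suppN (f : rV -> R) : bounded_supp f -> bounded_supp (fun x => - f x).
Proof. by move=> [M hM]; exists M => x /hM ->; rewrite oppr0. Qed.

Lemma bounded_suppD (f g : rV -> R) : bounded_supp f -> bounded_supp g ->
  bounded_supp (fun x => f x + g x).
Proof.
move=> [M hM] [N hN]; exists (Num.max M N) => x; rewrite gt_max => /andP[/hM -> /hN ->].
by rewrite addr0.
Qed.

(** A zero integral would force [g = 0] almost everywhere, and the nonempty open set [U] to be
    null. *)
Lemma Rintegral_gt0 (U : set rV) (g : rV -> R) y : open U -> U y ->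
  (forall z, 0 <= g z) -> (forall z, U z -> 0 < g z) ->
  mu.-integrable setT (EFin \o g) -> 0 < \int[mu]_z g z.
Proof.
move=> oU Uy g0 gU ig; have g0' : 0 <= \int[mu]_z g z by exact: Rintegral_ge0.
rewrite lt_neqAle g0' andbT eq_sym; apply/negP => /eqP int0.
have mg := measurable_int _ ig.
have E : (\int[mu]_z `|(EFin \o g) z| = 0)%E.
  have <- : (\int[mu]_z (g z)%:E = 0)%E.
    by rewrite -[LHS]fineK; [exact: congr1 int0|exact: integrable_fin_num].
  by apply: eq_integral => z _ /=; rewrite ger0_norm.
have [N [mN N0 hN]] := (ae_eq_integral_abs mu measurableT mg).1 E.
have : (mu U <= mu N)%E.
  apply: le_measure; rewrite ?inE//; first exact: open_measurable_rV.
  by move=> z Uz; apply: hN => /= /(_ I) [gz]; have := gU z Uz; rewrite gz ltxx.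
by rewrite N0 leNgt (lebesgue_rV_open_gt0 oU Uy).
Qed.

Lemma integrable_Gamma_mul x (g : rV -> R) (C : R) : measurable_fun setT g ->
  (forall y, `|g y| <= C) -> bounded_supp g ->
  mu.-integrable setT (EFin \o (fun y => Gamma x y * g y)).
Proof.
move=> mg gC [M hM]; have [_ [_ _ _ hi _]] := hG.
have cK := @compact_rV_le R n.+1 M; have iK := hi x _ cK.
have mK : measurable [set y : rV | `|y| <= M].
  by apply: closed_measurable_rV; apply: compact_closed; [exact: norm_hausdorff|exact: cK].
rewrite (_ : _ \o _ = (fun y => (Gamma x y)%:E * (g y)%:E)%E \_ [set y : rV | `|y| <= M]).
  apply/(integrable_mkcond _ mK)/integrableMl => //; first exact: measurable_funTS.
  by exists C; split; [exact: num_real|move=> N CN z _ /=; exact: le_trans (gC z) (ltW CN)].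
apply/funext => y; rewrite patchE; case: ifPn => [_|]; first by rewrite /= EFinM.
by rewrite notin_setE /= => /negP; rewrite -ltNge => /hM ->; rewrite mulr0.
Qed.

Lemma smooth_mul_vanish x (d : R) (f phi : rV -> R) : 0 < d ->
  smooth_on [set y | x != y] f -> smooth_on setT phi ->
  (forall y, ball x d y -> phi y = 0) -> smooth_on setT (fun y => f y * phi y).
Proof.
move=> d0 sf sphi p0; apply: smooth_on_local => y _; have [<-|xy] := eqVneq x y.
  exists (ball x d); split; [exact: ball_open|exact: ballxx|].
  apply: (@smooth_on_ext _ _ _ (fun=> 0)); first exact: ball_open.
    by move=> z bz; rewrite p0// mulr0.
  by apply: smooth_on_cst; exact: ball_open.
have oD := @open_rV_neq R n x : open [set y | x != y].
exists [set y | x != y]; split; [exact: oD|exact: xy|].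
exact: (@smooth_onM _ _ _ f phi oD sf (smooth_on_subset (@subsetT _ _) sphi)).
Qed.

Lemma Lop_cst0 (D : set rV) (f : rV -> R) (c : R) x : open D -> (forall y, D y -> f y = c) ->
  D x -> Lop A f x = 0.
Proof.
move=> oD fc Dx; rewrite (@Lop_ext _ _ A D f (cst c) x oD)//.
rewrite /Lop big1// => i _; rewrite big1// => j _.
rewrite (partial_ext (D := setT) (g := cst 0)) ?/partial ?derive_cst//; first exact: openT.
by move=> y _; rewrite /partial derive_cst mulr0.
Qed.

(* If [L Gamma_x] did not vanish at [y], a bump at [y], built from a level
   function of [Gamma_y], would contradict the equation of the fundamental
   solution. *)
Lemma Lop_Gamma (x y : rV) : x != y -> Lop A (Gamma x) y = 0.
Proof.
move=> xy; apply/eqP/negP => /negP; set c := Lop A (Gamma x) y => c0.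
have oD := @open_rV_neq R n x : open [set y | x != y].
have sG := @smooth_Gamma _ _ _ _ hG x.
have sL := smooth_Lop hA oD sG.
have xy0 : 0 < `|x - y| / 2 by rewrite divr_gt0// normr_gt0 subr_eq0.
(* Multiplying by [c] settles the sign: [g y = c^2 > 0]. *)
pose g z := c * Lop A (Gamma x) z.
(* [U] also avoids a ball around the pole, so that the bump [phi], zero outside [U], vanishes near
   [x]. *)
have [U [oU Uy Ug Ux]] : exists U, [/\ open U, U y, forall z, U z -> 0 < g z
    & forall z, U z -> ~ ball x (`|x - y| / 2) z].
  have cg : {for y, continuous g}.
    by apply: continuousM; [exact: cst_continuous|exact: smooth_on_continuous sL xy].
  have gy0 : 0 < g y by rewrite /g -expr2 exprn_even_gt0.
  have : \forall z \near y, 0 < g z by exact: (cvgr_gt (g y) cg 0 gy0).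
  move=> /nbhs_ballP[e /= e0 he]; exists (ball y (Num.min e (`|x - y| / 2))); split.
  - exact: ball_open.
  - by apply: ballxx; rewrite lt_min e0.
  - by move=> z bz; apply: he; apply: le_ball bz; rewrite ge_min lexx.
  - move=> z bz bx; have bz' : ball y (`|x - y| / 2) z.
      by apply: le_ball bz; rewrite ge_min lexx orbT.
    have := ball_triangle bx (ball_sym bz').
    by rewrite -splitr -ball_normE /= ltxx.
have [T T0 hT] := Gamma_base hG oU Uy.
have [chi [chi' [dchi chik chi0 chi1 [_ chi01 _ _]]]] := @smooth_step R.
pose F t := chi (1 * t + - T).
have Fk k : Ck1 k setT F.
  have := @Ck1_affine R k setT chi 1 (- T) openT (chik k).
  by rewrite (_ : [set t | _] = setT)//; exact/seteqP.
have F0 t : t <= T -> F t = 0 by move=> tT; rewrite /F chi0// mul1r subr_le0.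
have F1 t : T + 1 <= t -> F t = 1 by move=> tT; rewrite /F chi1// mul1r lerBrDl.
pose phi := level Gamma y F 1.
have tphi : test_fun setT phi by exact: (test_level hG y T0 Fk F0 F1).
have [sphi /compact_tsuppP bphi _] := tphi.
have phi_ge0 z : 0 <= phi z.
  by rewrite /phi /level; case: ifP => // _; have /andP[] := chi01 (1 * Gamma y z + - T).
have phiU z : ~ U z -> phi z = 0.
  move=> Uz; rewrite /phi /level; case: eqVneq => [yz|yz]; first by rewrite yz in Uy.
  rewrite F0//; apply/ltW; rewrite ltNge; apply/negP => Tz; exact/Uz/hT.
have phix z : ball x (`|x - y| / 2) z -> phi z = 0.
  by move=> bz; apply: phiU => Uz; exact: Ux Uz bz.
have oB : open (ball x (`|x - y| / 2)) by exact: ball_open.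
have Bx : ball x (`|x - y| / 2) x by exact: ballxx.
have pphix j z : ball x (`|x - y| / 2) z -> partial j phi z = 0.
  by move=> bz; rewrite (partial_ext (g := cst 0) j oB)// /partial derive_cst.
(* The Green flux of [Gamma x] and [phi]. It is smooth on the whole space: near the singularity of
   [Gamma x], [phi] vanishes. *)
pose V (i j : 'I_n.+1) (z : rV) : R := Gamma x z * (A z i j * partial j phi z)
                + - (phi z * (A z i j * partial j (Gamma x) z)).
have sV1 i j : smooth_on setT (fun z => Gamma x z * (A z i j * partial j phi z)).
  apply: (smooth_mul_vanish xy0 sG); first by apply: smooth_flux => //; exact: openT.
  by move=> z bz; rewrite pphix// mulr0.
have sV2 i j : smooth_on setT (fun z => phi z * (A z i j * partial j (Gamma x) z)).
  rewrite (_ : (fun z => _) = (fun z => (A z i j * partial j (Gamma x) z) * phi z)).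
    by apply: (smooth_mul_vanish xy0 (smooth_flux hA i j oD sG)).
  by apply/funext => z; rewrite mulrC.
have sV i j : smooth_on setT (V i j).
  exact: (smooth_onD openT (sV1 i j) (smooth_onN openT (sV2 i j))).
have bV i j : bounded_supp (V i j).
  apply: bounded_suppD; first by do 2!apply: bounded_suppM; exact: bounded_supp_partial.
  by apply: bounded_suppN; exact: bounded_suppMl.
have E z : \sum_i \sum_j partial i (V i j) z =
    Gamma x z * Lop A phi z - phi z * Lop A (Gamma x) z.
  have [xz|xz] := eqVneq x z; last first.
    have sphi' : smooth_on [set y | x != y] phi by exact: smooth_on_subset sphi.
    by rewrite (green_pointwise hA oD sG sphi' xz).
  have Bz : ball x (`|x - y| / 2) z by rewrite -xz.
  rewrite phix// mul0r subr0 (Lop_cst0 (c := 0) oB)// mulr0 big1// => i _.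
  rewrite big1// => j _; rewrite (partial_ext (g := cst 0) i oB)// ?/partial ?derive_cst//.
  by move=> w bw; rewrite /V pphix// phix// mulr0 mul0r mulr0 subr0.
have iG : mu.-integrable setT (EFin \o (fun z => Gamma x z * Lop A phi z)).
  have cL := continuous_Lop hA sphi; have bL := @bounded_supp_Lop _ _ A _ bphi.
  have [C _ hC] := continuous_bounded_supp_bounded cL bL.
  exact: integrable_Gamma_mul (continuous_measurable_rV cL) hC bL.
have sLp : smooth_on setT (fun z => Lop A (Gamma x) z * phi z).
  exact: smooth_mul_vanish xy0 sL sphi phix.
have cLp : continuous (fun z => Lop A (Gamma x) z * phi z).
  by move=> z; exact: smooth_on_continuous sLp _.
have iL : mu.-integrable setT (EFin \o (fun z => Lop A (Gamma x) z * phi z)).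
  by apply: integrable_continuous_bounded_supp => //; exact: bounded_suppM.
have int0 : \int[mu]_z (Lop A (Gamma x) z * phi z) = 0.
  have iL2 : mu.-integrable setT (EFin \o (fun z => phi z * Lop A (Gamma x) z)).
    by apply: eq_integrable iL => // z _; rewrite /= mulrC.
  have hB := RintegralB measurableT iG iL2.
  have hE : \int[mu]_z (\sum_i \sum_j partial i (V i j) z) =
      \int[mu]_z (Gamma x z * Lop A phi z - phi z * Lop A (Gamma x) z).
    by apply: eq_Rintegral => z _; exact: E.
  (* The equation of the fundamental solution gives [- phi x], and [phi x = 0]. *)
  have hF : \int[mu]_z (Gamma x z * Lop A phi z) = 0.
    by rewrite -oppr0 -(phix x Bx); have [_ [_ _ _ _ h]] := hG; exact: h.
  have hC : \int[mu]_z (Lop A (Gamma x) z * phi z) =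
      \int[mu]_z (phi z * Lop A (Gamma x) z).
    by apply: eq_Rintegral => z _; rewrite mulrC.
  have key (a b c' d e : R) : a = 0 -> a = b -> b = c' - d -> c' = 0 -> e = d -> e = 0.
    by move=> -> <- /esym/eqP + c'0 ->; rewrite c'0 sub0r oppr_eq0 => /eqP.
  exact: key (integral_divergence sV bV) hE hB hF hC.
(* The integrand is nonnegative and positive at [y], whereas the integral was just found to be 0. *)
have : 0 < \int[mu]_z (c * (Lop A (Gamma x) z * phi z)).
  have cgp : continuous (fun z => c * (Lop A (Gamma x) z * phi z)).
    by move=> z; apply: (@continuousM _ _ (cst c) _ z); [exact: cst_continuous|exact: cLp].
  apply: (@Rintegral_gt0 [set z | 0 < c * (Lop A (Gamma x) z * phi z)] _ y) => //.
  - apply: (@open_comp _ _ (fun z => c * (Lop A (Gamma x) z * phi z)) [set r | 0 < r]).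
      by move=> z _; exact: cgp.
    exact: open_gt.
  - by rewrite /= mulrA mulr_gt0 ?Ug// /phi /level eqxx.
  - move=> z; rewrite mulrA; have [Uz|Uz] := pselect (U z).
      by rewrite mulr_ge0// ltW// Ug.
    by rewrite phiU// mulr0.
  - by apply: integrable_continuous_bounded_supp => //; do 2!apply: bounded_suppM.
by rewrite (RintegralZl c measurableT iL) int0 mulr0 ltxx.
Qed.

(** For [psi = F''] this is [L (F (Gamma_x))]. The value 0 at the pole is the right one when [psi]
    vanishes near infinity. *)
Definition level_density x (psi : R -> R) (y : rV) : R :=
  if x == y then 0 else psi (Gamma x y) * energy A (Gamma x) y.

Lemma Lop_level x (F F1 F2 : R -> R) (T c : R) :
  (forall t : R, is_derive t 1 F (F1 t)) -> (forall t : R, is_derive t 1 F1 (F2 t)) ->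
  (forall t, T <= t -> F t = c) ->
  Lop A (level Gamma x F c) = level_density x F2.
Proof.
move=> dF dF1 FT; apply/funext => y; rewrite /level_density; case: eqVneq => [<-|xy].
  have [d d0 hd] := Gamma_pole hG x T.
  apply: (@Lop_cst0 (ball x d) _ c); [exact: ball_open| |exact: ballxx].
  by move=> z xz; rewrite /level; case: eqVneq => // xz'; rewrite FT// ltW// hd.
have oD := @open_rV_neq R n x : open [set y | x != y].
rewrite (@Lop_ext _ _ A _ _ (fun z => F (Gamma x z)) y oD)//; last first.
  by move=> z xz; rewrite /level (negPf xz).
rewrite (Lop_comp hA oD (@smooth_Gamma _ _ _ _ hG x) dF dF1 xy).
by rewrite Lop_Gamma// mulr0 add0r.
Qed.

End pole_equation.

(** * Testing weak solutions against functions of [Gamma x] *)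

Section level_identities.
Context (R : realType) (n : nat).
Local Notation rV := ('rV[R]_n.+1).
Context (A : rV -> 'M[R]_n.+1) (hA : admissible_matrix A).
Context (Gamma : rV -> rV -> R) (hG : admissible_fundamental_solution A Gamma).
Local Notation Ck1 := (@Ck R R unit (fun=> 1)).
Notation mu := lebesgue_rV.
Local Notation off x := [set y : rV | x != y].

Lemma offE (x : rV) : off x = setT `\` [set x].
Proof. by apply/seteqP; split=> y /=; [move=> /eqP xy; split => // /esym|move=> [_ yx]; apply/eqP => xy; exact: yx]. Qed.

Lemma Rintegral_off (x : rV) (f : rV -> R) : mu.-integrable setT (EFin \o f) ->
  \int[mu]_y f y = \int[mu]_(y in off x) f y.
Proof.
move=> fi; rewrite /Rintegral offE; congr fine; apply: (negligible_integral _ measurableT fi).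
  exact: measurable_rV_set1.
exact: lebesgue_rV_set1.
Qed.

Lemma smooth_energy x : smooth_on (off x) (energy A (Gamma x)).
Proof.
have oD := @open_rV_neq R n x : open (off x).
have sG := @smooth_Gamma _ _ _ _ hG x.
have h i j : smooth_on (off x) (fun y => A y i j * (partial i (Gamma x) y * partial j (Gamma x) y)).
  exact: (@smooth_onM _ _ _ (fun y => A y i j) _ oD (@smooth_A _ _ _ hA (off x) i j)
    (smooth_onM oD (smooth_on_partial i sG) (smooth_on_partial j sG))).
exact: (smooth_on_sum oD (fun i => smooth_on_sum oD (h i))).
Qed.

Lemma level_continuous x (psi : R -> R) y : x != y ->
  (forall t, 0 < t -> {for t, continuous psi}) ->
  {for y, continuous (fun y => psi (Gamma x y))}.
Proof.
move=> xy cpsi; apply: (@continuous_comp _ _ _ (Gamma x) psi).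
  exact: (Gamma_continuous hG).
by apply: cpsi; exact: (Gamma_gt0 hG).
Qed.

Lemma energy_continuous (x y : rV) : x != y -> {for y, continuous (energy A (Gamma x))}.
Proof. by move=> xy; apply: smooth_on_continuous (@smooth_energy x) xy. Qed.

Lemma level_density_continuous x (psi : R -> R) (T : R) :
  (forall t, 0 < t -> {for t, continuous psi}) -> (forall t, T <= t -> psi t = 0) ->
  continuous (level_density A Gamma x psi).
Proof.
move=> cpsi psiT y; have [<-|xy] := eqVneq x y.
  have [d d0 hd] := Gamma_pole hG x T.
  apply: (@near_eq_continuous R _ x (cst 0)); last exact: cst_continuous.
  apply/nbhs_ballP; exists d => //= z xz; rewrite /level_density.
  by case: eqVneq => // xz'; rewrite psiT ?mul0r// ltW// hd.
apply: (@near_eq_continuous R _ y (fun y => psi (Gamma x y) * energy A (Gamma x) y)).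
  have oD := @open_rV_neq R n x : open (off x).
  apply: filterS (open_nbhs_nbhs (conj oD xy)) => z xz.
  by rewrite /level_density (negPf xz).
apply: (@continuousM _ _ (fun y => psi (Gamma x y))); first exact: level_continuous.
exact: energy_continuous.
Qed.

Lemma level_density_bounded_supp x (psi : R -> R) (s : R) : 0 < s ->
  (forall t, 0 < t <= s -> psi t = 0) -> bounded_supp (level_density A Gamma x psi).
Proof.
move=> s0 psi0; have [M hM] := Gamma_decay1 hG x s0; exists M => y /hM[xy ys].
by rewrite /level_density (negPf xy) psi0 ?mul0r// (Gamma_gt0 hG)//= ltW.
Qed.

Lemma integrable_level_density (g : rV -> R) x (psi : R -> R) (s T : R) : continuous g -> 0 < s ->
  (forall t, 0 < t -> {for t, continuous psi}) ->
  (forall t, 0 < t <= s -> psi t = 0) -> (forall t, T <= t -> psi t = 0) ->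
  mu.-integrable setT (EFin \o (fun y => g y * level_density A Gamma x psi y)).
Proof.
move=> cg s0 cpsi psi0 psiT; apply: integrable_continuous_bounded_supp.
  move=> y; apply: (@continuousM _ _ g); first exact: cg.
  exact: (@level_density_continuous x psi T cpsi psiT).
exact: bounded_suppM (level_density_bounded_supp x s0 psi0).
Qed.

Definition weak_solution (w f : rV -> R) := forall phi, test_fun setT phi ->
  \int[mu]_y (w y * Lop A phi y) = - \int[mu]_y (f y * phi y).

(** Integrating [L phi] gives 0. This solution serves as a tool: the identities for weak solutions,
    applied to it, compute masses. *)
Lemma weak_solution_cst1 : weak_solution (cst 1) (cst 0).
Proof.
move=> phi [sphi /compact_tsuppP bphi _].
transitivity (0 : R).
  by under eq_Rintegral do rewrite mul1r; exact: integral_Lop.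
rewrite (_ : (fun y => _) = cst 0); last by apply/funext => y; rewrite mul0r.
by rewrite /Rintegral integral0 /= oppr0.
Qed.

Lemma weak_solution_level w f x (H theta theta1 : R -> R) (s T : R) :
  weak_solution w f -> 0 < s ->
  (forall t : R, is_derive t 1 H (theta t)) -> (forall t : R, is_derive t 1 theta (theta1 t)) ->
  (forall k, Ck1 k setT H) -> (forall t, t <= s -> H t = 0) ->
  (forall t, T <= t -> H t = H T) ->
  \int[mu]_y (w y * level_density A Gamma x theta1 y) =
  - \int[mu]_y (f y * level Gamma x H (H T) y).
Proof.
move=> wf s0 dH dtheta Hk H0 HT; have tphi := test_level hG x s0 Hk H0 HT.
by rewrite -(wf _ tphi) (Lop_level hA hG x dH dtheta HT).
Qed.

(* The image of the energy measure of [Gamma x] under [Gamma x] is the Lebesgue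
   measure on the half-line. *)
Lemma level_mass x (F F1 : R -> R) (s T : R) : 0 < s ->
  (forall k, Ck1 k setT F) -> (forall t : R, is_derive t 1 F (F1 t)) ->
  (forall t, t <= s -> F t = 0) -> (forall t, T <= t -> F t = 1) ->
  (forall t, t <= s \/ T <= t -> F1 t = 0) ->
  \int[mu]_y (level_density A Gamma x F1 y) = 1.
Proof.
move=> s0 Fk dF F0 FT F10.
have F1k k : Ck1 k setT F1 by apply: Ck1_derive (Fk k.+1) => //; exact: openT.
pose F2 : R -> R := 'D_1 F1.
have dF1 (t : R) : is_derive t 1 F1 (F2 t).
  by apply: derivableP; have [_ /(_ tt)[h _]] := F1k 1%N; exact: h.
pose theta t := t * F1 t; pose theta1 t := F1 t + t * F2 t.
have dtheta (t : R) : is_derive t 1 theta (theta1 t).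
  have := is_deriveM (is_derive_id t 1) (dF1 t).
  by rewrite /theta1 addrC [_ *: 1]mulr1.
have thetak k : Ck1 k setT theta.
  have idk m : Ck1 m setT (fun t : R => t).
    case: m => [|m]; first by split=> // t _; exact: cvg_id.
    by apply: (Ck1S openT (fun t _ => is_derive_id t (1 : R))); exact: Ck_cst openT.
  exact: (CkM openT (idk k) (F1k k)).
have theta0 t : t <= s -> theta t = 0 by move=> ts; rewrite /theta F10 ?mulr0//; left.
have thetaT t : T <= t -> theta t = 0 by move=> ts; rewrite /theta F10 ?mulr0//; right.
have [H [dH Hk H0 HT]] := antiderivative_smooth thetak theta0 thetaT.
have tF := test_level hG x s0 Fk F0 FT; have tH := test_level hG x s0 Hk H0 HT.
have LF := Lop_level hA hG x dF dF1 FT; have LH := Lop_level hA hG x dH dtheta HT.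
have [sH /compact_tsuppP bH _] := tH; have [sF /compact_tsuppP bF _] := tF.
have int0 := integral_Lop hA sH bH.
have int1 : \int[mu]_y (Gamma x y * Lop A (level Gamma x F 1) y) = - 1.
  have [_ [_ _ _ _ /(_ _ tF x) ->]] := hG.
  by rewrite /level eqxx.
have iH : mu.-integrable setT (EFin \o Lop A (level Gamma x H (H T))).
  apply: integrable_continuous_bounded_supp; first exact: continuous_Lop.
  exact: bounded_supp_Lop.
have iF : mu.-integrable setT (EFin \o (fun y => Gamma x y * Lop A (level Gamma x F 1) y)).
  have cL := continuous_Lop hA sF; have bL := @bounded_supp_Lop _ _ A _ bF.
  have [C _ hC] := continuous_bounded_supp_bounded cL bL.
  exact: (integrable_Gamma_mul hG x (continuous_measurable_rV cL) hC bL).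
have E : \int[mu]_y (level_density A Gamma x F1 y) =
    \int[mu]_y (Lop A (level Gamma x H (H T)) y - Gamma x y * Lop A (level Gamma x F 1) y).
  apply: eq_Rintegral => y _; rewrite LF LH /level_density.
  case: eqVneq => _; first by rewrite mulr0 subr0.
  by rewrite /theta1 mulrDl -mulrA addrK.
have B := RintegralB measurableT iH iF.
by rewrite E B int0 int1 opprK add0r.
Qed.

End level_identities.

(** * Truncation of the weight and bounds on the error terms *)

Section profile.
Context (R : realType).
Local Notation Ck1 := (@Ck R R unit (fun=> 1)).

(* [P] is the profile whose derivative [p] is the weight of the average; the
   superlevel set is [Gamma > a]. *)
Record profile (P p : R -> R) (a Pinf C c0 : R) : Prop := Profile {
  profile_a_gt0 : 0 < a;
  profile_derive : forall t : R, 0 < t -> is_derive t 1 P (p t);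
  profile_smooth : forall k, Ck1 k [set t | 0 < t] P;
  profile_Pa : P a = 0;
  profile_p_bound : forall t, a <= t -> 0 <= p t <= C;
  profile_c0_gt0 : 0 < c0;
  profile_p_lower : forall t, a <= t <= a + 1 -> c0 <= p t;
  profile_P_le : forall t, a <= t -> P t <= Pinf;
  profile_P_cvg : forall e, 0 < e -> exists T, forall t, T <= t -> `|P t - Pinf| < e
}.

Record step (chi chi' : R -> R) (D : R) : Prop := Step {
  step_derive : forall t : R, is_derive t 1 chi (chi' t);
  step_smooth : forall k, Ck1 k setT chi;
  step_le0 : forall t, t <= 0 -> chi t = 0;
  step_ge1 : forall t, 1 <= t -> chi t = 1;
  step'_ge0 : forall t, 0 <= chi' t;
  step_01 : forall t, 0 <= chi t <= 1;
  step'_0 : forall t, t <= 0 \/ 1 <= t -> chi' t = 0;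
  step'_bound : forall t, chi' t <= D
}.

Lemma step_exists : exists chi chi' D, step chi chi' D.
Proof.
by have [chi [chi' [h1 h2 h3 h4 [h5 h6 h7 [D h8]]]]] := @smooth_step R; exists chi, chi', D.
Qed.

Context (P p : R -> R) (a Pinf C c0 : R) (hP : profile P p a Pinf C c0).
Context (chi chi' : R -> R) (D : R) (hchi : step chi chi' D).

(** [lower_cut K] climbs from 0 to 1 on [[a, a + 1/K]] and [upper_cut K] falls from 1 to 0 on
    [[K, K + 1]]. [theta] is [P] so truncated; in its derivative [term1] carries the weight [p],
    [term2] and [term3] the slopes of the two cutoffs. The factor [1 *] keeps both cutoffs in the
    affine form [c * t + d] of the lemmas on reparametrizations. *)
Definition lower_cut K t := chi (K * t + - (K * a)).
Definition upper_cut K t := 1 - chi (1 * t + - K).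
Definition theta K t := P t * (lower_cut K t * upper_cut K t).
Definition term1 K t := p t * (lower_cut K t * upper_cut K t).
Definition term2 K t := P t * (K * chi' (K * t + - (K * a))) * upper_cut K t.
Definition term3 K t := P t * lower_cut K t * chi' (1 * t + - K).
Definition theta' K t := term1 K t + term2 K t - term3 K t.

Let a0 : 0 < a := profile_a_gt0 hP.

Lemma P_ge0 t : a <= t -> 0 <= P t.
Proof.
move=> at_; have [x /andP[ax _]|c /andP[ac _] E] := @MVT_closed R P p a t at_.
  by apply: (profile_derive hP); exact: lt_le_trans ax.
rewrite (profile_Pa hP) subr0 in E; rewrite E mulr_ge0 ?subr_ge0//.
by have /andP[] := profile_p_bound hP ac.
Qed.

Lemma P_le_linear t : a <= t -> P t <= C * (t - a).
Proof.
move=> at_; have [x /andP[ax _]|c /andP[ac _] E] := @MVT_closed R P p a t at_.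
  by apply: (profile_derive hP); exact: lt_le_trans ax.
rewrite (profile_Pa hP) subr0 in E; rewrite E ler_wpM2r ?subr_ge0//.
by have /andP[] := profile_p_bound hP ac.
Qed.

Lemma lower_cut_0 K t : 0 < K -> t <= a -> lower_cut K t = 0.
Proof. by move=> K0 ta; rewrite /lower_cut (step_le0 hchi)// subr_le0 ler_wpM2l// ltW. Qed.

Lemma lower_cut_1 K t : 0 < K -> a + K^-1 <= t -> lower_cut K t = 1.
Proof.
move=> K0 ta; rewrite /lower_cut (step_ge1 hchi)// -mulrBr -ler_pdivrMl//.
by rewrite mulr1 lerBrDl.
Qed.

Lemma upper_cut_0 K t : K + 1 <= t -> upper_cut K t = 0.
Proof. by move=> Kt; rewrite /upper_cut (step_ge1 hchi) ?subrr// mul1r lerBrDl. Qed.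

Lemma upper_cut_1 K t : t <= K -> upper_cut K t = 1.
Proof. by move=> Kt; rewrite /upper_cut (step_le0 hchi) ?subr0// mul1r subr_le0. Qed.

Lemma cut_01 K t : (0 <= lower_cut K t <= 1) && (0 <= upper_cut K t <= 1).
Proof.
rewrite /lower_cut /upper_cut (step_01 hchi) /=.
by have /andP[h1 h2] := step_01 hchi (1 * t + - K); rewrite subr_ge0 h2 gerBl.
Qed.

Lemma chi'_lower_0 K t : 0 < K -> t <= a \/ a + K^-1 <= t -> chi' (K * t + - (K * a)) = 0.
Proof.
move=> K0 ta; rewrite (step'_0 hchi)//; case: ta => ta; [left|right].
  by rewrite subr_le0 ler_wpM2l// ltW.
by rewrite -mulrBr -ler_pdivrMl// mulr1 lerBrDl.
Qed.

Lemma chi'_upper_0 K t : t <= K \/ K + 1 <= t -> chi' (1 * t + - K) = 0.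
Proof.
move=> tK; rewrite (step'_0 hchi)//; rewrite mul1r; case: tK => tK; [left|right].
  by rewrite subr_le0.
by rewrite lerBrDl.
Qed.

Lemma is_derive_affine (F F' : R -> R) (c d : R) (t : R) :
  (forall s : R, is_derive s 1 F (F' s)) ->
  is_derive t 1 (fun t => F (c * t + d)) (c * F' (c * t + d)).
Proof.
move=> dF; have dl : is_derive t 1 (fun t => c * t + d) c.
  by apply: is_derive_eq; rewrite addr0 [c *: 1]mulr1.
by have := @is_derive1_comp R F _ t _ _ (dF _) dl; rewrite mulrC.
Qed.

Lemma theta_le K t : 0 < K -> t <= a -> theta K t = 0.
Proof. by move=> K0 ta; rewrite /theta lower_cut_0// mul0r mulr0. Qed.

Lemma theta_ge K t : K + 1 <= t -> theta K t = 0.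
Proof. by move=> Kt; rewrite /theta upper_cut_0// mulr0 mulr0. Qed.

Lemma theta'_le K t : 0 < K -> t <= a -> theta' K t = 0.
Proof.
move=> K0 ta; rewrite /theta' /term1 /term2 /term3 lower_cut_0// chi'_lower_0; [|by []|by left].
by rewrite !(mul0r, mulr0) addr0 subr0.
Qed.

Lemma is_derive_theta K (t : R) : 0 < K -> is_derive t 1 (theta K) (theta' K t).
Proof.
move=> K0; have [ta|at_] := ltP t a.
  rewrite theta'_le ?(ltW ta)//; apply: (@near_eq_is_derive R R R (cst 0)).
  by near=> u; rewrite theta_le// ltW//; near: u; exact: lt_nbhsl.
have dl := @is_derive_affine chi chi' K (- (K * a)) t (step_derive hchi).
have du := @is_derive_affine chi chi' 1 (- K) t (step_derive hchi).
have du' : is_derive t 1 (upper_cut K) (- chi' (1 * t + - K)).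
  have := is_deriveB (is_derive_cst (1 : R) t 1) du.
  by rewrite mul1r sub0r.
have dc := is_deriveM dl du'.
have dP := is_deriveM (profile_derive hP (lt_le_trans a0 at_)) dc.
apply: (is_derive_eq dP); rewrite /theta' /term1 /term2 /term3 /GRing.scale /=.
rewrite mulrfctE /lower_cut /upper_cut.
move: (P t) (p t) (chi _) (chi (1 * t + - K)) (chi' _) (chi' (1 * t + - K)) => x1 x2 x3 x4 x5 x6.
ring.
Unshelve. all: by end_near. Qed.

Lemma smooth_affineT (F : R -> R) c d : (forall k, Ck1 k setT F) ->
  forall k, Ck1 k setT (fun t => F (c * t + d)).
Proof.
move=> Fk k; have := @Ck1_affine R k setT F c d openT (Fk k).
by rewrite (_ : [set t | _] = setT)//; exact/seteqP.
Qed.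

Lemma smooth_upper_cut K k : Ck1 k setT (upper_cut K).
Proof.
apply: (CkD openT (Ck_cst _ _ 1 openT)); apply: (CkN openT).
exact: smooth_affineT (step_smooth hchi) k.
Qed.

(** [P] is smooth on positive numbers only; the lower cutoff vanishes up to [a > 0], which allows
    gluing with 0. *)
Lemma smooth_theta K k : 0 < K -> Ck1 k setT (theta K).
Proof.
move=> K0; apply: (Ck1_glue a0); first by move=> t; exact: theta_le.
have o0 : open [set t : R | 0 < t] by exact: open_gt.
apply: (CkM o0); first exact: (profile_smooth hP).
apply: (CkM o0).
  by apply: Ck_subset (smooth_affineT _ _ (step_smooth hchi) k).
by apply: Ck_subset (smooth_upper_cut K k).
Qed.

Lemma continuous_p t : 0 < t -> {for t, continuous p}.
Proof.
move=> t0; have o0 : open [set t : R | 0 < t] by exact: open_gt.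
have h : Ck1 0 [set t | 0 < t] p.
  exact: (Ck1_derive o0 (profile_derive hP) (profile_smooth hP 1)).
exact: h.1.
Qed.

Lemma continuous_P t : 0 < t -> {for t, continuous P}.
Proof. exact: (profile_smooth hP 0).1. Qed.

Lemma smooth_step' k : Ck1 k setT chi'.
Proof. exact: (Ck1_derive openT (fun t _ => step_derive hchi t) (step_smooth hchi k.+1)). Qed.

Lemma continuous_lower_cut K : continuous (lower_cut K).
Proof. by move=> t; exact: ((smooth_affineT K (- (K * a)) (step_smooth hchi) 0).1 t I). Qed.

Lemma continuous_upper_cut K : continuous (upper_cut K).
Proof. by move=> t; exact: ((smooth_upper_cut K 0).1 t I). Qed.

Lemma continuous_chi' (c d : R) : continuous (fun t : R => chi' (c * t + d)).
Proof. by move=> t; exact: ((smooth_affineT c d smooth_step' 0).1 t I). Qed.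

Lemma continuous_term1 K t : 0 < t -> {for t, continuous (term1 K)}.
Proof.
move=> t0; apply: (@continuousM _ _ p); first exact: continuous_p.
apply: (@continuousM _ _ (lower_cut K)); [exact: continuous_lower_cut|exact: continuous_upper_cut].
Qed.

Lemma continuous_term2 K t : 0 < t -> {for t, continuous (term2 K)}.
Proof.
move=> t0; apply: (@continuousM _ _ (fun t => P t * (K * chi' (K * t + - (K * a))))); last exact: continuous_upper_cut.
apply: (@continuousM _ _ P); first exact: continuous_P.
apply: (@continuousM _ _ (cst K)); [exact: cst_continuous|exact: continuous_chi'].
Qed.

Lemma continuous_term3 K t : 0 < t -> {for t, continuous (term3 K)}.
Proof.
move=> t0; apply: (@continuousM _ _ (fun t => P t * lower_cut K t)); last exact: continuous_chi'.
apply: (@continuousM _ _ P); [exact: continuous_P|exact: continuous_lower_cut].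
Qed.

Lemma term1_ge0 K t : a <= t -> 0 <= term1 K t <= p t.
Proof.
move=> at_; have /andP[p0 _] := profile_p_bound hP at_.
have /andP[/andP[l0 l1] /andP[u0 u1]] := cut_01 K t.
by rewrite /term1 !mulr_ge0//= ler_piMr// mulr_ile1.
Qed.

Lemma term2_ge0 K t : 0 < K -> a <= t -> 0 <= term2 K t.
Proof.
move=> K0 at_; have /andP[_ /andP[u0 u1]] := cut_01 K t.
by rewrite /term2 !mulr_ge0 ?P_ge0 ?(ltW K0)// (step'_ge0 hchi).
Qed.

(** On the ramp [[a, a + 1/K]], [P <= C / K] absorbs the slope [K * D], so [term2 <= C * D]. As
    [K >= 1], the ramp lies in [[a, a + 1]] where [p >= c0]; hence a bound by a multiple of [p] that
    does not depend on [K], as domination requires. *)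
Lemma term2_le K t : 1 <= K -> a <= t -> term2 K t <= C * D / c0 * p t.
Proof.
move=> K1 at_; have K0 : 0 < K by exact: lt_le_trans K1.
have /andP[_ /andP[u0 u1]] := cut_01 K t.
have /andP[p0 pC] := profile_p_bound hP at_; have C0 : 0 <= C by exact: le_trans pC.
have D0 : 0 <= D by exact: le_trans (step'_ge0 hchi 0) (step'_bound hchi 0).
have c00 := profile_c0_gt0 hP.
have [ta|ta] := leP (a + K^-1) t.
  rewrite /term2 chi'_lower_0//; last by right.
  by rewrite !(mulr0, mul0r) mulr_ge0// divr_ge0// ?mulr_ge0// ltW.
have h1 : P t <= C * K^-1.
  apply: le_trans (P_le_linear at_) _; rewrite ler_wpM2l// lerBlDl ltW//.
have h2 : term2 K t <= C * D.
  rewrite /term2; apply: (@le_trans _ _ (C * K^-1 * (K * D) * 1)).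
    rewrite ler_pM ?mulr_ge0 ?P_ge0 ?(ltW K0) ?(step'_ge0 hchi)//.
    rewrite ler_pM ?mulr_ge0 ?P_ge0 ?(ltW K0) ?(step'_ge0 hchi)//.
    by rewrite ler_wpM2l ?(ltW K0) ?(step'_bound hchi).
  by rewrite mulr1 mulrA -(mulrA C) mulVf ?mulr1// gt_eqF.
apply: le_trans h2 _; rewrite -mulrA ler_peMr ?mulr_ge0// mulrC ler_pdivlMr// mul1r.
apply: (profile_p_lower hP); rewrite at_ /= (le_trans (ltW ta))// lerD2l.
by rewrite invf_le1.
Qed.

Lemma term3_bound K t : a <= t -> 0 <= term3 K t <= Pinf * chi' (1 * t + - K).
Proof.
move=> at_; have /andP[/andP[l0 l1] _] := cut_01 K t.
rewrite /term3 !mulr_ge0 ?P_ge0 ?(step'_ge0 hchi)//= ler_wpM2r ?(step'_ge0 hchi)//.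
apply: le_trans (profile_P_le hP at_); exact: ler_piMr (P_ge0 at_) l1.
Qed.

Lemma terms_le K t : 0 < K -> t <= a -> [/\ term1 K t = 0, term2 K t = 0 & term3 K t = 0].
Proof.
move=> K0 ta; rewrite /term1 /term2 /term3 lower_cut_0// chi'_lower_0; [|by []|by left].
by rewrite !(mul0r, mulr0).
Qed.

Lemma terms_ge K t : K + 1 <= t -> [/\ term1 K t = 0, term2 K t = 0 & term3 K t = 0].
Proof.
move=> Kt; rewrite /term1 /term2 /term3 upper_cut_0// chi'_upper_0; last by right.
by rewrite !(mul0r, mulr0).
Qed.

Lemma terms_eventually t : a < t -> exists N, forall k, (N <= k)%N ->
  term1 k.+1%:R t = p t /\ term2 k.+1%:R t = 0.
Proof.
(* Beyond this bound [t] lies past the lower ramp and before the upper one. *)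
move=> at_; have [N hN] : exists N : nat, Num.max ((t - a)^-1) t <= N%:R.
  exists (Num.truncn (Num.max ((t - a)^-1) t)).+1.
  by apply: ltW; exact: truncnS_gt.
exists N => k Nk; have Nk' : (N%:R : R) <= k.+1%:R by rewrite ler_nat leqW.
have := le_trans hN Nk'; rewrite ge_max => /andP[h1 h2].
have ta : a + k.+1%:R^-1 <= t.
  by rewrite -lerBrDl -[leRHS]invrK lef_pV2 ?posrE ?invr_gt0 ?subr_gt0.
rewrite /term1 /term2 lower_cut_1// upper_cut_1// chi'_lower_0; [|by []|by right].
by rewrite !(mulr1, mulr0).
Qed.

Context (G : R -> R) (dG : forall t : R, 0 < t -> is_derive t 1 G (P t)) (Ga : G a = 0).

Lemma primitive_bound K (H : R -> R) t : 0 < K ->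
  (forall t : R, is_derive t 1 H (theta K t)) ->
  H a = 0 -> a <= t -> `|H t| <= Pinf * (t - a).
Proof.
move=> K0 dH Ha at_; have [c /andP[ac _] E] := @MVT_closed R H _ a t at_ (fun t _ => dH t).
have /andP[/andP[l0 l1] /andP[u0 u1]] := cut_01 K c.
rewrite Ha subr0 in E; rewrite E normrM (ger0_norm (_ : 0 <= t - a)) ?subr_ge0//.
rewrite ler_wpM2r ?subr_ge0// ger0_norm ?mulr_ge0 ?P_ge0//.
by apply: le_trans (profile_P_le hP ac); rewrite ler_piMr ?P_ge0// mulr_ile1.
Qed.

Lemma G_bound t : a <= t -> 0 <= G t <= Pinf * (t - a).
Proof.
move=> at_; have [x /andP[ax _]|c /andP[ac _] E] := @MVT_closed R G P a t at_.
  by apply: dG; exact: lt_le_trans ax.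
by rewrite Ga subr0 in E; rewrite E mulr_ge0 ?P_ge0 ?subr_ge0//= ler_wpM2r ?subr_ge0// (profile_P_le hP).
Qed.

(** Between [b = a + 1/K] and [K] both cutoffs equal 1, so [G - H k] is constant there and equals
    its value at [b], where each function is at most [Pinf / K] in absolute value. *)
Lemma primitive_cvg (H : nat -> R -> R) t :
  (forall k (t : R), is_derive t 1 (H k) (theta k.+1%:R t)) ->
  (forall k, H k a = 0) -> a <= t -> H k t @[k --> \oo] --> G t.
Proof.
move=> dH Ha; rewrite le_eqVlt => /predU1P[<-|at_].
  by rewrite Ga; under eq_fun do rewrite Ha; exact: cvg_cst.
have Pinf0 : 0 <= Pinf by apply: le_trans (profile_P_le hP (lexx a)); rewrite (profile_Pa hP).
apply/cvgrPdist_le => e e0.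
(* The three bounds ensure [b <= t], [t <= K] and [2 * Pinf / K <= e]. *)
pose B := Num.max (Num.max ((t - a)^-1) t) (2 * Pinf / e).
exists (Num.truncn B).+1 => // k /= Nk.
have : B <= k.+1%:R.
  by apply/ltW/(lt_le_trans (truncnS_gt _)); rewrite ler_nat leqW.
rewrite !ge_max => /andP[/andP[h1 h2] h3].
have K0 : (0 : R) < k.+1%:R by [].
set b := a + k.+1%:R^-1.
have bt : b <= t by rewrite /b -lerBrDl -[leRHS]invrK lef_pV2 ?posrE ?invr_gt0 ?subr_gt0.
have ab : a <= b by rewrite lerDl invr_ge0.
have E : G t - H k t = G b - H k b.
  apply: (@derive0_const R (fun t => G t - H k t) b t) => [x /andP[bx xt]|]; last by rewrite bt lexx.
  have x0 : 0 < x by apply: lt_le_trans bx; exact: lt_le_trans ab.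
  have := is_deriveB (dG x0) (dH k x).
  by rewrite /theta lower_cut_1// upper_cut_1 ?(le_trans xt)// mulr1 mulr1 subrr.
rewrite E; apply: le_trans (ler_normB _ _) _.
have := primitive_bound K0 (dH k) (Ha k) ab; have /andP[Gb0 Gb] := G_bound ab.
rewrite (ger0_norm Gb0) => Hb; apply: le_trans (lerD Gb Hb) _.
have -> : b - a = k.+1%:R^-1 by rewrite /b addrAC subrr add0r.
by rewrite -mulr2n -[_ *+ 2]mulr_natl mulrA ler_pdivrMr// [leRHS]mulrC -ler_pdivrMr.
Qed.

End profile.

(** * The mean value identity for weak solutions *)

Section mean_value.
Context (R : realType) (n : nat).
Local Notation rV := ('rV[R]_n.+1).
Context (A : rV -> 'M[R]_n.+1) (hA : admissible_matrix A).
Context (Gamma : rV -> rV -> R) (hG : admissible_fundamental_solution A Gamma).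
Local Notation Ck1 := (@Ck R R unit (fun=> 1)).
Notation mu := lebesgue_rV.
Local Notation off x := [set y : rV | x != y].

Context (P p : R -> R) (a Pinf C c0 : R) (hP : profile P p a Pinf C c0).
Context (chi chi' : R -> R) (D : R) (hchi : step chi chi' D).
Context (G : R -> R) (dG : forall t : R, 0 < t -> is_derive t 1 G (P t)) (Ga : G a = 0).
Context (x : rV).

Let a0 : 0 < a := profile_a_gt0 hP.
Local Notation dens := (level_density A Gamma x).
Let B := [set y : rV | x != y /\ a < Gamma x y].
Let t1 (k : nat) := term1 p a chi k.+1%:R.
Let t2 (k : nat) := term2 P a chi chi' k.+1%:R.
Let t3 (k : nat) := term3 P a chi chi' k.+1%:R.

Let K0 (k : nat) : (0 : R) < k.+1%:R. Proof. by []. Qed.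

Lemma open_superlevel : open B.
Proof.
rewrite openE => y [xy ay]; have oD := @open_rV_neq R n x : open (off x).
have : \forall z \near y, a < Gamma x z.
  exact: (cvgr_gt (Gamma x y) (Gamma_continuous hG xy) a ay).
apply: filterS2 (open_nbhs_nbhs (conj oD xy)) => z /= xz az; by split.
Qed.

Let mB : measurable B. Proof. by apply: open_measurable_rV; exact: open_superlevel. Qed.

Lemma superlevel_bounded : exists M, forall y, B y -> `|y| <= M.
Proof.
have [M hM] := Gamma_decay1 hG x a0; exists M => y [xy ay].
by rewrite leNgt; apply/negP => /hM[_]; rewrite ltNge ltW.
Qed.

Lemma integrable_Gamma_superlevel : mu.-integrable B (EFin \o Gamma x).
Proof.
have [M hM] := superlevel_bounded.
have [_ [_ _ _ hi _]] := hG; have cK := @compact_rV_le R n.+1 M.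
have mK : measurable [set y : rV | `|y| <= M].
  by apply: closed_measurable_rV; apply: compact_closed; [exact: norm_hausdorff|exact: cK].
by apply: (integrableS mK mB _ (hi x _ cK)) => y; exact: hM.
Qed.

Lemma Pinf_ge0 : 0 <= Pinf.
Proof. by apply: le_trans (profile_P_le hP (lexx a)); rewrite (profile_Pa hP). Qed.

Lemma integrable_term (g : rV -> R) (psi : R -> R) k : continuous g ->
  (forall t, 0 < t -> {for t, continuous psi}) ->
  (forall t, t <= a -> psi t = 0) -> (forall t, k.+1%:R + 1 <= t -> psi t = 0) ->
  mu.-integrable setT (EFin \o (fun y => g y * dens psi y)).
Proof.
move=> cg cpsi psi0 psiT.
apply: (integrable_level_density hA hG x cg a0 cpsi _ psiT) => t /andP[_]; exact: psi0.
Qed.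

Let t1_le k t : t <= a -> t1 k t = 0.
Proof. by move=> ta; have [] := terms_le P p hchi (K0 k) ta. Qed.
Let t2_le k t : t <= a -> t2 k t = 0.
Proof. by move=> ta; have [] := terms_le P p hchi (K0 k) ta. Qed.
Let t3_le k t : t <= a -> t3 k t = 0.
Proof. by move=> ta; have [] := terms_le P p hchi (K0 k) ta. Qed.
Let t1_ge k t : k.+1%:R + 1 <= t -> t1 k t = 0.
Proof. by move=> ta; have [] := terms_ge P p a hchi ta. Qed.
Let t2_ge k t : k.+1%:R + 1 <= t -> t2 k t = 0.
Proof. by move=> ta; have [] := terms_ge P p a hchi ta. Qed.
Let t3_ge k t : k.+1%:R + 1 <= t -> t3 k t = 0.
Proof. by move=> ta; have [] := terms_ge P p a hchi ta. Qed.

Lemma integrable_t1 (g : rV -> R) k : continuous g ->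
  mu.-integrable setT (EFin \o (fun y => g y * dens (t1 k) y)).
Proof.
move=> cg; apply: (integrable_term cg _ (@t1_le k) (@t1_ge k)) => t t0.
exact: (continuous_term1 hP hchi).
Qed.

Lemma integrable_t2 (g : rV -> R) k : continuous g ->
  mu.-integrable setT (EFin \o (fun y => g y * dens (t2 k) y)).
Proof.
move=> cg; apply: (integrable_term cg _ (@t2_le k) (@t2_ge k)) => t t0.
exact: (continuous_term2 hP hchi).
Qed.

Lemma integrable_t3 (g : rV -> R) k : continuous g ->
  mu.-integrable setT (EFin \o (fun y => g y * dens (t3 k) y)).
Proof.
move=> cg; apply: (integrable_term cg _ (@t3_le k) (@t3_ge k)) => t t0.
exact: (continuous_term3 hP hchi).
Qed.

Lemma primitives : exists H : nat -> R -> R,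
  [/\ forall k (t : R), is_derive t 1 (H k) (theta P a chi k.+1%:R t),
      forall k j, Ck1 j setT (H k),
      forall k t, t <= a -> H k t = 0 &
      forall k t, k.+1%:R + 1 <= t -> H k t = H k (k.+1%:R + 1)].
Proof.
have /choice[H hH] : forall k : nat, exists H : R -> R,
  [/\ forall t : R, is_derive t 1 H (theta P a chi k.+1%:R t),
      forall j, Ck1 j setT H,
      forall t, t <= a -> H t = 0 &
      forall t, k.+1%:R + 1 <= t -> H t = H (k.+1%:R + 1)].
  move=> k; apply: antiderivative_smooth.
  - by move=> j; exact: (smooth_theta hP hchi).
  - by move=> t; exact: (theta_le P hchi).
  - by move=> t; exact: (theta_ge P a hchi).
by exists H; split=> k; have [] := hH k.
Qed.

(** The weak equation tested against [H k (Gamma_x)], whose second derivative in the level variable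
    is the sum [theta'] of the three terms. *)
Lemma truncated_identity (w f : rV -> R) (H : nat -> R -> R) k :
  weak_solution A w f -> continuous w ->
  (forall k (t : R), is_derive t 1 (H k) (theta P a chi k.+1%:R t)) ->
  (forall k j, Ck1 j setT (H k)) -> (forall k t, t <= a -> H k t = 0) ->
  (forall k t, k.+1%:R + 1 <= t -> H k t = H k (k.+1%:R + 1)) ->
  \int[mu]_y (w y * dens (t1 k) y) + \int[mu]_y (w y * dens (t2 k) y)
  - \int[mu]_y (w y * dens (t3 k) y) =
  - \int[mu]_y (f y * level Gamma x (H k) (H k (k.+1%:R + 1)) y).
Proof.
move=> wf cw dH Hk H0 HT.
have dtheta (t : R) := is_derive_theta hP hchi t (K0 k).
rewrite -(weak_solution_level hA hG x wf a0 (dH k) dtheta (Hk k) (H0 k) (HT k)).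
have i1 := integrable_t1 k cw; have i2 := integrable_t2 k cw; have i3 := integrable_t3 k cw.
have E : \int[mu]_y (w y * dens (theta' P p a chi chi' k.+1%:R) y) =
  \int[mu]_y ((w y * dens (t1 k) y + w y * dens (t2 k) y) - w y * dens (t3 k) y).
  apply: eq_Rintegral => y _; rewrite /level_density; case: ifP => _.
    by rewrite mulr0 addr0 subr0.
  by rewrite /theta' -!mulrDr -mulrBr -mulrDl -mulrBl.
have i12 : mu.-integrable setT (EFin \o (fun y => w y * dens (t1 k) y + w y * dens (t2 k) y)).
  exact: (integrableD measurableT i1 i2).
have E1 := RintegralB measurableT i12 i3; have E2 := RintegralD measurableT i1 i2.
by rewrite E E1 E2.
Qed.

Let b k := fun t : R => chi' (1 * t + - k.+1%:R).

Lemma b_mass k : \int[mu]_y (dens (b k) y) = 1.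
Proof.
apply: (level_mass hA hG x (K0 k) (F := fun t => chi (1 * t + - k.+1%:R)) (T := k.+1%:R + 1)).
- exact: (smooth_affineT _ _ (step_smooth hchi)).
- move=> t; have := is_derive_affine 1 (- k.+1%:R) t (step_derive hchi).
  by rewrite mul1r.
- by move=> t tk; rewrite (step_le0 hchi)// mul1r subr_le0.
- by move=> t tk; rewrite (step_ge1 hchi)// mul1r lerBrDl.
- move=> t tk; exact: (chi'_upper_0 hchi).
Qed.

Lemma integrable_b k : mu.-integrable setT (EFin \o dens (b k)).
Proof.
have := @integrable_level_density _ _ _ hA _ hG (cst 1) x (b k) k.+1%:R (k.+1%:R + 1).
rewrite (_ : (fun y => cst 1 y * dens (b k) y) = dens (b k)); last by apply/funext => y; rewrite mul1r.
apply => //; first by move=> y; exact: cst_continuous.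
- move=> t _; exact: (continuous_chi' hchi).
- by move=> t /andP[_ tk]; apply: (chi'_upper_0 hchi); left.
- by move=> t tk; apply: (chi'_upper_0 hchi); right.
Qed.

Lemma dens_ge0 (psi : R -> R) y : (forall t, a < t -> 0 <= psi t) ->
  (forall t, t <= a -> psi t = 0) -> 0 <= dens psi y.
Proof.
move=> psi0 psi1; rewrite /level_density; case: ifP => // _.
have [h|h] := leP (Gamma x y) a; first by rewrite psi1// mul0r.
by rewrite mulr_ge0 ?psi0// (energy_ge0 hA).
Qed.

(** For [w = 1], [f = 0] the truncated identity says that the masses of [t1] and [t2] add up to that
    of [t3], and [t3] is at most [Pinf] times the density [b k] of mass 1. Since [t2] contributes a
    nonnegative mass, the bound is uniform in [k]. *)
Lemma t1_mass k : \int[mu]_y (dens (t1 k) y) <= Pinf.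
Proof.
have [H [dH Hk H0 HT]] := primitives.
have c1 : continuous (cst 1 : rV -> R) by move=> y; exact: cst_continuous.
have := truncated_identity k (weak_solution_cst1 hA) c1 dH Hk H0 HT.
have E psi : \int[mu]_y (cst 1 y * dens psi y) = \int[mu]_y (dens psi y).
  by apply: eq_Rintegral => y _; rewrite mul1r.
rewrite !E [X in _ = - X](_ : _ = 0); last first.
  rewrite (_ : (fun y => _) = cst 0); last by apply/funext => y; rewrite mul0r.
  by rewrite /Rintegral integral0.
move=> /eqP; rewrite oppr0 subr_eq add0r => /eqP h.
have h2 : 0 <= \int[mu]_y dens (t2 k) y.
  apply: Rintegral_ge0 => y _; apply: dens_ge0; last exact: t2_le.
  by move=> t /ltW at_; exact: (term2_ge0 hP hchi).
have h3 : \int[mu]_y dens (t3 k) y <= Pinf.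
  rewrite -[leRHS]mulr1 -(b_mass k) -(RintegralZl Pinf measurableT (integrable_b k)).
  apply: le_Rintegral => //.
  - have := integrable_t3 k c1.
    by rewrite (_ : (fun y => cst 1 y * dens (t3 k) y) = dens (t3 k))//; apply/funext => y; rewrite mul1r.
  - by have := integrableZl measurableT Pinf (integrable_b k).
  move=> y _; rewrite /level_density; case: ifP => xy; first by rewrite mulr0.
  rewrite mulrA ler_wpM2r ?(energy_ge0 hA)//.
  have [h'|h'] := leP (Gamma x y) a.
    by rewrite t3_le// mulr_ge0 ?Pinf_ge0 ?(step'_ge0 hchi).
  by have /andP[] := term3_bound hP hchi k.+1%:R (ltW h').
by apply: le_trans h3; rewrite -h lerDl.
Qed.

Lemma dens_restrict (psi : R -> R) (w : rV -> R) : (forall t, t <= a -> psi t = 0) ->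
  \int[mu]_y (w y * dens psi y) = \int[mu]_(y in B) (w y * dens psi y).
Proof.
move=> psi0; rewrite [RHS]Rintegral_mkcond; apply: eq_Rintegral => y _.
rewrite patchE; case: ifPn => //; rewrite notin_setE /level_density => By.
case: eqVneq => xy; first by rewrite mulr0.
by rewrite psi0 ?mul0r ?mulr0// leNgt; apply/negP => h; apply: By.
Qed.

Definition weighted_density y := p (Gamma x y) * energy A (Gamma x) y.

Lemma dens_in (psi : R -> R) y : B y -> dens psi y = psi (Gamma x y) * energy A (Gamma x) y.
Proof. by move=> [xy _]; rewrite /level_density (negPf xy). Qed.

Lemma weighted_density_ge0 y : B y -> 0 <= weighted_density y.
Proof.
move=> [xy ay]; rewrite mulr_ge0 ?(energy_ge0 hA)//.
by have /andP[] := profile_p_bound hP (ltW ay).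
Qed.

Lemma measurable_weighted_density : measurable_fun B weighted_density.
Proof.
apply: open_continuous_measurable_rV; first exact: open_superlevel.
move=> y [xy _]; apply: (@continuousM _ _ (fun y => p (Gamma x y))).
  by apply: (level_continuous hG xy) => t; exact: (continuous_p hP).
exact: (energy_continuous hA hG).
Qed.

Lemma dens_eventually y : B y -> exists N, forall k, (N <= k)%N ->
  dens (t1 k) y = weighted_density y /\ dens (t2 k) y = 0.
Proof.
move=> By; have [N hN] := terms_eventually P p hchi By.2; exists N => k /hN[h1 h2].
by rewrite !dens_in// /t1 /t2 h1 h2 mul0r.
Qed.

(** At each point of [B] the truncated weights are eventually equal to the weight, and their masses
    are at most [Pinf]; Fatou's lemma carries the bound over. *)
Lemma integrable_weighted_density : mu.-integrable B (EFin \o weighted_density).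
Proof.
apply/integrableP; split; first by apply/measurable_EFinP; exact: measurable_weighted_density.
pose g k y := (dens (t1 k) y)%:E.
have it1 k : mu.-integrable setT (g k).
  have c1 : continuous (cst 1 : rV -> R) by move=> y; exact: cst_continuous.
  have := integrable_t1 k c1.
  by rewrite (_ : (fun y => cst 1 y * dens (t1 k) y) = dens (t1 k))//; apply/funext => y; rewrite mul1r.
have g0 k y : (0 <= g k y)%E.
  rewrite lee_fin; apply: dens_ge0; last exact: t1_le.
  by move=> t /ltW at_; have /andP[] := term1_ge0 hP hchi k.+1%:R at_.
have mg k : measurable_fun B (g k) by apply: measurable_funTS; exact: measurable_int (it1 k).
have gle k : (\int[mu]_(y in B) g k y <= Pinf%:E)%E.
  apply: (@le_trans _ _ (\int[mu]_y g k y)%E).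
    by apply: ge0_subset_integral => //; exact: measurable_int (it1 k).
  rewrite -[leLHS]fineK; last exact: integrable_fin_num.
  by rewrite lee_fin; exact: t1_mass.
have glim y : B y -> limn_einf (g ^~ y) = `|(EFin \o weighted_density) y|%E.
  move=> By; rewrite /= ger0_norm ?weighted_density_ge0//.
  have gl : g k y @[k --> \oo] --> (weighted_density y)%:E.
    apply: cvg_near_cst.
    by have [N hN] := dens_eventually By; exists N => // k /= /hN[h _]; rewrite /g h.
  by rewrite is_cvg_limn_einfE; [exact/cvg_lim|apply/cvg_ex; exists (weighted_density y)%:E].
apply: (@le_lt_trans _ _ Pinf%:E); last exact: ltry.
have F := fatou mu mB mg (fun k y _ => g0 k y).
rewrite (eq_integral (fun y => limn_einf (g ^~ y))); last first.
  by move=> y; rewrite inE => By; rewrite glim.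
apply: le_trans F _; rewrite limn_einf_lim; apply: lime_le; first exact: is_cvg_einfs.
apply: nearW => k; apply: le_trans (gle k).
by apply: ereal_inf_lbound; exists k => /=.
Qed.

Section sources.
Context (w f : rV -> R) (wf : weak_solution A w f) (cw : continuous w) (cf : continuous f).

Let bounded_on_B (g : rV -> R) : continuous g -> exists2 W, 0 <= W & forall y, B y -> `|g y| <= W.
Proof.
move=> cg; have [M hM] := superlevel_bounded.
have [W W0 hW] := continuous_bounded_ball M cg.
by exists W => // y /hM/hW.
Qed.

Let measurable_w_dens (g : rV -> R) (psi : R -> R) : continuous g ->
  (forall t, 0 < t -> {for t, continuous psi}) ->
  measurable_fun B (fun y => g y * dens psi y).
Proof.
move=> cg cpsi; apply: (@eq_measurable_fun _ _ _ _ _ (fun y => g y * (psi (Gamma x y) * energy A (Gamma x) y))).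
  by move=> y; rewrite inE => By; rewrite dens_in.
apply: open_continuous_measurable_rV; first exact: open_superlevel.
move=> y [xy _]; apply: (@continuousM _ _ g); first exact: cg.
apply: (@continuousM _ _ (fun y => psi (Gamma x y))); first exact: (level_continuous hG xy).
exact: (energy_continuous hA hG).
Qed.

Lemma cvg_term1 :
  mu.-integrable B (EFin \o (fun y => w y * weighted_density y)) /\
  \int[mu]_y (w y * dens (t1 k) y) @[k --> \oo] --> \int[mu]_(y in B) (w y * weighted_density y).
Proof.
have [W W0 hW] := bounded_on_B cw.
rewrite (_ : (fun k => _) = (fun k => \int[mu]_(y in B) (w y * dens (t1 k) y))); last first.
  by apply/funext => k; exact: (dens_restrict w (@t1_le k)).
apply: (@dominated_cvg_Rintegral _ _ _ _ _ _ _ (fun y => W * weighted_density y)) => //.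
- by move=> k; apply: measurable_w_dens => // t t0; exact: (continuous_term1 hP hchi).
- move=> y By; apply: cvg_near_cst.
  by have [N hN] := dens_eventually By; exists N => // k /= /hN[-> _].
- exact: (integrableZl mB W integrable_weighted_density).
- move=> k y By; rewrite normrM ler_pM// ?hW//.
  rewrite dens_in// normrM (ger0_norm (energy_ge0 hA _ _)) ler_wpM2r ?(energy_ge0 hA)//.
  by have /andP[h1 h2] := term1_ge0 hP hchi k.+1%:R (ltW By.2); rewrite ger0_norm.
Qed.

(** Each point of [B] leaves the lower ramp eventually, and [term2_le] dominates the error by a
    fixed multiple of the integrable weight. *)
Lemma cvg_term2 : \int[mu]_y (w y * dens (t2 k) y) @[k --> \oo] --> (0 : R).
Proof.
have [W W0 hW] := bounded_on_B cw.
rewrite (_ : (fun k => _) = (fun k => \int[mu]_(y in B) (w y * dens (t2 k) y))); last first.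
  by apply/funext => k; exact: (dens_restrict w (@t2_le k)).
have -> : (0 : R) = \int[mu]_(y in B) (cst 0 y) by rewrite /Rintegral integral0.
apply: (@dominated_cvg_Rintegral _ _ _ _ _ _ _ (fun y => W * (C * D / c0) * weighted_density y) _ _ _ _ _).2 => //.
- by move=> k; apply: measurable_w_dens => // t t0; exact: (continuous_term2 hP hchi).
- move=> y By; apply: cvg_near_cst.
  by have [N hN] := dens_eventually By; exists N => // k /= /hN[_ ->]; rewrite mulr0.
- exact: (integrableZl mB (W * (C * D / c0)) integrable_weighted_density).
- move=> k y By; rewrite normrM -mulrA ler_pM// ?hW//.
  rewrite dens_in// normrM (ger0_norm (energy_ge0 hA _ _)) mulrA ler_wpM2r ?(energy_ge0 hA)//.
  rewrite ger0_norm; first by apply: (term2_le hP hchi _ (ltW By.2)); rewrite ler1n.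
  exact: (term2_ge0 hP hchi (K0 k) (ltW By.2)).
Qed.

(* The measures [dens (b k)] are probability measures concentrating at the pole. *)
Lemma cvg_term3 : \int[mu]_y (w y * dens (t3 k) y) @[k --> \oo] --> w x * Pinf.
Proof.
(* The final estimate is [e1 * (Pinf + |w x|)]; the added 1 keeps the denominator positive. *)
apply/cvgrPdist_le => e e0; pose e1 := e / (Pinf + `|w x| + 1).
have d0 : 0 < Pinf + `|w x| + 1 by rewrite ltr_wpDl// addr_ge0// Pinf_ge0.
have e10 : 0 < e1 by rewrite divr_gt0.
have [T1 T10 hT1] : exists2 T, 0 < T & forall y, x != y -> T <= Gamma x y -> `|w x - w y| < e1.
  have oU : open [set y | `|w x - w y| < e1].
    apply: (@open_comp _ _ (fun y => `|w x - w y|) [set r | r < e1]); last exact: open_lt.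
    move=> y _; apply: (@continuous_comp _ _ _ (fun y => w x - w y) (fun r : R => `|r|)); last exact: norm_continuous.
    by apply: (@continuousB _ _ _ (cst (w x)) w); [exact: cst_continuous|exact: cw].
  by have := Gamma_base hG oU; apply; rewrite /= subrr normr0.
have [T2 hT2] := profile_P_cvg hP e10.
(* Above [T], [w] is close to [w x], [P] is close to [Pinf], and the lower cutoff is 1. *)
pose T := Num.max (Num.max T1 T2) (a + 1).
exists (Num.truncn T).+1 => // k /= Nk.
have : T <= k.+1%:R by apply/ltW/(lt_le_trans (truncnS_gt _)); rewrite ler_nat leqW.
rewrite !ge_max => /andP[/andP[kT1 kT2] ka].
have i3 := integrable_t3 k cw; have ib := integrable_b k.
have ib' : mu.-integrable setT (EFin \o (fun y => w x * Pinf * dens (b k) y)).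
  exact: (integrableZl measurableT (w x * Pinf) ib).
have -> : w x * Pinf = \int[mu]_y (w x * Pinf * dens (b k) y).
  by rewrite (RintegralZl (w x * Pinf) measurableT ib) b_mass mulr1.
rewrite -(RintegralB measurableT ib' i3).
have iB : mu.-integrable setT (EFin \o (fun y => w x * Pinf * dens (b k) y - w y * dens (t3 k) y)).
  exact: (integrableB measurableT ib' i3).
apply: (le_trans (le_normr_Rintegral measurableT iB)).
have ie : mu.-integrable setT (EFin \o (fun y => e * dens (b k) y)).
  exact: (integrableZl measurableT e ib).
suff h y : `|w x * Pinf * dens (b k) y - w y * dens (t3 k) y| <= e * dens (b k) y.
  rewrite -[leRHS]mulr1 -(b_mass k) -(RintegralZl e measurableT ib).
  apply: le_Rintegral => //.
  exact: (integrable_norm iB).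
rewrite /level_density; case: ifPn => xy; first by rewrite !mulr0 subrr normr0.
set t := Gamma x y; have E0 := energy_ge0 hA (Gamma x) y.
rewrite !mulrA -mulrBl normrM (ger0_norm E0) ler_wpM2r//.
have [tk|kt] := leP t k.+1%:R.
  rewrite /t3 /term3 /b (chi'_upper_0 hchi); last by left.
  by rewrite !mulr0 subrr normr0.
have c1 : lower_cut a chi k.+1%:R t = 1.
  rewrite (lower_cut_1 hchi)//; apply: le_trans (ltW kt); apply: le_trans ka.
  by rewrite lerD2l invf_le1// ler1n.
have at_ : a <= t by rewrite (le_trans _ (ltW kt))// (le_trans _ ka)// lerDl.
rewrite /t3 /term3 c1 mulr1 -/(b k t) -mulrBl normrM (ger0_norm (step'_ge0 hchi _)).
rewrite ler_wpM2r ?(step'_ge0 hchi)//.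
have h1 : `|w x - w y| <= e1 by apply/ltW/hT1 => //; exact: le_trans kT1 (ltW kt).
have h2 : `|P t - Pinf| <= e1 by apply/ltW/hT2; exact: le_trans kT2 (ltW kt).
have -> : w x * Pinf - w y * P t = (w x - w y) * P t - w x * (P t - Pinf) by ring.
apply: le_trans (ler_normB _ _) _; rewrite !normrM.
have P0 := P_ge0 hP at_; have P1 := profile_P_le hP at_.
apply: (@le_trans _ _ (e1 * Pinf + `|w x| * e1)).
  by apply: lerD; [apply: ler_pM => //; rewrite ger0_norm|apply: ler_wpM2l].
rewrite [_ * e1]mulrC -mulrDr /e1 mulrAC ler_pdivrMr// ler_wpM2l ?(ltW e0)//.
by rewrite lerDl.
Qed.

(** Dominated convergence: [|H k t| <= Pinf * (t - a)], and [Gamma x] is integrable on the bounded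
    set [B]. The pole, where [level] takes a prescribed value, is first discarded as a null set. *)
Lemma cvg_source (H : nat -> R -> R) :
  (forall k (t : R), is_derive t 1 (H k) (theta P a chi k.+1%:R t)) ->
  (forall k j, Ck1 j setT (H k)) -> (forall k t, t <= a -> H k t = 0) ->
  (forall k t, k.+1%:R + 1 <= t -> H k t = H k (k.+1%:R + 1)) ->
  \int[mu]_y (f y * level Gamma x (H k) (H k (k.+1%:R + 1)) y) @[k --> \oo] -->
  \int[mu]_(y in B) (f y * G (Gamma x y)).
Proof.
move=> dH Hk H0 HT; have Ha k : H k a = 0 by rewrite H0.
have E k : \int[mu]_y (f y * level Gamma x (H k) (H k (k.+1%:R + 1)) y) =
    \int[mu]_(y in B) (f y * H k (Gamma x y)).
  have [sL /compact_tsuppP bL _] := test_level hG x a0 (Hk k) (H0 k) (HT k).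
  have cL : continuous (level Gamma x (H k) (H k (k.+1%:R + 1))).
    by move=> y; exact: smooth_on_continuous sL _.
  rewrite (@Rintegral_off _ _ x).
    rewrite [LHS]Rintegral_mkcond [RHS]Rintegral_mkcond; apply: eq_Rintegral => y _.
    rewrite !patchE /level; have [<-|xy] := eqVneq x y.
      by rewrite !memNset//= ?eqxx//; case=> /negP; rewrite eqxx.
    have [ay|ya] := ltP a (Gamma x y); first by rewrite !mem_set.
    by rewrite mem_set// memNset ?H0 ?mulr0// => -[_]; rewrite ltNge ya.
  apply: integrable_continuous_bounded_supp; last exact: bounded_suppM.
  by move=> y; apply: (@continuousM _ _ f); [exact: cf|exact: cL].
rewrite (_ : (fun k => _) = (fun k => \int[mu]_(y in B) (f y * H k (Gamma x y)))); last exact/funext.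
have [F F0 hF] := bounded_on_B cf.
have iG : mu.-integrable B (EFin \o (fun y => F * Pinf * Gamma x y)).
  exact: (integrableZl mB (F * Pinf) integrable_Gamma_superlevel).
apply: (@dominated_cvg_Rintegral _ _ _ _ _ _ _ (fun y => F * Pinf * Gamma x y) _ _ _ _ _).2 => //.
- move=> k; apply: open_continuous_measurable_rV; first exact: open_superlevel.
  move=> y [xy _]; apply: (@continuousM _ _ f); first exact: cf.
  by apply: (level_continuous hG xy) => t _; exact: ((Hk k 0%N).1 t I).
- move=> y By; apply: (@cvgM _ _ _ _ (fun=> f y)); [exact: cvg_cst|];  exact: (primitive_cvg hP hchi dG Ga dH Ha (ltW By.2)).
- move=> k y By; rewrite normrM -mulrA ler_pM ?hF//.
  have := primitive_bound hP hchi (K0 k) (dH k) (Ha k) (ltW By.2).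
  move=> /le_trans; apply; rewrite ler_wpM2l ?Pinf_ge0// gerBl; exact: ltW.
Qed.

Lemma integrable_source : mu.-integrable B (EFin \o (fun y => f y * G (Gamma x y))).
Proof.
have [F F0 hF] := bounded_on_B cf.
have iF : mu.-integrable B (EFin \o (fun y => F * Pinf * Gamma x y)).
  exact: (integrableZl mB (F * Pinf) integrable_Gamma_superlevel).
apply: le_integrable iF => //.
  apply/measurable_EFinP; apply: open_continuous_measurable_rV; first exact: open_superlevel.
  move=> y [xy _]; apply: (@continuousM _ _ f); first exact: cf.
  apply: (level_continuous hG xy) => t t0.
  by apply/differentiable_continuous/derivable1_diffP; have [] := dG t0.
move=> y By /=; have [xy ay] := By; have g0 := Gamma_gt0 hG xy.
have /andP[G0 G1] := G_bound hP dG Ga (ltW ay).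
rewrite lee_fin !normrM (ger0_norm F0) (ger0_norm Pinf_ge0) (gtr0_norm g0) (ger0_norm G0).
rewrite -mulrA ler_pM ?hF//; apply: le_trans G1 _.
by rewrite ler_wpM2l ?Pinf_ge0// gerBl ltW.
Qed.

Lemma mean_identity : \int[mu]_(y in B) (w y * weighted_density y) - w x * Pinf =
  - \int[mu]_(y in B) (f y * G (Gamma x y)).
Proof.
have [H [dH Hk H0 HT]] := primitives.
have hs := cvg_source dH Hk H0 HT.
have hl := cvgB (cvgD cvg_term1.2 cvg_term2) cvg_term3.
rewrite addr0 in hl.
pose u k := \int[mu]_y (w y * dens (t1 k) y) + \int[mu]_y (w y * dens (t2 k) y)
  - \int[mu]_y (w y * dens (t3 k) y).
have hl' : u k @[k --> \oo] -->
  \int[mu]_(y in B) (w y * weighted_density y) - w x * Pinf by exact: hl.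
have hs' : u k @[k --> \oo] --> - \int[mu]_(y in B) (f y * G (Gamma x y)).
  rewrite (_ : u = fun k => - \int[mu]_y (f y * level Gamma x (H k) (H k (k.+1%:R + 1)) y)).
    exact: cvgN hs.
  by apply/funext => k; exact: truncated_identity.
by rewrite -(cvg_lim (@norm_hausdorff _ R) hl') (cvg_lim (@norm_hausdorff _ R) hs').
Qed.

End sources.

End mean_value.

(** * The power weight and the primitive behind [Q_r] *)

Section power_profile.
Context (R : realType) (alpha : R) (halpha : -1 < alpha) (r : R) (r0 : 0 < r).
Local Notation beta := (alpha + 1).

Let b0 : 0 < beta. Proof. by rewrite addrC -ltrBlDl sub0r. Qed.
Let a0 : 0 < r^-1. Proof. by rewrite invr_gt0. Qed.

(** The primitive of the kernel weight that vanishes at [1/r]. Its limit at infinity,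
    [r^beta / beta], is the inverse of the normalizing factor of the averages, so the pole term of
    the mean identity becomes [w x] itself. *)
Definition powP (t : R) : R := beta^-1 * ((r^-1) `^ (- beta) - t `^ (- beta)).
Definition powp (t : R) : R := t `^ (- (alpha + 2)).

Lemma powR_antitone (q s t : R) : 0 <= q -> 0 < s -> s <= t -> t `^ (- q) <= s `^ (- q).
Proof.
move=> q0 s0 st; have t0 := lt_le_trans s0 st.
rewrite !powRN lef_pV2 ?posrE ?powR_gt0//; apply: ge0_ler_powR => //; rewrite nnegrE ltW//.
Qed.

Lemma powR_inv_neg (q s : R) : 0 < s -> s^-1 `^ (- q) = s `^ q.
Proof.
move=> s0; rewrite -powR_inv1 ?ltW// -powRrM mulN1r opprK//.
Qed.

Lemma is_derive_powP (t : R) : 0 < t -> is_derive t 1 powP (powp t).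
Proof.
move=> t0; have d := @is_derive1_powR R (- beta) t t0.
have d' := is_deriveZ beta^-1 (is_deriveB (is_derive_cst ((r^-1) `^ (- beta)) t 1) d).
apply: (is_derive_eq d'); rewrite sub0r /powp /GRing.scale /= mulNr opprK mulrA mulVf ?gt_eqF// mul1r.
by congr (_ `^ _); ring.
Qed.

Lemma power_profile : profile powP powp r^-1 (beta^-1 * (r^-1) `^ (- beta))
  (powp r^-1) (powp (r^-1 + 1)).
Proof.
have q0 : 0 <= alpha + 2 by move: halpha; lra.
split => //.
- exact: is_derive_powP.
- move=> k; have o0 : open [set t : R | 0 < t] by exact: open_gt.
  apply: (CkM o0 (Ck_cst _ _ _ o0)); apply: (CkD o0 (Ck_cst _ _ _ o0)).
  exact: (CkN o0 (Ck1_powR _ _)).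
- by rewrite /powP subrr mulr0.
- by move=> t at_; rewrite powR_ge0/=; exact: powR_antitone.
- by rewrite powR_gt0// addr_gt0.
- by move=> t /andP[at_ ta]; apply: powR_antitone => //; exact: lt_le_trans at_.
- by move=> t at_; rewrite /powP ler_wpM2l ?invr_ge0 ?(ltW b0)// gerBl powR_ge0.
(* Chosen so that [T^(-beta)] is the inverse of [beta^-1 / e + 1], whence
   [beta^-1 * T^(-beta) < e]. *)
- move=> e e0; pose T := (beta^-1 / e + 1) `^ (beta^-1).
  have T1 : 0 < beta^-1 / e + 1 by rewrite ltr_wpDl// divr_ge0 ?invr_ge0// ltW.
  have T0 : 0 < T by rewrite powR_gt0.
  exists T => t Tt; have t0 := lt_le_trans T0 Tt.
  rewrite /powP -mulrBr addrAC subrr add0r mulrN normrN gtr0_norm; last first.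
    by rewrite mulr_gt0 ?invr_gt0// powR_gt0.
  apply: (@le_lt_trans _ _ (beta^-1 * T `^ (- beta))).
    by rewrite ler_wpM2l ?invr_ge0 ?(ltW b0)//; apply: powR_antitone => //; exact: ltW.
  rewrite /T -powRrM mulrN mulVf ?gt_eqF// powR_inv1 ?(ltW T1)//.
  rewrite ltr_pdivrMr// mulrDr mulr1 mulrCA divff ?gt_eqF// mulr1 ltrDl//.
Qed.

(** The exponent [-1], which occurs for [alpha = 0], gives a logarithm. Mere existence keeps the
    later computations uniform in [alpha]. *)
Lemma powR_primitive (q : R) : exists M : R -> R, forall t : R, 0 < t -> is_derive t 1 M (t `^ q).
Proof.
have [->|q1] := eqVneq q (-1).
  exists (@ln R) => t t0; rewrite powR_inv1 ?ltW//; exact: is_derive1_ln.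
have q10 : q + 1 != 0 by rewrite addr_eq0.
exists (fun t => (q + 1)^-1 * t `^ (q + 1)) => t t0.
have d := is_deriveZ (q + 1)^-1 (@is_derive1_powR R (q + 1) t t0).
by apply: (is_derive_eq d); rewrite /GRing.scale /= mulrA mulVf// mul1r addrK.
Qed.

(** [G] has two roles: as the primitive of [powP] it weights the source in the mean identity, and as
    an integral in [rho] it is what remains of [Q_r] once the integrals are exchanged. Writing the
    inverse of [rho] as a power gives an integrand that is measurable on the whole line. *)
Lemma power_primitive : exists G : R -> R,
  [/\ forall t : R, 0 < t -> is_derive t 1 G (powP t), G r^-1 = 0,
   forall s, r^-1 < s -> 0 < G s &
   forall s, (\int[@lebesgue_measure R]_(rho in `]0%R, r[)
     (rho `^ alpha * Num.max 0 (s - rho `^ (-1)))%:E)%E =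
     (if r^-1 < s then G s else 0)%:E].
Proof.
have [M dM] := powR_primitive (- beta).
(* A primitive in [rho] of [rho^alpha * (s - 1/rho)]. [G s] is its increment from [1/s], where the
   second factor changes sign, to [r]. *)
pose Phi s rho := s * (beta^-1 * rho `^ beta) + M (rho^-1).
pose G s := Phi s r - Phi s s^-1.
have dPhi s (rho : R) : 0 < rho -> is_derive rho 1 (Phi s) (rho `^ alpha * (s - rho^-1)).
  move=> h0; have h1 : rho != 0 by rewrite gt_eqF.
  have d1 := is_deriveZ s (is_deriveZ beta^-1 (@is_derive1_powR R beta rho h0)).
  have dV : is_derive rho 1 (fun s : R => s^-1) (- rho^-1 ^+ 2).
    have := @is_deriveV R id rho 1 1 h1 (is_derive_id _ _).
    by rewrite /= -exprVn [_ *: 1]mulr1.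
  have hi : 0 < rho^-1 by rewrite invr_gt0.
  have d2 := @is_derive1_comp R M (fun s => s^-1) rho _ _ (dM _ hi) dV.
  apply: (is_derive_eq (is_deriveD d1 d2)).
  rewrite /GRing.scale /= (powR_inv_neg beta h0) addrK.
  rewrite powRD ?h1 ?implybT// powRr1 ?ltW//.
  by field; rewrite h1 gt_eqF.
have dG (t : R) : 0 < t -> is_derive t 1 G (powP t).
  move=> t0; have tn : t != 0 by rewrite gt_eqF.
  (* Written out, the endpoint [1/s] turns into a power of [s] and [M s], which can be
     differentiated in [s]. *)
  apply: (@near_eq_is_derive R R R (fun s => (beta^-1 * r `^ beta) * s + M r^-1
      - (beta^-1 * (s * s `^ (- beta)) + M s))).
    near=> s; have s0 : 0 < s by near: s; exact: lt_nbhsr.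
    rewrite /G /Phi invrK (_ : s^-1 `^ beta = s `^ (- beta)); first by ring.
    by rewrite -[beta in LHS]opprK powR_inv_neg.
  have dp := @is_derive1_powR R (- beta) t t0.
  have d1 := is_deriveZ beta^-1 (is_deriveM (is_derive_id t (1 : R)) dp).
  have d2 := is_deriveD d1 (dM t t0).
  have d3 := is_deriveZ (beta^-1 * r `^ beta) (is_derive_id t (1 : R)).
  have d4 := is_deriveB (is_deriveD d3 (is_derive_cst (M r^-1) t 1)) d2.
  apply: (is_derive_eq d4); rewrite /powP (powR_inv_neg beta r0) /GRing.scale /=.
  have -> : t `^ (- beta) = t `^ (- beta - 1) * t.
    rewrite -[X in _ * X](powRr1 (ltW t0)) -powRD ?tn ?implybT//.
    by congr (_ `^ _); ring.
  by field; rewrite gt_eqF.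
have Ga : G r^-1 = 0 by rewrite /G invrK subrr.
have P0 t : r^-1 <= t -> 0 <= powP t.
  move=> rt; rewrite /powP mulr_ge0 ?invr_ge0 ?(ltW b0)// subr_ge0.
  by apply: powR_antitone => //; exact: ltW.
have P1 t : r^-1 < t -> 0 < powP t.
  move=> rt; rewrite /powP mulr_gt0 ?invr_gt0// subr_gt0.
  have t0 := lt_trans a0 rt.
  rewrite !powRN ltf_pV2 ?posrE ?powR_gt0//; apply: gt0_ltr_powR => //; rewrite nnegrE ltW//.
exists G; split => //.
  (* [powP] vanishes at [1/r], so the strict increase of [G] is read on [[m, s]] only. *)
  move=> s rs; pose m := (r^-1 + s) / 2.
  have rm : r^-1 < m by rewrite /m midf_lt.
  have ms : m < s by rewrite /m midf_lt.
  have [z /andP[mz _]|c /andP[mc _] E] := @MVT_closed R G powP m s (ltW ms).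
    by apply: dG; apply: lt_le_trans mz; exact: lt_trans rm.
  have [z /andP[mz _]|c' /andP[mc' _] E'] := @MVT_closed R G powP r^-1 m (ltW rm).
    by apply: dG; apply: lt_le_trans mz.
  have Gm : 0 <= G m.
    by rewrite -[G m]subr0 -[X in _ - X]Ga E' mulr_ge0 ?P0 ?subr_ge0 ?(ltW rm).
  have : 0 < G s - G m by rewrite E mulr_gt0 ?subr_gt0// P1// (lt_le_trans rm).
  by rewrite subr_gt0; exact: le_lt_trans.
move=> s; case: ifPn => [rs|]; last first.
  rewrite -leNgt => sr; apply: integral0_eq => rho; rewrite /= in_itv /= => /andP[h0 hr].
  rewrite max_l ?mulr0// subr_le0 powR_inv1 ?(ltW h0)// (le_trans sr)//.
  by rewrite lef_pV2 ?posrE// ltW.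
have s0 : 0 < s by exact: lt_trans rs.
have sr : s^-1 < r by rewrite -[r]invrK ltf_pV2 ?posrE.
have s10 : 0 < s^-1 by rewrite invr_gt0.
have mg : measurable_fun setT (fun rho : R => (rho `^ alpha * Num.max 0 (s - rho `^ (-1)))%:E).
  apply/measurable_EFinP; apply: measurable_funM; first exact: measurable_powR.
  apply: measurable_maxr => //; apply: measurable_funB => //; exact: measurable_powR.
transitivity (\int[@lebesgue_measure R]_(rho in `[(s^-1)%R, r[)
     (rho `^ alpha * Num.max 0 (s - rho `^ (-1)))%:E)%E.
  rewrite integral_mkcond [RHS]integral_mkcond; apply: eq_integral => rho _.
  rewrite !patchE !mem_setE !in_itv /=; have [h0|h0] := leP rho 0.
    by rewrite leNgt (le_lt_trans h0 s10).
  have [hr|hr] := ltP rho r; last by rewrite !andbF.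
  have [hs|hs] := leP s^-1 rho; first by [].
  rewrite /= max_l ?mulr0// subr_le0 powR_inv1 ?(ltW h0)//.
  by rewrite -[s]invrK lef_pV2 ?posrE// ltW.
rewrite integral_itv_bndo_bndc; last exact: measurable_funTS.
transitivity (\int[@lebesgue_measure R]_(rho in `[(s^-1)%R, r]) (rho `^ alpha * (s - rho^-1))%:E)%E.
  apply: eq_integral.
  move=> rho; rewrite inE /= in_itv /= => /andP[h1 h2].
  have h0 : 0 < rho by exact: lt_le_trans h1.
  rewrite powR_inv1 ?(ltW h0)// max_r// subr_ge0 -[leRHS]invrK lef_pV2 ?posrE//.
have pos (rho : R) : rho \in `[s^-1, r] -> 0 < rho.
  by rewrite in_itv /= => /andP[h1 _]; exact: lt_le_trans h1.
have cPhi (rho : R) : 0 < rho -> {for rho, continuous (Phi s)}.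
  by move=> h; apply/differentiable_continuous/derivable1_diffP; have [] := dPhi s rho h.
have cI : {within `[s^-1, r], continuous (fun rho => rho `^ alpha * (s - rho^-1))}.
  apply: continuous_in_subspaceT => rho; rewrite inE => /pos h.
  apply: (@continuousM _ _ (fun rho => rho `^ alpha)).
    apply/differentiable_continuous/derivable1_diffP.
    by have [] := @is_derive1_powR R alpha rho h.
  apply: cvgB; first exact: cvg_cst.
  by apply: inv_continuous; rewrite gt_eqF.
have LR : derivable_oo_LRcontinuous (Phi s) s^-1 r.
  split.
  - move=> rho; rewrite in_itv /= => /andP[h1 _].
    by have [] := dPhi s rho (lt_trans s10 h1).
  - by apply: cvg_at_right_filter; exact: cPhi.
  - by apply: cvg_at_left_filter; exact: cPhi.
have F' : {in `]s^-1, r[, derive1 (Phi s) =1 (fun rho => rho `^ alpha * (s - rho^-1))}.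
  move=> rho; rewrite in_itv /= => /andP[h1 _].
  by rewrite derive1E; have [_ ->] := dPhi s rho (lt_trans s10 h1).
by have -> := continuous_FTC2 sr cI LR F'.
Unshelve. all: by end_near. Qed.

End power_profile.

(** * The averages, the normalization and their quotient *)

Section averages.
Context (R : realType) (n : nat).
Local Notation rV := ('rV[R]_n.+1).
Context (A : rV -> 'M[R]_n.+1) (hA : admissible_matrix A).
Context (Gamma : rV -> rV -> R) (hG : admissible_fundamental_solution A Gamma).
Context (alpha : R) (halpha : -1 < alpha).
Notation mu := lebesgue_rV.
Local Notation beta := (alpha + 1).
Local Notation off x := [set y : rV | x != y].
Local Notation superlevel r x := [set y : rV | x != y /\ r^-1 < Gamma x y].

Let b0 : 0 < beta. Proof. by rewrite addrC -ltrBlDl sub0r. Qed.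

Lemma Lball_superlevel r x : Lball Gamma r x = [set x] `|` superlevel r x.
Proof.
apply/seteqP; split=> y; rewrite /Lball /extGamma /=.
  by case: eqVneq => [->|xy]; [left|rewrite lte_fin; right].
by case=> [->|[xy h]]; [rewrite eqxx ltry|rewrite (negPf xy) lte_fin].
Qed.

Lemma measurable_superlevel r x : measurable (superlevel r x).
Proof.
exact: (open_measurable_rV (@open_superlevel _ _ _ _ hG r^-1 x)).
Qed.

(** The ball contains its pole, where the integrands have an arbitrary value. Any function is
    measurable on a point, and a point is null. *)
Lemma Rintegral_insert (B : set rV) x (g : rV -> R) : measurable B -> ~ B x ->
  mu.-integrable B (EFin \o g) ->
  \int[mu]_(y in [set x] `|` B) g y = \int[mu]_(y in B) g y.
Proof.
move=> mB Bx ig; have m1 := measurable_rV_set1 x; have mu1 := lebesgue_rV_set1 x.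
have mgB := measurable_int _ ig.
have mgx : measurable_fun [set x] (EFin \o g).
  move=> _ Y mY; have [Yx|Yx] := pselect ((EFin \o g) @^-1` Y `<=` ~` [set x]).
    rewrite (_ : _ `&` _ = set0)//; apply/seteqP; split=> // z [] zx /Yx; exact.
  rewrite (_ : _ `&` _ = [set x])//; apply/seteqP; split=> [z []//|z /= ->]; split=> //.
  by apply: contrapT => h; apply: Yx => z' /= Yz' z'x; apply: h; rewrite -z'x.
have mU : measurable_fun ([set x] `|` B) (EFin \o g) by apply/measurable_funU.
have disj : [disjoint [set x] & B].
  by apply/disj_setPS => z [/= -> Bz]; exact: Bx.
have z1 h : measurable_fun [set x] h -> (\int[mu]_(y in [set x]) h y = 0)%E.
  by move=> mh; exact: (null_set_integral m1 mh mu1).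
have iU : mu.-integrable ([set x] `|` B) (EFin \o g).
  apply/integrableP; split => //.
  rewrite ge0_integral_setU//; last exact: measurableT_comp.
  rewrite z1; last exact: measurableT_comp.
  by rewrite add0e; move/integrableP: ig => [].
rewrite Rintegral_setU//.
by rewrite [X in X + _](_ : _ = 0) ?add0r// /Rintegral z1.
Qed.

Lemma kernelKE x y : kernelK A Gamma alpha x y = powp alpha (Gamma x y) * energy A (Gamma x) y.
Proof.
rewrite /kernelK /powp powRN mulrC; congr (_ * _).
rewrite mxE [RHS]exchange_big /=; apply: eq_bigr => j _; rewrite !mxE mulr_suml.
by apply: eq_bigr => i _; rewrite !mxE [RHS]mulrCA mulrA.
Qed.

Lemma meanM_superlevel r x (u : rV -> R) : 0 < r -> continuous u ->
  mu.-integrable (superlevel r x) (EFin \o (fun y => u y * weighted_density A Gamma (powp alpha) x y)) /\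
  meanM A Gamma alpha r u x = beta / (r `^ beta) *
    \int[mu]_(y in superlevel r x) (u y * weighted_density A Gamma (powp alpha) x y).
Proof.
move=> r0 cu; have [chi [chi' [D hchi]]] := step_exists R.
have [iu _] := cvg_term1 hA hG (power_profile halpha r0) hchi x cu.
split; first exact: iu.
rewrite /meanM; congr (_ * _); rewrite Lball_superlevel.
transitivity (\int[mu]_(y in [set x] `|` superlevel r x)
    (u y * weighted_density A Gamma (powp alpha) x y)).
  by apply: eq_Rintegral => y _; rewrite kernelKE.
by apply: Rintegral_insert => //; [exact: (measurable_superlevel r x)|case; rewrite eqxx].
Qed.

Lemma integrable_excess r x : 0 < r ->
  mu.-integrable (superlevel r x) (EFin \o (fun y => Gamma x y - r^-1)).
Proof.
move=> r0; have mB := measurable_superlevel r x.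
have iG := integrable_Gamma_superlevel hG (power_profile halpha r0) x.
apply: le_integrable iG => //.
  apply/measurable_EFinP; apply: measurable_funB => //.
  by apply/measurable_EFinP; exact: (measurable_int _ (integrable_Gamma_superlevel hG (power_profile halpha r0) x)).
move=> y [xy h] /=; rewrite lee_fin.
rewrite ger0_norm ?subr_ge0 ?(ltW h)// (gtr0_norm (Gamma_gt0 hG xy)).
by rewrite gerBl invr_ge0 ltW.
Qed.

(** The positive part moves the dependence on [rho] from the domain into the integrand, as needed to
    exchange the integrals of [Q_r]. *)
Lemma Rintegral_Lball_excess (rho : R) x : 0 < rho ->
  (\int[mu]_(y in Lball Gamma rho x) (Gamma x y - rho^-1))%:E =
  (\int[mu]_y (Num.max 0 ((if x == y then 0 else Gamma x y) - rho `^ (-1)))%:E)%E.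
Proof.
move=> h0; have mB := measurable_superlevel rho x; have iB := integrable_excess x h0.
rewrite Lball_superlevel Rintegral_insert//; last by case; rewrite eqxx.
rewrite /Rintegral fineK; last exact: integrable_fin_num.
rewrite integral_mkcond; apply: eq_integral => y _; rewrite patchE powR_inv1 ?(ltW h0)//.
have [<-|xy] := eqVneq x y.
  rewrite memNset; last by case; rewrite eqxx.
  by rewrite max_l// sub0r oppr_le0 invr_ge0 ltW.
have [h|h] := ltP rho^-1 (Gamma x y).
  by rewrite mem_set// max_r// subr_ge0 ltW.
by rewrite memNset ?max_l ?subr_le0// => -[_]; rewrite ltNge h.
Qed.

(** Tonelli: integrating in [rho] first leaves, for each [y], the one-dimensional integral given as
    hypothesis, taken at [s = Gamma x y]. *)
Lemma meanQ_superlevel r x (G : R -> R) : 0 < r ->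
  (forall s, (\int[@lebesgue_measure R]_(rho in `]0%R, r[)
     (rho `^ alpha * Num.max 0 (s - rho `^ (-1)))%:E)%E =
     (if r^-1 < s then G s else 0)%:E) ->
  meanQ Gamma alpha r x = beta / (r `^ beta) *
    \int[mu]_(y in superlevel r x) G (Gamma x y).
Proof.
move=> r0 hGint; rewrite /meanQ; congr (_ * _); rewrite /Rintegral; congr fine.
pose Gamma1 y := if x == y then 0 else Gamma x y.
have mGamma1 : measurable_fun setT Gamma1.
  have oD := @open_rV_neq R n x : open (off x).
  rewrite (_ : Gamma1 = (Gamma x) \_ (off x)).
    apply/(measurable_restrictT _ (open_measurable_rV oD)).
    by apply: open_continuous_measurable_rV => // y xy; exact: (Gamma_continuous hG).
  apply/funext => y; rewrite patchE /Gamma1; case: eqVneq => xy; last by rewrite mem_set.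
  by rewrite memNset//= xy eqxx.
pose I : set (measurableTypeR R) := `]0, r[%classic.
have mI : measurable I by exact: measurable_itv.
pose f (z : measurableTypeR R * rV) : \bar R :=
  (\1_I z.1 * (z.1 `^ alpha * Num.max 0 (Gamma1 z.2 - z.1 `^ (-1))))%:E.
have mf : measurable_fun setT f.
  apply/measurable_EFinP; apply: measurable_funM.
    by apply: measurableT_comp; [exact: measurable_indic|exact: measurable_fst].
  apply: measurable_funM.
    by apply: (measurableT_comp (measurable_powR alpha)); exact: measurable_fst.
  apply: measurable_maxr => //; apply: measurable_funB.
    by apply: (measurableT_comp mGamma1); exact: measurable_snd.
  by apply: (measurableT_comp (measurable_powR (-1))); exact: measurable_fst.
have f0 z : (0 <= f z)%E.
  by rewrite lee_fin !mulr_ge0 ?powR_ge0// le_max lexx.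
have E1 : (\int[@lebesgue_measure R]_(rho in `]0%R, r[)
    (rho `^ alpha * fine (\int[mu]_(y in Lball Gamma rho x) (Gamma x y - rho^-1)%:E))%:E =
    \int[@lebesgue_measure R]_rho \int[mu]_y f (rho, y))%E.
  rewrite integral_mkcond; apply: eq_integral => rho _; rewrite patchE.
  case: ifPn => [|hn]; last first.
    apply/esym/integral0_eq => y _; rewrite /f /= indicE (negPf hn) mul0r//.
  move=> hi; move: (hi); rewrite inE /= in_itv /= => /andP[h0 hr].
  rewrite EFinM Rintegral_Lball_excess// -ge0_integralZl//; last 3 first.
  - by apply/measurable_EFinP; apply: measurable_maxr => //; exact: measurable_funB.
  - by move=> y _; rewrite lee_fin le_max lexx.
  - by rewrite lee_fin powR_ge0.
  by apply: eq_integral => y _; rewrite /f /= indicE hi mul1r EFinM.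
rewrite [LHS]E1 (@fubini_tonelli _ _ _ _ R (@lebesgue_measure R) (@lebesgue_rV R n.+1) f mf f0).
rewrite [RHS]integral_mkcond; apply: eq_integral => y _.
transitivity (\int[@lebesgue_measure R]_(rho in `]0%R, r[)
     (rho `^ alpha * Num.max 0 (Gamma1 y - rho `^ (-1)))%:E)%E.
  rewrite [RHS]integral_mkcond; apply: eq_integral => rho _; rewrite patchE /f /= indicE.
  by case: ifPn => h; rewrite ?mul1r// mul0r.
rewrite hGint patchE /Gamma1; have [<-|xy] := eqVneq x y.
  rewrite memNset; last by case; rewrite eqxx.
  by rewrite ltNge invr_ge0 (ltW r0).
have [h|h] := ltP r^-1 (Gamma x y); first by rewrite mem_set.
by rewrite memNset// => -[_]; rewrite ltNge h.
Qed.

Lemma superlevel_nonempty r x : 0 < r -> exists y, superlevel r x y.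
Proof.
move=> r0; have [d d0 hd] := Gamma_pole hG x r^-1.
have d20 : 0 < d / 2 by rewrite divr_gt0.
(* The dimension being positive, moving every coordinate by [d / 2] gives a point other than the
   pole. *)
pose y := x + const_mx (d / 2); have xy : x != y.
  apply/eqP => /rowP /(_ ord0); rewrite !mxE => /eqP.
  by rewrite -subr_eq0 opprD addrA subrr sub0r oppr_eq0 gt_eqF.
exists y; split => //; apply: hd => //; apply/ball_rVP => // i.
by rewrite !mxE opprD addrA subrr sub0r normrN gtr0_norm// ltr_pdivrMr// ltr_pMr// ltr1n.
Qed.

(* The quotient defining [L_a w] is an average of [- f] over the [L]-ball, for the
   weight [G (Gamma x)]. *)
Lemma La_quotient_cvg x (w f : rV -> R) : weak_solution A w f -> continuous w -> continuous f ->
  La_quotient A Gamma alpha w x r @[r --> 0^'+] --> - f x.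
Proof.
move=> wf cw cf; apply/cvgrPdist_le => e e0.
have [T T0 hT] : exists2 T, 0 < T & forall y, x != y -> T <= Gamma x y -> `|f y - f x| < e.
  have oU : open [set y | `|f y - f x| < e].
    apply: (@open_comp _ _ (fun y => `|f y - f x|) [set s | s < e]); last exact: open_lt.
    move=> y _; apply: (@continuous_comp _ _ _ (fun y => f y - f x) (fun s : R => `|s|)); last exact: norm_continuous.
    by apply: (@continuousB _ _ _ f (cst (f x))); [exact: cf|exact: cst_continuous].
  by have := Gamma_base hG oU; apply; rewrite /= subrr normr0.
near=> r.
have r0 : 0 < r by [].
(* The whole punctured ball then lies where [f] is within [e] of [f x]. *)
have rT : T <= r^-1.
  rewrite -[T]invrK lef_pV2 ?posrE ?invr_gt0//; near: r.
  by apply: nbhs_right_le; rewrite invr_gt0.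
have [G [dG Ga Gpos Gint]] := power_primitive halpha r0.
have [chi [chi' [D hchi]]] := step_exists R.
have hP := power_profile halpha r0.
have [_ hM] := meanM_superlevel x r0 cw.
have hQ := meanQ_superlevel x r0 Gint.
have id1 := mean_identity hA hG hP hchi dG Ga x wf cw cf.
have iS := integrable_source hG hP dG Ga x cf.
have c1 : continuous (cst 1 : rV -> R) by move=> y; exact: cst_continuous.
have iG' := integrable_source hG hP dG Ga x c1.
set B := superlevel r x in hM hQ id1 iS iG' *.
have mB : measurable B := measurable_superlevel r x.
have iG : mu.-integrable B (EFin \o (fun y => G (Gamma x y))).
  by apply: eq_integrable iG' => // y _ /=; rewrite mul1r.
have IG0 : 0 < \int[mu]_(y in B) G (Gamma x y).
  rewrite Rintegral_mkcond; have [y0 By0] := superlevel_nonempty x r0.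
  apply: (@Rintegral_gt0 R n B _ y0) => //.
  - exact: (@open_superlevel _ _ _ _ hG r^-1 x).
  - move=> y; rewrite patchE; case: ifPn => //; rewrite inE => -[_ h].
    exact/ltW/Gpos.
  - by move=> y By; rewrite patchE mem_set//; exact: Gpos By.2.
  - have := (integrable_mkcond (EFin \o (fun y => G (Gamma x y))) mB).1 iG.
    by rewrite restrict_EFin.
have c0 : 0 < beta / (r `^ beta) by rewrite divr_gt0// powR_gt0.
(* The prefactor times the limit [r^beta / beta] of the profile is 1, so the mean identity scales to
   this difference. *)
have E : meanM A Gamma alpha r w x - w x =
    - (beta / (r `^ beta) * \int[mu]_(y in B) (f y * G (Gamma x y))).
  rewrite hM -mulrN -id1 mulrBr; congr (_ - _).
  rewrite (powR_inv_neg _ r0); field.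
  by rewrite gt_eqF//= gt_eqF// powR_gt0.
have iS' : mu.-integrable B (EFin \o (fun y => f x * G (Gamma x y))).
  exact: (integrableZl mB (f x) iG).
have iD : mu.-integrable B (EFin \o (fun y => f y * G (Gamma x y) - f x * G (Gamma x y))).
  exact: (integrableB mB iS iS').
have ie : mu.-integrable B (EFin \o (fun y => e * G (Gamma x y))).
  exact: (integrableZl mB e iG).
have key : `|\int[mu]_(y in B) (f y * G (Gamma x y)) - f x * \int[mu]_(y in B) G (Gamma x y)|
    <= e * \int[mu]_(y in B) G (Gamma x y).
  rewrite -(RintegralZl (f x) mB iG) -(RintegralZl e mB iG) -(RintegralB mB iS iS').
  apply: le_trans (le_normr_Rintegral mB iD) _.
  apply: le_Rintegral => //; first exact: (integrable_norm iD).
  move=> y [xy h]; rewrite -mulrBl normrM (gtr0_norm (Gpos _ h)) ler_wpM2r ?(ltW (Gpos _ h))//.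
  by apply/ltW/hT => //; exact: le_trans rT (ltW h).
rewrite /La_quotient E hQ mulNr -mulf_div divff ?gt_eqF// mul1r opprK addrC.
move: key IG0; set S := \int[mu]_(y in B) (f y * _); set I := \int[mu]_(y in B) _ => key I0.
have -> : S / I - f x = (S - f x * I) / I by field; rewrite gt_eqF.
by rewrite normrM normfV (gtr0_norm I0) ler_pdivrMr.
Unshelve. all: by end_near. Qed.

(** The mean identity for [w = 1], [f = 0]: the normalized weight is a probability density. *)
Lemma weighted_density_mass r x : 0 < r ->
  mu.-integrable (superlevel r x) (EFin \o weighted_density A Gamma (powp alpha) x) /\
  beta / (r `^ beta) * \int[mu]_(y in superlevel r x) weighted_density A Gamma (powp alpha) x y = 1.
Proof.
move=> r0; have [G [dG Ga _ _]] := power_primitive halpha r0.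
have [chi [chi' [D hchi]]] := step_exists R; have hP := power_profile halpha r0.
have c1 : continuous (cst 1 : rV -> R) by move=> y; exact: cst_continuous.
have c0 : continuous (cst 0 : rV -> R) by move=> y; exact: cst_continuous.
split; first exact: (integrable_weighted_density hA hG hP hchi x).
have := mean_identity hA hG hP hchi dG Ga x (weak_solution_cst1 hA) c1 c0.
rewrite [X in _ = - X](_ : _ = 0); last first.
  rewrite (_ : (fun y => _) = cst 0); last by apply/funext => y; rewrite mul0r.
  by rewrite /Rintegral integral0.
rewrite oppr0 mul1r => /eqP; rewrite subr_eq0 => /eqP.
under eq_Rintegral do rewrite mul1r.
move=> ->; rewrite (powR_inv_neg _ r0); field.
by rewrite gt_eqF//= gt_eqF// powR_gt0.
Qed.

Lemma meanQ_ge0 r x : 0 < r -> 0 <= meanQ Gamma alpha r x.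
Proof.
move=> r0; have [G [_ _ Gpos Gint]] := power_primitive halpha r0.
rewrite (meanQ_superlevel x r0 Gint) mulr_ge0 ?divr_ge0 ?powR_ge0 ?(ltW b0)//.
by apply: Rintegral_ge0 => y [_ h]; exact/ltW/Gpos.
Qed.

(** An average for a probability density cannot exceed the maximum, and [Q_r] is nonnegative. *)
Lemma La_quotient_max r x (z : rV -> R) : 0 < r -> continuous z -> (forall y, z y <= z x) ->
  La_quotient A Gamma alpha z x r <= 0.
Proof.
move=> r0 cz zx; apply: mulr_le0_ge0; last by rewrite invr_ge0 meanQ_ge0.
have [iz ->] := meanM_superlevel x r0 cz; have [iw w1] := weighted_density_mass x r0.
have mB := measurable_superlevel r x.
have iw' : mu.-integrable (superlevel r x)
    (EFin \o (fun y => z x * weighted_density A Gamma (powp alpha) x y)).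
  exact: (integrableZl mB (z x) iw).
have E : z x = beta / (r `^ beta) * \int[mu]_(y in superlevel r x)
    (z x * weighted_density A Gamma (powp alpha) x y).
  by rewrite (RintegralZl (z x) mB iw) mulrCA w1 mulr1.
rewrite subr_le0 [leRHS]E; apply: ler_wpM2l; first by rewrite divr_ge0 ?powR_ge0 ?(ltW b0).
apply: le_Rintegral => // y [xy h]; apply: ler_wpM2r => //.
by rewrite mulr_ge0 ?powR_ge0// (energy_ge0 hA).
Qed.

Lemma La_quotientB r x (u w : rV -> R) : 0 < r -> continuous u -> continuous w ->
  La_quotient A Gamma alpha (fun y => u y - w y) x r =
  La_quotient A Gamma alpha u x r - La_quotient A Gamma alpha w x r.
Proof.
move=> r0 cu cw; rewrite /La_quotient -mulrBl; congr (_ / _).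
have cuw : continuous (fun y => u y - w y).
  by move=> y; apply: (@continuousB _ _ _ u w); [exact: cu|exact: cw].
have [iu ->] := meanM_superlevel x r0 cu; have [iw ->] := meanM_superlevel x r0 cw.
have [_ ->] := meanM_superlevel x r0 cuw.
have mB := measurable_superlevel r x.
have E : \int[mu]_(y in superlevel r x) ((u y - w y) * weighted_density A Gamma (powp alpha) x y) =
  \int[mu]_(y in superlevel r x) (u y * weighted_density A Gamma (powp alpha) x y) -
  \int[mu]_(y in superlevel r x) (w y * weighted_density A Gamma (powp alpha) x y).
  rewrite -(RintegralB mB iu iw); apply: eq_Rintegral => y _; exact: mulrBl.
by rewrite E; ring.
Qed.

End averages.

(** * Potentials: decay and continuity *)

Section potential.
Context (R : realType) (n : nat).
Local Notation rV := ('rV[R]_n.+1).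
Context (A : rV -> 'M[R]_n.+1) (hA : admissible_matrix A).
Context (Gamma : rV -> rV -> R) (hG : admissible_fundamental_solution A Gamma).
Notation mu := lebesgue_rV.
Local Notation Ck1 := (@Ck R R unit (fun=> 1)).

(** The value 0 on the diagonal makes the kernel nonnegative and measurable everywhere, without
    changing the integrals in either variable. *)
Definition Gamma_off (x y : rV) : R := if x == y then 0 else Gamma x y.

Lemma Gamma_off_ge0 x y : 0 <= Gamma_off x y.
Proof. by rewrite /Gamma_off; case: eqVneq => // xy; exact/ltW/(Gamma_gt0 hG). Qed.

Lemma Gamma_off_sym x y : Gamma_off x y = Gamma_off y x.
Proof. by rewrite /Gamma_off eq_sym; case: eqVneq => // xy; rewrite (Gamma_sym hG)// eq_sym. Qed.

(** Smoothness of [Gamma] is stated on [R^(n+n)], whereas Fubini works on a product of two spaces;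
    [row_mx] is measurable from the product, coordinate by coordinate. *)
Lemma measurable_Gamma_off2 :
  measurable_fun setT (fun z : rV * rV => Gamma_off z.1 z.2).
Proof.
pose h (z : 'rV[R]_(n.+1 + n.+1)) : R := Gamma_off (lsubmx z) (rsubmx z).
rewrite (_ : (fun z => _) = h \o (fun z : rV * rV => row_mx z.1 z.2)); last first.
  by apply/funext => z; rewrite /h /= row_mxKl row_mxKr.
apply: measurableT_comp.
  rewrite (_ : h = (fun z => Gamma (lsubmx z) (rsubmx z)) \_ [set z | lsubmx z != rsubmx z]).
    apply/(measurable_restrictT _ (open_measurable_rV (@open_diag R n))).
    have [sG _] := hG; apply: open_continuous_measurable_rV; first exact: open_diag.
    by move=> z hz; exact: smooth_on_continuous sG hz.
  apply/funext => z; rewrite patchE /h /Gamma_off; case: eqVneq => xy; last by rewrite mem_set.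
  by rewrite memNset//= xy eqxx.
apply: measurable_fun_rVP => i; have [j ->|j ->] := @split_ordP n.+1 n.+1 i.
  rewrite (_ : _ \o _ = @rV_coord R n.+1 j \o fst).
    exact: (measurableT_comp (measurable_rV_coord j) measurable_fst).
  by apply/funext => z; rewrite /= /rV_coord row_mxEl.
rewrite (_ : _ \o _ = @rV_coord R n.+1 j \o snd).
  exact: (measurableT_comp (measurable_rV_coord j) measurable_snd).
by apply/funext => z; rewrite /= /rV_coord row_mxEr.
Qed.

Lemma measurable_Gamma_off x : measurable_fun setT (Gamma_off x).
Proof.
exact: (measurableT_comp measurable_Gamma_off2 (pair1_measurable x)).
Qed.

Definition potential (f : rV -> R) (x : rV) : R := \int[mu]_y (Gamma x y * f y).

Lemma integrable_potential f x : continuous f -> bounded_supp f ->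
  mu.-integrable setT (EFin \o (fun y => Gamma_off x y * f y)) /\
  potential f x = \int[mu]_y (Gamma_off x y * f y).
Proof.
move=> cf bf; have [C _ hC] := continuous_bounded_supp_bounded cf bf.
have mf := continuous_measurable_rV cf.
have ig := integrable_Gamma_mul hG x mf hC bf.
have ig' : mu.-integrable setT (EFin \o (fun y => Gamma_off x y * f y)).
  apply: le_integrable ig => //.
    by apply/measurable_EFinP; apply: measurable_funM => //; exact: measurable_Gamma_off.
  move=> y _ /=; rewrite lee_fin /Gamma_off; case: ifP => // _.
  by rewrite mul0r normr0.
split=> //; rewrite /potential (Rintegral_off x ig) (Rintegral_off x ig').
by apply: eq_Rintegral => y; rewrite inE /Gamma_off /= => /negPf ->.
Qed.

Lemma potential_decay f e : continuous f -> bounded_supp f -> 0 < e ->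
  exists M, forall x, M < `|x| -> `|potential f x| < e.
Proof.
move=> cf bf e0; have [M hM] := bf.
have iaf : mu.-integrable setT (EFin \o (fun y => `|f y|)).
  exact: (integrable_norm (integrable_continuous_bounded_supp cf bf)).
pose I := \int[mu]_y `|f y|; have I0 : 0 <= I by exact: Rintegral_ge0.
have e1 : 0 < e / (I + 1) by rewrite divr_gt0// ltr_wpDl.
have [N hN] := Gamma_decay hG (@compact_rV_le R n.+1 M) e1; exists N => x Nx.
have [ig ->] := integrable_potential x cf bf.
apply: le_lt_trans (le_normr_Rintegral measurableT ig) _.
have ie : mu.-integrable setT (EFin \o (fun y => e / (I + 1) * `|f y|)).
  exact: (integrableZl measurableT (e / (I + 1)) iaf).
apply: (@le_lt_trans _ _ (\int[mu]_y (e / (I + 1) * `|f y|))).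
  apply: le_Rintegral => //; first exact: (integrable_norm ig).
  move=> y _; rewrite normrM; have [yM|yM] := leP `|y| M; last by rewrite hM// normr0 !mulr0.
  have [xy hy] := hN x y Nx yM; apply: ler_wpM2r => //.
  by rewrite /Gamma_off (negPf xy) (gtr0_norm (Gamma_gt0 hG xy)) ltW.
rewrite (RintegralZl (e / (I + 1)) measurableT iaf) -/I mulrAC ltr_pdivrMr ?ltr_wpDl//.
by rewrite ltr_pM2l// ltrDl.
Qed.

Lemma potential_ge0 f x : continuous f -> bounded_supp f -> (forall y, 0 <= f y) -> 0 <= potential f x.
Proof.
move=> cf bf f0; have [_ ->] := integrable_potential x cf bf.
by apply: Rintegral_ge0 => y _; rewrite mulr_ge0// Gamma_off_ge0.
Qed.

Lemma potentialD f g c x : continuous f -> bounded_supp f -> continuous g -> bounded_supp g ->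
  potential (fun y => f y + c * g y) x = potential f x + c * potential g x.
Proof.
move=> cf bf cg bg.
have [C _ hC] := continuous_bounded_supp_bounded cf bf.
have [C' _ hC'] := continuous_bounded_supp_bounded cg bg.
have i1 := integrable_Gamma_mul hG x (continuous_measurable_rV cf) hC bf.
have i2 := integrable_Gamma_mul hG x (continuous_measurable_rV cg) hC' bg.
have i3 : mu.-integrable setT (EFin \o (fun y => c * (Gamma x y * g y))).
  exact: (integrableZl measurableT c i2).
rewrite /potential -(RintegralZl c measurableT i2) -(RintegralD measurableT i1 i3).
by apply: eq_Rintegral => y _; rewrite mulrDr mulrCA.
Qed.

(** Reduces continuity to sequences, along which dominated convergence runs: a discontinuity
    supplies a bad point in each ball of radius [d / (k+1)]. *)
Lemma continuous_seq (f : rV -> R) x (d : R) : 0 < d ->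
  (forall u : nat -> rV, (forall k, ball x (d / k.+1%:R) (u k)) ->
     f (u k) @[k --> \oo] --> f x) -> {for x, continuous f}.
Proof.
move=> d0 h V Vfx; apply: contrapT => hn.
have /choice[u hu] : forall k : nat, exists y, ball x (d / k.+1%:R) y /\ ~ V (f y).
  move=> k; apply: contrapT => hk; apply: hn; apply/nbhs_ballP.
  exists (d / k.+1%:R); first by rewrite /= divr_gt0.
  by move=> y bxy; apply: contrapT => Vy; apply: hk; exists y.
have [N _ hN] := h u (fun k => (hu k).1) V Vfx.
exact: (hu N).2 (hN N (leqnn N)).
Qed.

(* Since [tr A > 0], a quadratic function of one coordinate is a strict subsolution
   near [x0]. With [k = - L phi], the potential [phi] of [k] is continuous while
   [k] is bounded below near [x0]. *)
Lemma local_subsolution (x0 : rV) : exists2 phi, test_fun setT phi &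
  exists2 d, 0 < d & forall y, ball x0 d y -> 1 <= - Lop A phi y.
Proof.
have [_ psd sA trA] := hA.
have [i Ai] : exists i, 0 < A x0 i i.
  apply: contrapT => hn; have := trA x0; rewrite ltNge => /negP; apply.
  by apply: sumr_le0 => i _; rewrite leNgt; apply/negP => h; apply: hn; exists i.
(* With this factor [L q] is [-2] at [x0]: the first order term carries [F1 c = 0], the other is
   [F2 * A x0 i i]. By continuity [- L q] stays above 1 nearby. *)
pose c := x0 ord0 i; pose F t : R := - (A x0 i i)^-1 * (t - c) ^+ 2.
pose F1 t : R := - (A x0 i i)^-1 * (2 * (t - c)).
pose F2 (t : R) : R := - (A x0 i i)^-1 * 2.
have dF (t : R) : is_derive t 1 F (F1 t).
  rewrite /F /F1; apply: is_derive_eq.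
  by rewrite /GRing.scale /=; ring.
have dF1 (t : R) : is_derive t 1 F1 (F2 t).
  rewrite /F1 /F2; apply: is_derive_eq.
  by rewrite /GRing.scale /=; ring.
pose q (y : rV) := F (y ord0 i).
have scoord := @smooth_on_coord R n.+1 setT i openT.
have Fk k : Ck1 k setT F.
  case: k => [|k].
    by split=> // t _; apply/differentiable_continuous/derivable1_diffP; have [] := dF t.
  apply: (Ck1S openT (fun t _ => dF t)); case: k => [|k].
    by split=> // t _; apply/differentiable_continuous/derivable1_diffP; have [] := dF1 t.
  apply: (Ck1S openT (fun t _ => dF1 t)); exact: Ck_cst openT.
have sq : smooth_on setT q by exact: (smooth_on_comp openT openT (fun _ _ => I) Fk scoord).
have Lq y : Lop A q y = F1 (y ord0 i) * Lop A (fun v : rV => v ord0 i) y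
    + F2 (y ord0 i) * A y i i.
  rewrite (Lop_comp hA openT scoord dF dF1)//; congr (_ + _ * _).
  rewrite /energy (bigD1 i)//= [X in _ + X]big1 ?addr0.
    rewrite (bigD1 i)//= [X in _ + X]big1 ?addr0.
      by rewrite !(partial_coord _ _ _).1 eqxx !mulr1.
    by move=> j ji; rewrite !(partial_coord _ _ _).1 eqxx (eq_sym i) (negPf ji) !mulr0.
  move=> j ji; rewrite big1// => k _.
  by rewrite !(partial_coord _ _ _).1 (eq_sym i) (negPf ji) mul0r mulr0.
have Lq0 : - Lop A q x0 = 2.
  rewrite Lq /F1 subrr !mulr0 mul0r add0r /F2 !mulNr opprK mulrAC mulVf ?mul1r//.
  by rewrite gt_eqF.
have [chi [chi' [_ chik chi0 chi1 _]]] := @smooth_step R.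
(* [S (Gamma_x0)] is 1 around [x0], so the cut-off function has the same [L] as [q] there. *)
pose S t := chi (1 * t + - 1).
have Sk k : Ck1 k setT S.
  have := @Ck1_affine R k setT chi 1 (- 1) openT (chik k).
  by rewrite (_ : [set t | _] = setT)//; exact/seteqP.
have S0 t : t <= 1 -> S t = 0 by move=> t1; rewrite /S chi0// mul1r subr_le0.
have S1 t : 2 <= t -> S t = 1 by move=> t1; rewrite /S chi1// mul1r lerBrDl.
have [sS /compact_tsuppP bS _] := test_level hG x0 ltr01 Sk S0 S1.
pose phi y := q y * level Gamma x0 S 1 y.
have sphi : smooth_on setT phi by exact: (smooth_onM openT sq sS).
exists phi.
  by split=> //; apply/compact_tsuppP; exact: bounded_suppM.
have [d d0 hd] := Gamma_pole hG x0 2.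
have cL : continuous (Lop A q) := continuous_Lop hA sq.
have cN : {for x0, continuous (fun y => - Lop A q y)} by apply: (@continuousN _ _ _ (Lop A q)); exact: cL.
have L1 : 1 < - Lop A q x0 by rewrite Lq0 ltr1n.
have : \forall y \near x0, 1 < - Lop A q y by exact: (cvgr_gt (- Lop A q x0) cN 1 L1).
move=> /nbhs_ballP[e /= e0 he]; exists (Num.min e d); first by rewrite lt_min e0.
move=> y bxy; have bd : ball x0 d y by apply: le_ball bxy; rewrite ge_min lexx orbT.
have be : ball x0 e y by apply: le_ball bxy; rewrite ge_min lexx.
have oB : open (ball x0 d) by exact: ball_open.
have -> : Lop A phi y = Lop A q y.
  apply: (Lop_ext A oB _ bd) => z bz; rewrite /phi /level; case: eqVneq => [_|xz]; first by rewrite mulr1.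
  by rewrite S1 ?mulr1//; apply/ltW/hd.
exact/ltW/he.
Qed.

(** With the first point near [x0] and the second bounded and away from [x0], the pairs stay in a
    compact set off the diagonal, where [Gamma] attains a maximum. *)
Lemma Gamma_bound_away (x0 : rV) d M : 0 < d ->
  exists2 C, 0 <= C & forall x y, ball x0 (d / 2) x -> ~ ball x0 d y -> `|y| <= M ->
    x != y /\ Gamma x y <= C.
Proof.
move=> d0; pose K := [set z : 'rV[R]_(n.+1 + n.+1) |
  [/\ `|x0 - lsubmx z| <= d / 2, d <= `|x0 - rsubmx z| & `|rsubmx z| <= M]].
have Kneq z : K z -> lsubmx z != rsubmx z.
  move=> [h1 h2 _]; apply/eqP => E; rewrite -E in h2.
  have := le_trans h2 h1; rewrite leNgt; move/negP; apply.
  by rewrite ltr_pdivrMr// ltr_pMr// ltr1n.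
have inK x y : ball x0 (d / 2) x -> ~ ball x0 d y -> `|y| <= M -> K (row_mx x y).
  rewrite -!ball_normE /= => h1 h2 h3; split; rewrite ?row_mxKl ?row_mxKr ?(ltW h1)//.
  by rewrite leNgt; apply/negP.
have cl : continuous (fun z : 'rV[R]_(n.+1 + n.+1) => `|x0 - lsubmx z|).
  move=> z; apply: (@continuous_comp _ _ _ (fun z => x0 - lsubmx z) (fun v : rV => `|v|)); last exact: norm_continuous.
  apply: (@continuousB _ _ _ (cst x0) (fun z => lsubmx z : rV)); first exact: cst_continuous.
  exact/differentiable_continuous/differentiable_lsubmx.
have cr0 : continuous (fun z : 'rV[R]_(n.+1 + n.+1) => rsubmx z : rV).
  by move=> z; exact/differentiable_continuous/differentiable_rsubmx.
have cr : continuous (fun z : 'rV[R]_(n.+1 + n.+1) => `|x0 - rsubmx z|).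
  move=> z; apply: (@continuous_comp _ _ _ (fun z => x0 - rsubmx z) (fun v : rV => `|v|)); last exact: norm_continuous.
  by apply: (@continuousB _ _ _ (cst x0) (fun z => rsubmx z : rV)); [exact: cst_continuous|exact: cr0].
have cr' : continuous (fun z : 'rV[R]_(n.+1 + n.+1) => `|rsubmx z|).
  move=> z; apply: (@continuous_comp _ _ _ (fun z => rsubmx z) (fun v : rV => `|v|)); last exact: norm_continuous.
  exact: cr0.
have cK : compact K.
  apply: bounded_closed_compact.
    exists (`|x0| + d / 2 + `|M|); split; first exact: num_real.
    move=> N MN z [h1 _ h3]; apply: le_trans (ltW MN).
    have B0 : 0 <= `|x0| + d / 2 + `|M| by rewrite !addr_ge0// divr_ge0// ltW.
    have h4 : `|lsubmx z| <= `|x0| + d / 2.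
      rewrite -[lsubmx z](subKr x0); apply: le_trans (ler_normB _ _) _.
      by rewrite lerD2l.
    apply/rV_norm_leP => // i; have [j ->|j ->] := @split_ordP n.+1 n.+1 i.
      have -> : z ord0 (lshift n.+1 j) = (lsubmx z) ord0 j by rewrite mxE.
      by apply: le_trans (rV_coord_norm_le _ _) _; rewrite (le_trans h4)// lerDl.
    have -> : z ord0 (rshift n.+1 j) = (rsubmx z) ord0 j by rewrite mxE.
    apply: le_trans (rV_coord_norm_le _ _) _; apply: (le_trans h3).
    by rewrite (le_trans (ler_norm M))// lerDr addr_ge0// divr_ge0// ltW.
  rewrite (_ : K = ((fun z => `|x0 - lsubmx z|) @^-1` [set r | r <= d / 2]) `&`
     (((fun z => `|x0 - rsubmx z|) @^-1` [set r | d <= r]) `&`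
      ((fun z => `|rsubmx z|) @^-1` [set r | r <= M]))); last first.
    by apply/seteqP; split=> z; [case|case=> ? []].
  apply: closedI; [|apply: closedI]; apply: closed_comp => [z _|];
    [exact: cl|exact: closed_le|exact: cr|exact: closed_ge|exact: cr'|exact: closed_le].
have [[z0 Kz0]|K0] := pselect (K !=set0); last first.
  exists 0 => // x y hx hy hM; exfalso; apply: K0; exists (row_mx x y); exact: inK.
have [||z1 _ hz1] := @EVT_max_rV R _ (fun z => Gamma (lsubmx z) (rsubmx z)) K _ cK.
- by exists z0.
- apply: continuous_in_subspaceT => z; rewrite inE => Kz.
  have [sG _] := hG; exact: (smooth_on_continuous sG (Kneq z Kz)).
exists `|Gamma (lsubmx z1) (rsubmx z1)| => // x y hx hy hM; have Kxy := inK x y hx hy hM.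
have := Kneq _ Kxy; rewrite row_mxKl row_mxKr => xy; split=> //.
have := hz1 (row_mx x y); rewrite inE row_mxKl row_mxKr => /(_ Kxy) h.
exact: le_trans h (ler_norm _).
Qed.

Lemma Gamma_off_cvg (u : nat -> rV) x0 y (d : R) : 0 < d ->
  (forall k, ball x0 (d / k.+1%:R) (u k)) -> x0 != y ->
  Gamma_off (u k) y @[k --> \oo] --> Gamma_off x0 y.
Proof.
move=> d0 hu xy; apply/cvgrPdist_lt => e e0.
have [d1 d10 hd1] := Gamma_continuous2 hG xy e0.
have xy0 : 0 < `|x0 - y| by rewrite normr_gt0 subr_eq0.
pose d2 := Num.min d1 `|x0 - y|; have d20 : 0 < d2 by rewrite lt_min d10.
exists (Num.truncn (d / d2)).+1 => // k /= Nk.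
have hk : d / k.+1%:R <= d2.
  rewrite ler_pdivrMr// -ler_pdivrMl// mulrC.
  by apply/ltW/(lt_le_trans (truncnS_gt _)); rewrite ler_nat leqW.
have b1 : ball x0 d1 (u k) by apply: le_ball (hu k); rewrite (le_trans hk)// ge_min lexx.
have b2 : ball x0 `|x0 - y| (u k) by apply: le_ball (hu k); rewrite (le_trans hk)// ge_min lexx orbT.
have uy : u k != y by apply/eqP => uy; move: b2; rewrite uy -ball_normE /= ltxx.
rewrite /Gamma_off (negPf xy) (negPf uy); apply: hd1 => //; exact: ballxx.
Qed.

Lemma ball_seq_cvg (u : nat -> rV) x0 (d : R) : 0 < d ->
  (forall k, ball x0 (d / k.+1%:R) (u k)) -> u k @[k --> \oo] --> x0.
Proof.
move=> d0 hu V /nbhs_ballP[e /= e0 eV].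
exists (Num.truncn (d / e)).+1 => // k /= Nk; apply: eV; apply: le_ball (hu k).
rewrite ler_pdivrMr// -ler_pdivrMl// mulrC.
by apply/ltW/(lt_le_trans (truncnS_gt _)); rewrite ler_nat leqW.
Qed.

(* Scheffe's argument: [|Gamma_{u_m} - Gamma_{x0}|] is its signed version, whose
   integral against [k] is [phi u_m - phi x0], plus twice its negative part, which
   is dominated by [Gamma_{x0}]. *)
Lemma continuous_potential f : continuous f -> bounded_supp f -> continuous (potential f).
Proof.
move=> cf bf x0; have [phi tphi [d d0 hk]] := local_subsolution x0.
have [sphi /compact_tsuppP bphi _] := tphi.
pose k y := - Lop A phi y.
have ck : continuous k by move=> y; apply: (@continuousN _ _ _ (Lop A phi)); exact: (continuous_Lop hA sphi).
have bk : bounded_supp k by apply: bounded_suppN; exact: bounded_supp_Lop.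
have potk x : potential k x = phi x.
  have [_ [_ _ _ _ /(_ _ tphi x) h]] := hG.
  have [C _ hC] := continuous_bounded_supp_bounded ck bk.
  have ik := integrable_Gamma_mul hG x (continuous_measurable_rV ck) hC bk.
  rewrite -[phi x]opprK -h /potential -[LHS]opprK; congr (- _).
  rewrite -mulN1r -(RintegralZl (- 1) measurableT ik); apply: eq_Rintegral => y _.
  by rewrite mulN1r mulrN opprK.
have [F F0 hF] := continuous_bounded_supp_bounded cf bf.
have [Mf hMf] := bf; have [Mk hMk] := bk.
have [C C0 hC] := Gamma_bound_away x0 (Num.max Mf Mk) d0.
pose B := ball x0 d; have mB : measurable B by exact: measurable_ball_rV.
have Bx0 : B x0 by exact: ballxx.
have B1 y : B y -> \1_B y = 1 :> R by move=> By; rewrite indicE mem_set.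
have B0 y : ~ B y -> \1_B y = 0 :> R by move=> By; rewrite indicE memNset.
have d20 : 0 < d / 2 by rewrite divr_gt0.
apply: (continuous_seq d20) => u hu.
have hu2 m : ball x0 (d / 2) (u m).
  apply: le_ball (hu m); rewrite ler_pdivrMr// ler_peMr ?(ltW d20)// ler1n//.
pose D m y := Gamma_off (u m) y - Gamma_off x0 y.
(* [Rm] is built so that [|D f| <= F * D * k + Rm]. Inside [B], [k >= 1] gives
   [|D f| <= F * |D| * k] and [R1] turns [|D|] into [D]; outside [B], [R2] is the exact
   difference. *)
pose R1 m y := F * ((`|D m y| - D m y) * k y).
pose R2 m y := `|D m y| * `|f y| - F * (D m y * k y).
pose Rm m y := \1_B y * R1 m y + (1 - \1_B y) * R2 m y.
(* Dominates all the [Rm m]: inside [B], [|D| - D] is at most twice the kernel at [x0]; outside,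
   both kernels are at most [C] wherever [f] or [k] is nonzero. *)
pose g y := 2 * C * (`|f y| + F * `|k y|) + 2 * F * (Gamma_off x0 y * `|k y|).
have caf : continuous (fun y => `|f y|).
  by move=> y; apply: (@continuous_comp _ _ _ f (fun r : R => `|r|)); [exact: cf|exact: norm_continuous].
have cak : continuous (fun y => `|k y|).
  by move=> y; apply: (@continuous_comp _ _ _ k (fun r : R => `|r|)); [exact: ck|exact: norm_continuous].
have baf : bounded_supp (fun y => `|f y|) by exists Mf => y /hMf ->; rewrite normr0.
have bak : bounded_supp (fun y => `|k y|) by exists Mk => y /hMk ->; rewrite normr0.
have iaf := integrable_continuous_bounded_supp caf baf.
have iak := integrable_continuous_bounded_supp cak bak.
have [iGk _] := integrable_potential x0 cak bak.
have ig : mu.-integrable setT (EFin \o g).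
  have i1 := integrableD measurableT iaf (integrableZl measurableT F iak).
  exact: (integrableD measurableT (integrableZl measurableT (2 * C) i1)
    (integrableZl measurableT (2 * F) iGk)).
have mD m : measurable_fun setT (D m).
  by apply: measurable_funB; exact: measurable_Gamma_off.
have mk := continuous_measurable_rV ck.
have mR m : measurable_fun setT (Rm m).
  have mB1 : measurable_fun setT (\1_B : rV -> R) by exact: measurable_indic.
  have mDn : measurable_fun setT (fun y => `|D m y|) by apply: measurableT_comp.
  apply: measurable_funD; apply: measurable_funM => //.
  - apply: measurable_funM => //; apply: measurable_funM => //.
    exact: measurable_funB.
  - exact: measurable_funB.
  - apply: measurable_funB; first by apply: measurable_funM => //; exact: continuous_measurable_rV.
    by apply: measurable_funM => //; apply: measurable_funM.
have Rm_cvg y : Rm m y @[m --> \oo] --> (0 : R).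
  have [xy|xy] := eqVneq x0 y.
    rewrite (_ : Rm ^~ y = cst 0); first exact: cvg_cst.
    (* At [y = x0] the kernel of [x0] was set to 0, so [D >= 0] and the remainder vanishes for every
       [m]. *)
    apply/funext => m; have D0 : 0 <= D m x0.
      by rewrite /D [X in _ - X]/Gamma_off eqxx subr0 Gamma_off_ge0.
    have b1 : \1_B x0 = 1 :> R := B1 _ Bx0.
    by rewrite /Rm -xy b1 (subrr (1 : R)) mul0r addr0 /R1 (ger0_norm D0) (subrr (D m x0)) mul0r !mulr0.
  have D0 : D m y @[m --> \oo] --> (0 : R).
    rewrite -(subrr (Gamma_off x0 y)); apply: cvgB; last exact: cvg_cst.
    exact: Gamma_off_cvg hu xy.
  have nD0 : `|D m y| @[m --> \oo] --> (0 : R) by rewrite -(normr0 R); apply: cvg_norm.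
  have c1 : R1 m y @[m --> \oo] --> F * ((0 - 0) * k y).
    by apply: cvgM; [exact: cvg_cst|apply: cvgM; [exact: cvgB|exact: cvg_cst]].
  have c2 : R2 m y @[m --> \oo] --> 0 * `|f y| - F * (0 * k y).
    apply: cvgB; first by apply: cvgM; [exact: nD0|exact: cvg_cst].
    by apply: cvgM; [exact: cvg_cst|apply: cvgM; [exact: D0|exact: cvg_cst]].
  have -> : (0 : R) = \1_B y * (F * ((0 - 0) * k y)) + (1 - \1_B y) * (0 * `|f y| - F * (0 * k y)).
    by rewrite subr0 !mul0r !mulr0 subr0 mulr0 addr0.
  by apply: cvgD; apply: cvgM => //; exact: cvg_cst.
have Rm_le m y : `|Rm m y| <= g y.
  have g1 : 0 <= 2 * C * (`|f y| + F * `|k y|) by rewrite !mulr_ge0// addr_ge0// mulr_ge0.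
  have g2 : 0 <= 2 * F * (Gamma_off x0 y * `|k y|) by rewrite !mulr_ge0// Gamma_off_ge0.
  have [By|By] := pselect (B y).
    rewrite /Rm (B1 _ By) subrr mul0r addr0 mul1r /R1 /g.
    apply: (@le_trans _ _ (2 * F * (Gamma_off x0 y * `|k y|))); last by rewrite lerDr.
    rewrite !normrM (ger0_norm F0) mulrA [2 * F]mulrC -!mulrA ler_wpM2l// mulrA ler_wpM2r//.
    have := Gamma_off_ge0 (u m) y; have := Gamma_off_ge0 x0 y; rewrite /D.
    move: (Gamma_off (u m) y) (Gamma_off x0 y) => p q q0 p0.
    have [h|h] := leP 0 (p - q); first by rewrite (ger0_norm h) (subrr (p - q)) normr0 mulr_ge0.
    by rewrite (ltr0_norm h) ger0_norm; clear -h p0 q0; lra.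
  rewrite /Rm (B0 _ By) mul0r add0r subr0 mul1r /g.
  apply: (@le_trans _ _ (2 * C * (`|f y| + F * `|k y|))); last by rewrite lerDl.
  rewrite /R2; have [yM|yM] := leP `|y| (Num.max Mf Mk); last first.
    move: yM; rewrite gt_max => /andP[y1 y2].
    by rewrite (hMf _ y1) (hMk _ y2) normr0 !mulr0 addr0 subr0 normr0 mulr0.
  have [xy1 h1] := hC _ _ (hu2 m) By yM.
  have [xy2 h2] := hC _ _ (ballxx x0 d20) By yM.
  have Dle : `|D m y| <= 2 * C.
    apply: le_trans (ler_normB _ _) _; rewrite !(ger0_norm (Gamma_off_ge0 _ _)).
    by rewrite mulrDl mul1r /Gamma_off (negPf xy1) (negPf xy2) lerD.
  apply: le_trans (ler_normB _ _) _.
  rewrite !normrM !normr_id (ger0_norm F0) mulrCA -mulrDr ler_wpM2r//.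
  by rewrite addr_ge0// mulr_ge0.
have [_ IR] := dominated_cvg_Rintegral measurableT mR (fun y _ => Rm_cvg y) ig (fun m y _ => Rm_le m y).
rewrite (Rintegral_cst mu measurableT) mul0r in IR.
have uc := ball_seq_cvg d20 hu.
have cphi : phi (u m) @[m --> \oo] --> phi x0.
  have := smooth_on_continuous sphi (I : setT x0); apply: cvg_comp; exact: uc.
(* The integral of [D * k] is [phi (u m) - phi x0], which tends to 0 because [phi] is smooth, so no
   estimate of [Gamma] near the diagonal is required. *)
have major m : `|potential f x0 - potential f (u m)| <=
    F * (phi (u m) - phi x0) + \int[mu]_y Rm m y.
  have [if1 ->] := integrable_potential x0 cf bf; have [if2 ->] := integrable_potential (u m) cf bf.
  rewrite -(RintegralB measurableT if1 if2).
  have iD : mu.-integrable setT (EFin \o (fun y => Gamma_off x0 y * f y - Gamma_off (u m) y * f y)).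
    exact: (integrableB measurableT if1 if2).
  apply: le_trans (le_normr_Rintegral measurableT iD) _.
  have [ik1 e1] := integrable_potential x0 ck bk; have [ik2 e2] := integrable_potential (u m) ck bk.
  rewrite -!potk e1 e2 -(RintegralB measurableT ik2 ik1).
  have iDk : mu.-integrable setT (EFin \o (fun y => Gamma_off (u m) y * k y - Gamma_off x0 y * k y)).
    exact: (integrableB measurableT ik2 ik1).
  have iFDk : mu.-integrable setT (EFin \o (fun y => F * (Gamma_off (u m) y * k y - Gamma_off x0 y * k y))).
    exact: (integrableZl measurableT F iDk).
  have iRm : mu.-integrable setT (EFin \o Rm m).
    apply: le_integrable ig => //; first exact/measurable_EFinP.
    move=> y _ /=; rewrite lee_fin (le_trans (Rm_le m y))// ler_norm//.
  rewrite -(RintegralZl F measurableT iDk) -(RintegralD measurableT iFDk iRm).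
  apply: le_Rintegral => //; first exact: (integrable_norm iD).
    exact: (integrableD measurableT iFDk iRm).
  move=> y _; rewrite -mulrBl -mulrBl normrM -/(D m y) -[X in `|X| * _]opprB normrN -/(D m y).
  rewrite /Rm; have [By|By] := pselect (B y).
    rewrite (B1 _ By) subrr mul0r addr0 mul1r /R1 -mulrDr -mulrDl addrC subrK.
    rewrite mulrCA ler_wpM2l//; apply: (@le_trans _ _ (F * 1)); first by rewrite mulr1.
    by rewrite ler_wpM2l// /k hk.
  by rewrite (B0 _ By) mul0r add0r subr0 mul1r /R2 addrCA subrr addr0.
apply/cvgrPdist_le => e e0.
have lim0 : F * (phi (u m) - phi x0) + \int[mu]_y Rm m y @[m --> \oo] --> F * (phi x0 - phi x0) + 0.
  apply: cvgD; last exact: IR.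
  by apply: cvgM; [exact: cvg_cst|apply: cvgB; [exact: cphi|exact: cvg_cst]].
rewrite subrr mulr0 addr0 in lim0.
move/cvgrPdist_le : lim0 => /(_ e e0) [N _ hN]; exists N => // m /hN /=.
rewrite sub0r normrN => h; apply: le_trans (major m) _.
exact: le_trans (ler_norm _) h.
Qed.

End potential.

(** * Potentials as weak solutions; the distributional equation *)

Lemma Rintegral_swap d1 d2 (T1 : measurableType d1) (T2 : measurableType d2) (R : realType)
    (m1 : {sigma_finite_measure set T1 -> \bar R})
    (m2 : {sigma_finite_measure set T2 -> \bar R}) (F : T1 * T2 -> R) :
  measurable_fun setT F ->
  (forall x, m2.-integrable setT (fun y => (F (x, y))%:E)) ->
  (forall y, m1.-integrable setT (fun x => (F (x, y))%:E)) ->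
  m1.-integrable setT (fun x => (\int[m2]_y `|F (x, y)|)%:E) ->
  \int[m1]_x \int[m2]_y F (x, y) = \int[m2]_y \int[m1]_x F (x, y).
Proof.
move=> mF i2 i1 iN.
have mEF : measurable_fun setT (EFin \o F) by exact/measurable_EFinP.
have iF : (m1 \x m2)%E.-integrable setT (EFin \o F).
  apply/(integrable12ltyP m1 m2 mEF).
  rewrite [ltLHS](_ : _ = (\int[m1]_x (\int[m2]_y `|F (x, y)|)%R%:E)%E); last first.
    apply: eq_integral => x _; rewrite /Rintegral fineK.
      by apply: eq_integral => y _.
    have /= := integrable_fin_num measurableT (integrable_norm (i2 x)).
    by apply.
  have := integrable_fin_num measurableT iN.
  by rewrite fin_numElt => /andP[].
transitivity (fine (\int[m1]_x \int[m2]_y (EFin \o F) (x, y))%E).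
  congr fine; apply: eq_integral => x _; rewrite /Rintegral fineK//.
  exact: (integrable_fin_num measurableT (i2 x)).
rewrite (Fubini iF); congr fine; apply: eq_integral => y _.
rewrite /Rintegral fineK//; exact: (integrable_fin_num measurableT (i1 y)).
Qed.

Section weak_solutions.
Context (R : realType) (n : nat).
Local Notation rV := ('rV[R]_n.+1).
Context (A : rV -> 'M[R]_n.+1) (hA : admissible_matrix A).
Context (Gamma : rV -> rV -> R) (hG : admissible_fundamental_solution A Gamma).
Notation mu := lebesgue_rV.

(** By Fubini and the symmetry of [Gamma], pairing the potential of [f] with [L phi] amounts to
    pairing [f] with the potential of [L phi], which is [- phi]. *)
Lemma weak_solution_potential f : continuous f -> bounded_supp f ->
  weak_solution A (potential Gamma f) f.
Proof.
move=> cf bf phi tphi; have [sphi /compact_tsuppP bphi _] := tphi.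
have cL : continuous (Lop A phi) by exact: (continuous_Lop hA sphi).
have bL := bounded_supp_Lop A bphi.
pose F (z : rV * rV) : R := Gamma_off Gamma z.1 z.2 * (f z.2 * Lop A phi z.1).
have caf : continuous (fun y => `|f y|).
  by move=> y; apply: (@continuous_comp _ _ _ f (fun r : R => `|r|)); [exact: cf|exact: norm_continuous].
have baf : bounded_supp (fun y => `|f y|) by have [M hM] := bf; exists M => y /hM ->; rewrite normr0.
have caL : continuous (fun y => `|Lop A phi y|).
  by move=> y; apply: (@continuous_comp _ _ _ (Lop A phi) (fun r : R => `|r|)); [exact: cL|exact: norm_continuous].
have baL : bounded_supp (fun y => `|Lop A phi y|) by have [M hM] := bL; exists M => y /hM ->; rewrite normr0.
have mF : measurable_fun setT F.
  apply: measurable_funM; first exact: (measurable_Gamma_off2 hG).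
  apply: measurable_funM.
    exact: (measurableT_comp (continuous_measurable_rV cf) measurable_snd).
  exact: (measurableT_comp (continuous_measurable_rV cL) measurable_fst).
have F2 x y : F (x, y) = Lop A phi x * (Gamma_off Gamma x y * f y).
  by rewrite /F /= mulrA mulrC.
have F1 x y : F (x, y) = f y * (Gamma_off Gamma y x * Lop A phi x).
  by rewrite /F /= mulrCA (Gamma_off_sym hG).
have i2 x : mu.-integrable setT (fun y => (F (x, y))%:E).
  rewrite (_ : (fun y => _) = EFin \o (fun y => Lop A phi x * (Gamma_off Gamma x y * f y))); last first.
    by apply/funext => y; rewrite F2.
  have [ig _] := integrable_potential hG x cf bf; exact: (integrableZl measurableT (Lop A phi x) ig).
have i1 y : mu.-integrable setT (fun x => (F (x, y))%:E).
  rewrite (_ : (fun x => _) = EFin \o (fun x => f y * (Gamma_off Gamma y x * Lop A phi x))); last first.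
    by apply/funext => x; rewrite F1.
  have [ig _] := integrable_potential hG y cL bL; exact: (integrableZl measurableT (f y) ig).
(* Integrating in [y] leaves the potential of [|f|] times [|L phi|]: the first is continuous by the
   previous part, the second is continuous with bounded support. *)
have iN : mu.-integrable setT (fun x => (\int[mu]_y `|F (x, y)|)%:E).
  rewrite (_ : (fun x => _) = EFin \o (fun x => potential Gamma (fun y => `|f y|) x * `|Lop A phi x|)).
    have cp := continuous_potential hA hG caf baf.
    apply: integrable_continuous_bounded_supp; last exact: bounded_suppM.
    move=> x; apply: (@continuousM _ _ (potential Gamma (fun y => `|f y|)) (fun y => `|Lop A phi y|)).
      exact: cp.
    exact: caL.
  apply/funext => x /=; congr EFin; have [ig ->] := integrable_potential hG x caf baf.
  rewrite mulrC -(RintegralZl `|Lop A phi x| measurableT ig); apply: eq_Rintegral => y _.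
  by rewrite F2 !normrM (ger0_norm (Gamma_off_ge0 hG x y)).
have S := Rintegral_swap mF i2 i1 iN.
transitivity (\int[mu]_x \int[mu]_y F (x, y)).
  apply: eq_Rintegral => x _; have [ig ->] := integrable_potential hG x cf bf.
  rewrite mulrC -(RintegralZl (Lop A phi x) measurableT ig); apply: eq_Rintegral => y _.
  by rewrite F2.
rewrite S.
have ifp : mu.-integrable setT (EFin \o (fun y => f y * phi y)).
  apply: integrable_continuous_bounded_supp; last exact: bounded_suppM.
  move=> y; apply: (@continuousM _ _ f phi); first exact: cf.
  exact: (smooth_on_continuous sphi (I : setT y)).
rewrite -mulN1r -(RintegralZl (- 1) measurableT ifp); apply: eq_Rintegral => y _.
have [ig e] := integrable_potential hG y cL bL.
transitivity (f y * potential Gamma (Lop A phi) y).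
  by rewrite e -(RintegralZl (f y) measurableT ig); apply: eq_Rintegral => x _; rewrite F1.
have [_ [_ _ _ _ /(_ _ tphi y) h]] := hG.
by rewrite /potential h mulrN mulN1r.
Qed.

(** Moving the derivatives onto [phi] produces the transposed sum of
    [partial j (A i j * partial i phi)]; symmetry of [A] and an exchange of sums restore [Lop]. *)
Lemma Lop_distE u phi : continuous u -> test_fun setT phi ->
  Lop_dist A (regular_dist setT u) phi = \int[mu]_y (u y * Lop A phi y).
Proof.
move=> cu [sphi /compact_tsuppP bphi _].
pose V i j : rV -> R := fun y => partial j (fun z => A z i j * partial i phi z) y.
have iV i j : mu.-integrable setT (EFin \o (fun y => u y * V i j y)).
  have sAp : smooth_on setT (fun z => A z i j * partial i phi z).
    rewrite (_ : (fun z => _) = (fun z => A z j i * partial i phi z)).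
      exact: (smooth_flux hA j i openT sphi).
    by apply/funext => z; rewrite (A_sym hA).
  apply: integrable_continuous_bounded_supp.
    move=> y; apply: (@continuousM _ _ u (V i j)); first exact: cu.
    exact: (smooth_on_continuous (smooth_on_partial j sAp) (I : setT y)).
  by apply: bounded_suppM; apply: bounded_supp_partial; apply: bounded_suppM; exact: bounded_supp_partial.
transitivity (\sum_i \sum_j \int[mu]_y (u y * V i j y)).
  apply: eq_bigr => i _; apply: eq_bigr => j _.
  by rewrite /dist_partial /dist_mul /regular_dist opprK.
transitivity (\int[mu]_y \sum_i \sum_j u y * V i j y).
  rewrite (@Rintegral_sum _ _ _ _ _ (index_enum _) _ _ measurableT); last first.
    move=> i; apply: integrable_Rsum => //.
  by apply: eq_bigr => i _; rewrite (@Rintegral_sum _ _ _ _ _ (index_enum _) _ _ measurableT).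
apply: eq_Rintegral => y _; rewrite /Lop exchange_big big_distrr; apply: eq_bigr => i _.
rewrite big_distrr; apply: eq_bigr => j _ /=; congr (_ * _).
by rewrite /V; congr (partial i _ y); apply/funext => z; rewrite (A_sym hA).
Qed.

Lemma dist_eq_weak_solution u f : continuous u -> continuous f ->
  dist_eq_on setT (Lop_dist A (regular_dist setT u)) (regular_dist setT (fun x => - f x)) <->
  weak_solution A u f.
Proof.
move=> cu cf; suff E phi : test_fun setT phi ->
    regular_dist setT (fun x => - f x) phi = - \int[mu]_y (f y * phi y).
  by split=> H phi tphi; have := H phi tphi; rewrite (Lop_distE cu tphi) (E _ tphi).
move=> [sphi /compact_tsuppP bphi _].
have ifp : mu.-integrable setT (EFin \o (fun y => f y * phi y)).
  apply: integrable_continuous_bounded_supp; last exact: bounded_suppM.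
  move=> y; apply: (@continuousM _ _ f phi); first exact: cf.
  exact: (smooth_on_continuous sphi (I : setT y)).
rewrite -mulN1r -(RintegralZl (- 1) measurableT ifp); apply: eq_Rintegral => y _.
by rewrite mulN1r mulNr.
Qed.

End weak_solutions.

(** * Comparison with the potential *)

Section maximum_principle.
Context (R : realType) (n : nat).
Local Notation rV := ('rV[R]_n.+1).
Context (A : rV -> 'M[R]_n.+1) (hA : admissible_matrix A).
Context (Gamma : rV -> rV -> R) (hG : admissible_fundamental_solution A Gamma).
Context (alpha : R) (halpha : -1 < alpha).

(* At a maximum of [u - potential (f + eps g)] all quotients are nonpositive, while
   they converge to [eps * g > 0]. *)
Lemma La_quotient_le_potential u f : continuous u -> bounded_supp u ->
  continuous f -> bounded_supp f ->
  (forall x, La_quotient A Gamma alpha u x r @[r --> 0^'+] --> - f x) ->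
  forall x, u x <= potential Gamma f x.
Proof.
move=> cu [Mu hMu] cf bf Lu x0; rewrite leNgt; apply/negP => hx0.
set c := u x0 - potential Gamma f x0; have c0 : 0 < c by rewrite subr_gt0.
have c20 : 0 < c / 2 by rewrite divr_gt0.
have [N hN] := potential_decay hG cf bf c20.
(* Outside the ball of radius [M], [u] vanishes and the potential is below [c / 2] in absolute
   value, so the excess there is less than [c / 2]. *)
pose M := Num.max Mu N.
have out y : M < `|y| -> u y - potential Gamma f y < c / 2.
  rewrite gt_max => /andP[/hMu -> /hN]; rewrite sub0r.
  by apply: le_lt_trans; rewrite -normrN ler_norm.
have Mx0 : `|x0| <= M.
  rewrite leNgt; apply/negP => /out; rewrite -/c ltNge => /negP; apply.
  by rewrite ler_pdivrMr// ler_peMr ?ler1n// ltW.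
(* A continuous nonnegative function of bounded support that is positive on the whole closed ball of
   radius [M], where the maximum will be found. *)
pose g (y : rV) : R := Num.max 0 (M + 1 - `|y|).
have cg : continuous g.
  move=> y; apply: (@continuous_max _ _ (cst 0) (fun y : rV => M + 1 - `|y|)).
    exact: cst_continuous.
  apply: (@continuousB _ _ _ (cst (M + 1)) (fun y : rV => `|y|)); first exact: cst_continuous.
  exact: norm_continuous.
have bg : bounded_supp g.
  by exists (M + 1) => y hy; rewrite /g; apply/max_idPl; rewrite subr_le0 ltW.
have g0 y : 0 <= g y by rewrite /g le_max lexx.
have P0 y : 0 <= potential Gamma g y := potential_ge0 hG y cg bg g0.
(* The perturbation then costs less than [c / 2] at [x0], which leaves [z x0 > c / 2]. Outside the
   ball it only lowers [z], so the maximum over the ball is global. *)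
pose e := c / 2 / (potential Gamma g x0 + 1).
have p1 : 0 < potential Gamma g x0 + 1 by rewrite ltr_wpDl.
have e0 : 0 < e by rewrite divr_gt0.
have eP : e * potential Gamma g x0 < c / 2.
  by rewrite /e mulrAC ltr_pdivrMr// ltr_pM2l// ltrDl.
pose h y := f y + e * g y.
have ch : continuous h.
  move=> y; apply: (@continuousD _ _ _ f (fun y => e * g y)); first exact: cf.
  by apply: (@continuousM _ _ (cst e) g); [exact: cst_continuous|exact: cg].
have bh : bounded_supp h.
  have [Mf hMf] := bf; have [Mg hMg] := bg; exists (Num.max Mf Mg) => y.
  by rewrite gt_max => /andP[y1 y2]; rewrite /h hMf// hMg// mulr0 addr0.
have cw := continuous_potential hA hG ch bh.
have ww := weak_solution_potential hA hG ch bh.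
pose z y := u y - potential Gamma h y.
have cz : continuous z.
  by move=> y; apply: (@continuousB _ _ _ u (potential Gamma h)); [exact: cu|exact: cw].
have zE y : z y = u y - potential Gamma f y - e * potential Gamma g y.
  by rewrite /z (potentialD hG e y cf bf cg bg) opprD addrA.
have z0 : c / 2 < z x0.
  rewrite zE -/c -ltrBlDr opprK -ltrBrDl; apply: (lt_le_trans eP).
  by rewrite [X in X - _]splitr addrK.
have [||x1 /[!inE] Kx1 hx1] := @EVT_max_rV R _ z _ _ (@compact_rV_le R n.+1 M).
- by exists x0.
- by apply: continuous_in_subspaceT => y _; exact: cz.
have zmax y : z y <= z x1.
  have [yM|yM] := leP `|y| M; first by apply: hx1; rewrite inE.
  apply: (@le_trans _ _ (z x0)); last by apply: hx1; rewrite inE.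
  apply/ltW/(le_lt_trans _ z0); rewrite zE; apply: le_trans (ltW (out y yM)).
  by rewrite gerBl mulr_ge0// ltW.
have gx1 : 0 < g x1.
  by rewrite /g lt_max subr_gt0; apply/orP; right; rewrite (le_lt_trans Kx1)// ltrDl.
have cq : La_quotient A Gamma alpha z x1 r @[r --> 0^'+] --> e * g x1.
  have -> : e * g x1 = - f x1 - - h x1 by rewrite opprK /h addKr.
  have cB : La_quotient A Gamma alpha u x1 r - La_quotient A Gamma alpha (potential Gamma h) x1 r
      @[r --> 0^'+] --> - f x1 - - h x1.
    by apply: cvgB; [exact: Lu|exact: (La_quotient_cvg hA hG halpha ww cw ch)].
  apply: cvg_trans cB; apply: near_eq_cvg; near=> r.
  by rewrite (La_quotientB hA hG halpha x1 _ cu cw).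
have : e * g x1 <= 0.
  apply: (cvgr_to_le cq); near=> r.
  exact: (La_quotient_max hA hG halpha _ cz zmax).
by rewrite leNgt mulr_gt0.
Unshelve. all: by end_near.
Qed.

End maximum_principle.

Theorem theorem1p6 (R : realType) (n : nat)
    (A : 'rV[R]_n -> 'M[R]_n) (Gamma : 'rV[R]_n -> 'rV[R]_n -> R) (alpha : R)
    (hA : admissible_matrix A)
    (hL : hypoelliptic A)
    (hGamma : admissible_fundamental_solution A Gamma)
    (halpha : -1 < alpha)
    (f u : 'rV[R]_n -> R)
    (cf : continuous f) (sf : compact (tsupp f))
    (cu : continuous u) (su : compact (tsupp u)) :
  (La_domain A Gamma alpha u /\ forall x, La A Gamma alpha u x = - f x) <->
  dist_eq_on setT (Lop_dist A (regular_dist setT u))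
                  (regular_dist setT (fun x => - f x)).
Proof.
clear hL; move: A Gamma hA hGamma f u cf sf cu su; case: n => [|n] A Gamma hA hG f u cf sf cu su.
  (* In dimension 0 the trace is an empty sum and cannot be positive. *)
  by have [_ _ _ /(_ 0)] := hA; rewrite /mxtrace big_ord0 ltxx.
have bf := (compact_tsuppP f).1 sf; have bu := (compact_tsuppP u).1 su.
apply: (iff_trans _ (iff_sym (dist_eq_weak_solution hA cu cf))); split; last first.
  move=> wu.
  have Lu x : La_quotient A Gamma alpha u x r @[r --> 0^'+] --> - f x.
    exact: (La_quotient_cvg hA hG halpha wu cu cf).
  split; first by split=> // x; apply/cvg_ex; exists (- f x); exact: Lu.
  by move=> x; exact: (cvg_lim (@norm_hausdorff _ R) (Lu x)).
case=> -[_ Cu] Lu.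
have {Cu}Lu x : La_quotient A Gamma alpha u x r @[r --> 0^'+] --> - f x.
  by rewrite -Lu; exact: Cu.
(* The comparison applied to [(u, f)] and to [(- u, - f)] gives the two inequalities. *)
suff <- : potential Gamma f = u by exact: (weak_solution_potential hA hG cf bf).
apply/funext => x; apply/eqP; rewrite eq_le (La_quotient_le_potential hA hG halpha cu bu cf bf Lu) andbT.
have cNu : continuous (fun y => - u y) by move=> y; apply: (@continuousN _ _ _ u); exact: cu.
have cNf : continuous (fun y => - f y) by move=> y; apply: (@continuousN _ _ _ f); exact: cf.
have LNu y : La_quotient A Gamma alpha (fun t => - u t) y r @[r --> 0^'+] --> - - f y.
  have c0 : - La_quotient A Gamma alpha u y r @[r --> 0^'+] --> - - f y by apply: cvgN; exact: Lu.
  apply: cvg_trans c0; apply: near_eq_cvg; near=> r.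
  have r0 : 0 < r by [].
  have cuu : continuous (fun t => u t - u t).
    by move=> t; apply: (@continuousB _ _ _ u u); exact: cu.
  (* [- u] is written [(u - u) - u], so that oddness of the quotient follows from its behaviour on
     differences. *)
  have := La_quotientB hA hG halpha y r0 cuu cu; rewrite (La_quotientB hA hG halpha y r0 cu cu).
  by rewrite subrr sub0r => <-; congr (La_quotient _ _ _ _ _ _); apply/funext => t; rewrite subrr sub0r.
have := La_quotient_le_potential hA hG halpha cNu (bounded_suppN bu) cNf (bounded_suppN bf) LNu x.
have -> : potential Gamma (fun y => - f y) x = - potential Gamma f x.
  (* [- f = f + (-2) f] puts the negation in the form of [potentialD]. *)
  have := potentialD hG (- 2) x cf bf cf bf.
  rewrite (_ : (fun y => f y + - 2 * f y) = (fun y => - f y)) => [->|]; last by apply/funext => y; ring.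
  by ring.
by rewrite lerN2.
Unshelve. all: by end_near.
Qed.
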